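(* Consider the following $16$ triangle groups, which are the noncocompact triangle groups of arithmetic dimension $2$ (equivalently, with quadratic invariant trace field): $\Delta(2,5,\infty)$, $\Delta(2,8,\infty)$, $\Delta(2,10,\infty)$, $\Delta(2,12,\infty)$, $\Delta(3,4,\infty)$, $\Delta(3,5,\infty)$, $\Delta(3,6,\infty)$, $\Delta(4,6,\infty)$, $\Delta(4,12,\infty)$, $\Delta(5,5,\infty)$, $\Delta(8,8,\infty)$, $\Delta(10,10,\infty)$, $\Delta(12,12,\infty)$, $\Delta(4,\infty,\infty)$, $\Delta(5,\infty,\infty)$, $\Delta(6,\infty,\infty)$. They are partitioned by commensurability into exactly the following nine classes: - with invariant trace field $\mathbb Q(\sqrt2)$: $\{\Delta(2,8,\infty),\Delta(8,8,\infty),\Delta(4,\infty,\infty)\}$ and $\{\Delta(3,4,\infty)\}$; - with invariant trace field $\mathbb Q(\sqrt3)$: $\{\Delta(2,12,\infty),\Delta(12,12,\infty),\Delta(6,\infty,\infty)\}$, $\{\Delta(4,12,\infty)\}$ and $\{\Delta(3,6,\infty)\}$; - with invariant trace field $\mathbb Q(\sqrt5)$: $\{\Delta(2,10,\infty),\Delta(10,10,\infty),\Delta(5,\infty,\infty)\}$, $\{\Delta(2,5,\infty),\Delta(5,5,\infty)\}$ and $\{\Delta(3,5,\infty)\}$; - with invariant trace field $\mathbb Q(\sqrt6)$: $\{\Delta(4,6,\infty)\}$.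
   Context: For $2\le l\le m\le n\le\infty$ with $1/l+1/m+1/n<1$, $\Delta(l,m,n)<\mathrm{PSL}_2\mathbb R$ is the orientation-preserving index-$2$ subgroup of the group generated by the reflections in the sides of a hyperbolic triangle with angles $\pi/l,\pi/m,\pi/n$ (well defined up to conjugation by isometries). $\mathrm{PSL}_2^\pm\mathbb R$ is the group of real $2\times 2$ matrices of determinant $\pm1$ modulo $\pm1$. Two subgroups $\Gamma,\Gamma'$ of $\mathrm{PSL}_2^\pm\mathbb R$ are commensurable if there exists $C\in\mathrm{PSL}_2^\pm\mathbb R$ such that $C\Gamma C^{-1}\cap\Gamma'$ has finite index both in $C\Gamma C^{-1}$ and in $\Gamma'$. The invariant trace field of $\Gamma$ is the field $F_2$ generated over $\mathbb Q$ by the traces of the elements of the subgroup $\Gamma^2$ generated by the squares of elements of $\Gamma$; the arithmetic dimension of $\Gamma$ is the number of archimedean places $\sigma:F_2\to\mathbb R$ at which the quaternion algebra $F_2[\Gamma^2]$ is split, which for noncocompact triangle groups equals the degree of $F_2$ over $\mathbb Q$. *)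

(* Defs.v *)
From HB Require Import structures.
From mathcomp Require Import all_boot all_order all_algebra.
From mathcomp Require Import all_classical all_reals all_analysis.

Set Implicit Arguments.
Unset Strict Implicit.
Unset Printing Implicit Defensive.

Import Order.TTheory GRing.Theory Num.Theory.
Import numFieldNormedType.Exports.

Local Open Scope classical_set_scope.
Local Open Scope ring_scope.

(* A subgroup of PSL_2^{+-}(R) is represented by its full preimage in the
   group of real matrices of determinant +-1, that is, by a group of such
   matrices which contains -1. This preserves inclusions, intersections,
   conjugates and indices, and turns the subgroup generated by a set into the
   smallest [psl_subgroup] containing lifts of its elements. *)
Definition psl_subgroup (R : realType) (G : set 'M[R]_2) : Prop :=
  [/\ G 1 /\ G (- 1),
      forall g, G g -> \det g = 1 \/ \det g = - 1,
      forall g h, G g -> G h -> G (g * h) &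
      forall g, G g -> G g^-1].

Definition generated_subgroup (R : realType) (S : set 'M[R]_2) : set 'M[R]_2 :=
  smallest (@psl_subgroup R) S.

(* The hyperbolic plane is {x + i y | y > 0}, with x + i y encoded as (x, y). *)
Definition upper_half_plane (R : realType) : set (R * R) := [set z | 0 < z.2].

(* For g = [a, b; c, d] of determinant 1 (resp. -1) this is the isometry
   z |-> (a w + b) / (c w + d) with w = z (resp. w the conjugate of z): the
   numerator of the real part of (a w + b) * conj (c w + d) is the same in both
   cases, and its imaginary part is y * |det g|. *)
Definition isom (R : realType) (g : 'M[R]_2) (z : R * R) : R * R :=
  let a := g 0 0 in let b := g 0 1 in let c := g 1 0 in let d := g 1 1 in
  let: (x, y) := z in
  let den := (c * x + d) ^+ 2 + (c * y) ^+ 2 in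
  ((a * c * (x ^+ 2 + y ^+ 2) + (a * d + b * c) * x + b * d) / den,
   `|\det g| * y / den).

(* A point of the closed half plane: [None] is the point oo, and [Some (x, y)]
   is x + i y, an ideal point when y = 0. *)
Definition closed_point (R : realType) (p : option (R * R)) : Prop :=
  if p is Some z then 0 <= z.2 else True.

(* When a^2 + b c > 0, the equation c (x^2 + y^2) - 2 a x - b = 0 defines the
   closure of a geodesic, which ends at oo exactly when c = 0; every geodesic is
   of this form. *)
Definition on_geodesic (R : realType) (a b c : R) (p : option (R * R)) : Prop :=
  if p is Some (x, y) then c * (x ^+ 2 + y ^+ 2) - 2 * a * x - b = 0
  else c = 0.

(* The two lifts of the reflection in the geodesic through p and q. *)
Definition reflections (R : realType) (p q : option (R * R)) : set 'M[R]_2 :=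
  [set g | exists a b c : R,
     [/\ 0 < a ^+ 2 + b * c,
         on_geodesic a b c p /\ on_geodesic a b c q,
         \det g = - 1 &
         forall z, upper_half_plane z -> on_geodesic a b c (Some z) ->
           isom g z = z]].

Definition triangle (R : realType) (p q r : option (R * R)) : Prop :=
  [/\ closed_point p, closed_point q, closed_point r &
      ~ exists a b c : R,
          [/\ 0 < a ^+ 2 + b * c,
              on_geodesic a b c p, on_geodesic a b c q & on_geodesic a b c r]].

(* A positive multiple of the tangent vector at v = (x, y) of the geodesic ray
   from v to p: the circle centred at k on the real axis through v and
   p = (x', y'), x' <> x, has tangent +-(y, k - x) at v, where
   2 (x' - x) (k - x) = (x' - x)^2 + y'^2 - y^2. *)
Definition direction (R : realType) (v : R * R) (p : option (R * R)) : R * R :=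
  if p is Some (x', y') then
    (2 * v.2 * (x' - v.1), (x' - v.1) ^+ 2 + y' ^+ 2 - v.2 ^+ 2)
  else (0, 1).

Definition vector_angle (R : realType) (u w : R * R) : R :=
  acos ((u.1 * w.1 + u.2 * w.2) /
    (Num.sqrt (u.1 ^+ 2 + u.2 ^+ 2) * Num.sqrt (w.1 ^+ 2 + w.2 ^+ 2))).

(* The angle at v of the triangle with vertices v, p, q. *)
Definition vertex_angle (R : realType) (v p q : option (R * R)) : R :=
  if v is Some z then
    if 0 < z.2 then vector_angle (direction z p) (direction z q) else 0
  else 0.

(* The parameters l, m, n of triangle groups live in [option nat], [None] being
   infinity. *)
Notation signature := (option nat * option nat * option nat)%type.

Definition le_oo (k k' : option nat) : bool :=
  match k, k' with
  | _, None => true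
  | None, Some _ => false
  | Some i, Some j => (i <= j)%N
  end.

Definition inv_oo (k : option nat) : rat := if k is Some i then i%:R^-1 else 0.

Definition hyperbolic_signature (s : signature) : Prop :=
  let: (l, m, n) := s in
  [/\ le_oo (Some 2%N) l, le_oo l m, le_oo m n &
      inv_oo l + inv_oo m + inv_oo n < 1].

(* pi / k, with pi / oo = 0 *)
Definition angle_oo (R : realType) (k : option nat) : R :=
  if k is Some i then pi / i%:R else 0.

(* G is Delta(l, m, n) for some choice of a triangle with angles pi/l, pi/m,
   pi/n. *)
Definition triangle_group (R : realType) (s : signature) (G : set 'M[R]_2) :
    Prop :=
  let: (l, m, n) := s in
  exists p q r : option (R * R),
    [/\ triangle p q r,
        vertex_angle p q r = angle_oo R l,
        vertex_angle q r p = angle_oo R m,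
        vertex_angle r p q = angle_oo R n &
        G = generated_subgroup
              (reflections p q `|` reflections q r `|` reflections r p)
            `&` [set g | \det g = 1]].

Definition cocompact (R : realType) (G : set 'M[R]_2) : Prop :=
  exists K : set (R * R),
    [/\ compact K, K `<=` @upper_half_plane R &
        forall z, upper_half_plane z -> exists2 g, G g & K (isom g z)].

Definition conjugate (R : realType) (C : 'M[R]_2) (G : set 'M[R]_2) :
    set 'M[R]_2 :=
  [set C * g * C^-1 | g in G].

Definition finite_index (R : realType) (H G : set 'M[R]_2) : Prop :=
  H `<=` G /\ finite_set [set [set g * h | h in H] | g in G].

Definition commensurable (R : realType) (G G' : set 'M[R]_2) : Prop :=
  exists C : 'M[R]_2,
    [/\ \det C = 1 \/ \det C = - 1,
        finite_index (conjugate C G `&` G') (conjugate C G) &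
        finite_index (conjugate C G `&` G') G'].

Definition subfield (R : realType) (K : set R) : Prop :=
  GRing.divring_closed [in K].

Definition generated_field (R : realType) (S : set R) : set R :=
  smallest (@subfield R) S.

(* Q(sqrt d) *)
Definition Q_sqrt (R : realType) (d : nat) : set R :=
  generated_field [set Num.sqrt d%:R].

Definition squares_subgroup (R : realType) (G : set 'M[R]_2) : set 'M[R]_2 :=
  generated_subgroup [set g * g | g in G].

Definition invariant_trace_field (R : realType) (G : set 'M[R]_2) : set R :=
  generated_field [set \tr g | g in squares_subgroup G].

(* e is a basis of the K-vector space U, for a subfield K of R *)
Definition basis_over (R : realType) (V : lmodType R) (K : set R) (U : set V)
    (d : nat) (e : 'I_d -> V) : Prop :=
  (forall i, U (e i)) /\
  forall u, U u -> exists! c : {ffun 'I_d -> R},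
    (forall i, K (c i)) /\ u = \sum_i c i *: e i.

Definition degree_over_Q (R : realType) (F : set R) (d : nat) : Prop :=
  exists e : 'I_d -> R^o, basis_over (range (@ratr R)) (F : set R^o) e.

Definition subalgebra (R : realType) (F : set R) (A : set 'M[R]_2) : Prop :=
  [/\ A 1,
      forall x y, A x -> A y -> A (x + y),
      forall x y, A x -> A y -> A (x * y) &
      forall k x, F k -> A x -> A (k *: x)].

(* F[G] *)
Definition generated_algebra (R : realType) (F : set R) (G : set 'M[R]_2) :
    set 'M[R]_2 :=
  smallest (subalgebra F) G.

(* A field embedding F -> R is encoded as its extension by zero to R, so that
   distinct functions are distinct embeddings. *)
Definition real_place (R : realType) (F : set R) (sigma : R -> R) : Prop :=
  [/\ sigma 1 = 1,
      forall x y, F x -> F y -> sigma (x + y) = sigma x + sigma y,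
      forall x y, F x -> F y -> sigma (x * y) = sigma x * sigma y &
      forall x, ~ F x -> sigma x = 0].

(* The quaternion algebra A over F is split at sigma if the tensor product of A
   with R along sigma is isomorphic to M_2(R), i.e. if there is a
   sigma-semilinear ring morphism phi : A -> M_2(R) whose R-linear extension to
   that tensor product is bijective, i.e. maps an F-basis of A to an R-basis. *)
Definition split_at (R : realType) (F : set R) (A : set 'M[R]_2)
    (sigma : R -> R) : Prop :=
  exists phi : 'M[R]_2 -> 'M[R]_2, exists e : 'I_4 -> 'M[R]_2,
    [/\ phi 1 = 1,
        forall x y, A x -> A y -> phi (x + y) = phi x + phi y,
        forall x y, A x -> A y -> phi (x * y) = phi x * phi y,
        forall k x, F k -> A x -> phi (k *: x) = sigma k *: phi x &
        basis_over F A e /\ basis_over setT setT (phi \o e)].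

Definition arithmetic_dimension (R : realType) (G : set 'M[R]_2) (d : nat) :
    Prop :=
  let F := invariant_trace_field G in
  let A := generated_algebra F (squares_subgroup G) in
  ([set sigma | real_place F sigma /\ split_at F A sigma] #= `I_d)%card.

Local Notation oo := (@None nat).

Definition sixteen_signatures : seq signature :=
  [:: (Some 2, Some 5, oo); (Some 2, Some 8, oo); (Some 2, Some 10, oo);
      (Some 2, Some 12, oo); (Some 3, Some 4, oo); (Some 3, Some 5, oo);
      (Some 3, Some 6, oo); (Some 4, Some 6, oo); (Some 4, Some 12, oo);
      (Some 5, Some 5, oo); (Some 8, Some 8, oo); (Some 10, Some 10, oo);
      (Some 12, Some 12, oo); (Some 4, oo, oo); (Some 5, oo, oo);
      (Some 6, oo, oo)]%N.

(* The nine classes, each preceded by the integer d such that the invariant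
   trace field is Q(sqrt d). *)
Definition nine_classes : seq (nat * seq signature) :=
  [:: (2, [:: (Some 2, Some 8, oo); (Some 8, Some 8, oo); (Some 4, oo, oo)]);
      (2, [:: (Some 3, Some 4, oo)]);
      (3, [:: (Some 2, Some 12, oo); (Some 12, Some 12, oo);
              (Some 6, oo, oo)]);
      (3, [:: (Some 4, Some 12, oo)]);
      (3, [:: (Some 3, Some 6, oo)]);
      (5, [:: (Some 2, Some 10, oo); (Some 10, Some 10, oo);
              (Some 5, oo, oo)]);
      (5, [:: (Some 2, Some 5, oo); (Some 5, Some 5, oo)]);
      (5, [:: (Some 3, Some 5, oo)]);
      (6, [:: (Some 4, Some 6, oo)])]%N.

(* Main.v *)
Require Import Defs.
From HB Require Import structures.
From mathcomp Require Import all_boot all_order all_algebra.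
From mathcomp Require Import all_classical all_reals all_analysis.
From mathcomp Require Import ring lra zify cyclotomic algC.
From mathcomp.real_closed Require complex.

Set Implicit Arguments.
Unset Strict Implicit.
Unset Printing Implicit Defensive.

Import Order.TTheory GRing.Theory Num.Theory.
Import numFieldNormedType.Exports.

Local Open Scope classical_set_scope.
Local Open Scope ring_scope.

(* A triangle with an ideal vertex is moved so that this vertex is oo. The triangle
   group then becomes gam a b, generated by -1, x = [a, 1; -1, 0] and
   y = [0, 1; -1, b], where a = 2 cos (pi / l), b = 2 cos (pi / m), and
   x y = - [1, -t; 0, 1] with t = a + b. Up to sign, an element is a product of
   blocks - y^k x^i whose entries are nonnegative, and even lie in {0} u [1, oo).
   Hence nonzero lower left entries are at least 1 in absolute value, which excludes
   cocompactness, and the parabolic elements are conjugate to powers of x y.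

   The invariant trace field is Q(a^2, b^2, a b), and the quaternion algebra splits at
   each real place. This field is quadratic in sixteen cases only, since otherwise
   it is Q or has three real places, found among the conjugations of a cyclotomic field.

   Commensurability inside a class comes from two inclusions of index 2. Conversely, let
   C commensurate gam a1 b1 and gam a2 b2. By the pigeonhole principle C matches
   parabolic elements, hence cusps, so that every lower left entry r1 of the first group
   has a counterpart r2 in the second with t1^2 r1^2 = q t2^2 r2^2, q rational. Taking
   r1 = -1 separates the fields. Inside one quadratic field the normal form also shows
   |r'| <= |r| for the Galois conjugate r' of an entry r of the second group, so that
   |t1' / t1| <= |t2' / t2|; this settles sqrt 2 and sqrt 5. For sqrt 3 there is equality,
   so that the adjacent cusps 0 and - a1 of the first group go to cusps of the second
   with |r'| = |r|. These are known explicitly, and their differences are not nonzero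
   rational multiples of t2 a1 / t1. *)

(** The discreteness rests on one estimate: sin (k pi / l) >= sin (pi / l) for 0 < k < l. The
    entries of the nontrivial powers of x and y are, up to sign, quotients of such sines, hence 0 or
    at least 1. The normal form only uses that the set of allowed entries contains 0 and 1 and is
    closed under sums and products. It is therefore proved over a commutative ring for any such set
    and applied twice: over R with {0} u [1, oo), and over R x R, where an entry is carried together
    with its Galois conjugate and the allowed pairs (r, r') are those with |r'| <= r. The second use
    needs the conjugate to be the smaller one in every power, so it is set up only for the groups
    that occur as targets. Commensurability being symmetric, each pair is treated in the one
    direction in which the inequality between the ratios fails. Over sqrt 3 the three groups have
    the same ratio (t' / t)^2 = (2 - sqrt 3) / (2 + sqrt 3), so that the inequality says nothing and
    the cusps of equality have to separate them. *)

Definition mx2 (A : Type) (a b c d : A) : 'M[A]_2 :=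
  \matrix_(i, j) if i == 0 then if j == 0 then a else b
                 else if j == 0 then c else d.

Lemma ord2P (i : 'I_2) : i = 0 \/ i = 1.
Proof.
by case: i => [[|[|i]] lt_i] //; [left | right]; apply/val_inj.
Qed.

(** * Two by two matrices by their entries *)

Section Mx2Entries.
Variable A : Type.
Implicit Types a b c d : A.

Lemma mx2_00 a b c d : mx2 a b c d 0 0 = a. Proof. by rewrite mxE. Qed.
Lemma mx2_01 a b c d : mx2 a b c d 0 1 = b. Proof. by rewrite mxE. Qed.
Lemma mx2_10 a b c d : mx2 a b c d 1 0 = c. Proof. by rewrite mxE. Qed.
Lemma mx2_11 a b c d : mx2 a b c d 1 1 = d. Proof. by rewrite mxE. Qed.
Definition mx2E := (mx2_00, mx2_01, mx2_10, mx2_11).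

Lemma mx2_eq (g h : 'M[A]_2) :
  g 0 0 = h 0 0 -> g 0 1 = h 0 1 -> g 1 0 = h 1 0 -> g 1 1 = h 1 1 -> g = h.
Proof.
by move=> *; apply/matrixP => i j; case: (ord2P i) (ord2P j) => -> [] ->.
Qed.

Lemma mx2_eta (g : 'M[A]_2) : g = mx2 (g 0 0) (g 0 1) (g 1 0) (g 1 1).
Proof. by apply: mx2_eq; rewrite mx2E. Qed.

Lemma mx2_ind (P : 'M[A]_2 -> Prop) :
  (forall a b c d, P (mx2 a b c d)) -> forall g, P g.
Proof. by move=> Pmx g; rewrite (mx2_eta g). Qed.

Lemma mx2_inj a b c d a' b' c' d' :
  mx2 a b c d = mx2 a' b' c' d' -> [/\ a = a', b = b', c = c' & d = d'].
Proof.
by move=> E; split; [move/matrixP/(_ 0 0): E | move/matrixP/(_ 0 1): E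
  | move/matrixP/(_ 1 0): E | move/matrixP/(_ 1 1): E]; rewrite !mx2E.
Qed.

End Mx2Entries.

Section Mx2Ring.
Variable A : comNzRingType.
Implicit Types a b c d : A.

Lemma big_ord2 (F : 'I_2 -> A) : \sum_i F i = F 0 + F 1.
Proof.
by rewrite !big_ord_recl big_ord0 addr0; congr (_ + F _); apply/val_inj.
Qed.

Lemma mulmx2 a b c d a' b' c' d' :
  mx2 a b c d * mx2 a' b' c' d' =
  mx2 (a * a' + b * c') (a * b' + b * d') (c * a' + d * c') (c * b' + d * d').
Proof. by apply: mx2_eq; rewrite ?mx2E !mxE big_ord2 !mx2E. Qed.

Lemma addmx2 a b c d a' b' c' d' :
  mx2 a b c d + mx2 a' b' c' d' = mx2 (a + a') (b + b') (c + c') (d + d').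
Proof. by apply: mx2_eq; rewrite ?mx2E !mxE /=. Qed.

Lemma oppmx2 a b c d : - mx2 a b c d = mx2 (- a) (- b) (- c) (- d).
Proof. by apply: mx2_eq; rewrite ?mx2E !mxE. Qed.

Lemma scalemx2 k a b c d : k *: mx2 a b c d = mx2 (k * a) (k * b) (k * c) (k * d).
Proof. by apply: mx2_eq; rewrite ?mx2E !mxE. Qed.

Lemma trmx2 a b c d : (mx2 a b c d)^T = mx2 a c b d.
Proof. by apply: mx2_eq; rewrite ?mx2E !mxE. Qed.

Lemma onemx2 : 1 = mx2 1 0 0 1 :> 'M[A]_2.
Proof. by apply: mx2_eq; rewrite mx2E !mxE. Qed.

Lemma zeromx2 : 0 = mx2 0 0 0 0 :> 'M[A]_2.
Proof. by apply: mx2_eq; rewrite mx2E !mxE. Qed.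

Lemma det_mx2 a b c d : \det (mx2 a b c d) = a * d - b * c.
Proof.
rewrite (expand_det_row _ 0) big_ord2 /cofactor !det_mx11 !mxE /=.
by rewrite expr0 expr1 mul1r mulN1r mulrN.
Qed.

Lemma tr_mx2 a b c d : \tr (mx2 a b c d) = a + d.
Proof. by rewrite /mxtrace big_ord2 !mx2E. Qed.

Lemma detM2 (g h : 'M[A]_2) : \det (g * h) = \det g * \det h.
Proof. exact: det_mulmx. Qed.

Lemma detN2 (g : 'M[A]_2) : \det (- g) = \det g.
Proof. by elim/mx2_ind: g => a b c d; rewrite oppmx2 !det_mx2 !mulrNN. Qed.

End Mx2Ring.

Lemma mulmx2_inv (F : fieldType) (g h : 'M[F]_2) : g * h = 1 -> g^-1 = h.
Proof.
move=> gh1; have hg1 : h * g = 1 by apply: mulmx1C.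
have Ug : g \is a GRing.unit by apply/unitrP; exists h.
by apply: (mulrI Ug); rewrite divrr // gh1.
Qed.

Lemma mx2_unit (F : fieldType) (g : 'M[F]_2) :
  (g \is a GRing.unit) = (\det g != 0).
Proof. by rewrite -[LHS]/(g \in unitmx) unitmxE unitfE. Qed.

Lemma invmx2 (F : fieldType) (a b c d : F) : a * d - b * c != 0 ->
  (mx2 a b c d)^-1 = (a * d - b * c)^-1 *: mx2 d (- b) (- c) a.
Proof.
move=> D0; apply: mulmx2_inv; rewrite scalemx2 mulmx2 onemx2.
by congr mx2; field.
Qed.

Lemma det_inv2 (F : fieldType) (g : 'M[F]_2) : \det g^-1 = (\det g)^-1.
Proof. exact: det_inv. Qed.

(** * Determinant +-1 and equality up to sign *)

Section DetPm1.
Variable R : realFieldType.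
Implicit Types g h : 'M[R]_2.

Definition detpm1 g := \det g = 1 \/ \det g = - 1.

Lemma detpm1_neq0 g : detpm1 g -> \det g != 0.
Proof. by case=> ->; rewrite ?oppr_eq0 oner_eq0. Qed.

Lemma detpm1_unit g : detpm1 g -> g \is a GRing.unit.
Proof. by rewrite mx2_unit => /detpm1_neq0. Qed.

Lemma detpm1M g h : detpm1 g -> detpm1 h -> detpm1 (g * h).
Proof.
by rewrite /detpm1 detM2 => -[] -> [] ->; rewrite ?mulr1 ?mul1r ?mulrNN ?mulr1;
  auto.
Qed.

Lemma detpm1V g : detpm1 g -> detpm1 g^-1.
Proof. by rewrite /detpm1 det_inv2 => -[] ->; rewrite ?invrN invr1; auto. Qed.

End DetPm1.

Section UpToSign.
Variable A : nzRingType.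
Implicit Types g h k : A.

Definition pm g h := g = h \/ g = - h.

Lemma pm_refl g : pm g g. Proof. by left. Qed.

Lemma pm_sym g h : pm g h -> pm h g.
Proof. by case=> ->; [left | right; rewrite opprK]. Qed.

Lemma pm_trans h g k : pm g h -> pm h k -> pm g k.
Proof. by case=> -> [] ->; rewrite ?opprK; [left|right|right|left]. Qed.

Lemma pmN g h : pm (- g) h <-> pm g h.
Proof.
have K g' : pm g' h -> pm (- g') h by case=> ->; [right | left; rewrite opprK].
by split=> /K //; rewrite opprK.
Qed.

Lemma pmNr g h : pm g (- h) <-> pm g h.
Proof. by split=> /pm_sym/pmN/pm_sym. Qed.

Lemma pmMl k g h : pm g h -> pm (k * g) (k * h).
Proof. by case=> ->; [left | right; rewrite mulrN]. Qed.

Lemma pmMr k g h : pm g h -> pm (g * k) (h * k).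
Proof. by case=> ->; [left | right; rewrite mulNr]. Qed.

Lemma pmM g h g' h' : pm g h -> pm g' h' -> pm (g * g') (h * h').
Proof. by move=> /(pmMr g') H /(pmMl h); apply: pm_trans H. Qed.

End UpToSign.

(** * Geodesics, reflections and angles in the half plane *)

Section Geodesics.
Variable R : realType.
Local Notation pt := (option (R * R)).
Implicit Types (p q r v : pt) (a b c : R).

(* Homogeneous coordinates (h0 : h1 : h2) of a closed point, oo being
   (1 : 0 : 0): in them [on_geodesic a b c] is a linear condition. *)
Definition h0 p := if p is Some z then z.1 ^+ 2 + z.2 ^+ 2 else 1.
Definition h1 p := if p is Some z then z.1 else 0.
Definition h2 p : R := if p is Some _ then 1 else 0.

Definition ev a b c p := c * h0 p - 2 * a * h1 p - b * h2 p.

Lemma on_geodesicE a b c p : on_geodesic a b c p <-> ev a b c p = 0.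
Proof.
case: p => [[x y]|]; rewrite /on_geodesic /ev /h0 /h1 /h2 /=.
  by rewrite mulr1.
by rewrite mulr1 !mulr0 !subr0.
Qed.

(* The cross product of the homogeneous coordinates of p and q. *)
Definition ga p q := h0 q * h2 p - h0 p * h2 q.
Definition gb p q := 2 * (h1 q * h0 p - h1 p * h0 q).
Definition gc p q := 2 * (h1 q * h2 p - h1 p * h2 q).
Definition gD p q := ga p q ^+ 2 + gb p q * gc p q.

Lemma ev_gl p q : ev (ga p q) (gb p q) (gc p q) p = 0.
Proof. by rewrite /ev /ga /gb /gc; ring. Qed.

Lemma ev_gr p q : ev (ga p q) (gb p q) (gc p q) q = 0.
Proof. by rewrite /ev /ga /gb /gc; ring. Qed.

(** A quadratic form of signature (1, 2), with polar form [hip]: it is positive on the points of the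
    half plane, and the ideal points are null vectors. *)
Definition hq p := h0 p * h2 p - h1 p ^+ 2.
Definition hip p q := (h0 p * h2 q + h2 p * h0 q) / 2 - h1 p * h1 q.

(** Lagrange's identity: the discriminant of the cross product is - 4 times the Gram determinant of
    p and q. *)
Lemma gDE p q : gD p q = 4 * (hip p q ^+ 2 - hq p * hq q).
Proof. by rewrite /gD /ga /gb /gc /hip /hq; field. Qed.

Lemma hqE p : closed_point p -> hq p = (if p is Some z then z.2 ^+ 2 else 0).
Proof.
by case: p => [[x y]|] /= _; rewrite /hq /h0 /h1 /h2 /=; ring.
Qed.

Lemma hip_ge0 p q : 0 <= hip p q.
Proof.
case: p => [[x y]|]; case: q => [[x' y']|]; rewrite /hip /h0 /h1 /h2 /=.
- have -> : (((x ^+ 2 + y ^+ 2) * 1 + 1 * (x' ^+ 2 + y' ^+ 2)) / 2 - x * x' =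
     ((x - x') ^+ 2 + y ^+ 2 + y' ^+ 2) / 2) by field.
  by rewrite divr_ge0 // !addr_ge0 ?sqr_ge0.
- by lra.
- by lra.
- by lra.
Qed.

Lemma gD_gt0 p q : closed_point p -> closed_point q -> p <> q -> 0 < gD p q.
Proof.
case: p => [[x y]|]; case: q => [[x' y']|] //= y0 y0' pq;
  rewrite /gD /ga /gb /gc /h0 /h1 /h2 /=; last first.
- by nra.
- by nra.
(* The squared length of [direction (x, y) (Some (x', y'))]. *)
have -> : ((x' ^+ 2 + y' ^+ 2) * 1 - (x ^+ 2 + y ^+ 2) * 1) ^+ 2 +
  2 * (x' * (x ^+ 2 + y ^+ 2) - x * (x' ^+ 2 + y' ^+ 2)) *
   (2 * (x' * 1 - x * 1)) =
  (2 * y * (x' - x)) ^+ 2 + ((x' - x) ^+ 2 + y' ^+ 2 - y ^+ 2) ^+ 2 by ring.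
rewrite lt_neqAle addr_ge0 ?sqr_ge0 // andbT eq_sym paddr_eq0 ?sqr_ge0 //.
apply/negP => /andP[]; rewrite !sqrf_eq0 !mulf_eq0 pnatr_eq0 /=.
have yy : (y' ^+ 2 == y ^+ 2) = (y' == y) by rewrite eqrXn2.
case/orP => [/eqP y_0 | xx].
  rewrite y_0 expr0n subr0 paddr_eq0 ?sqr_ge0 // !sqrf_eq0 subr_eq0.
  by case/andP => /eqP xx' /eqP yy'; apply: pq; rewrite xx' yy' y_0.
rewrite (eqP xx) expr0n add0r subr_eq0 yy => /eqP yy'.
by apply: pq; move: xx; rewrite subr_eq0 => /eqP ->; rewrite yy'.
Qed.

Lemma hip_gt0 p q : closed_point p -> closed_point q -> p <> q -> hq p = 0 ->
  0 < hip p q.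
Proof.
move=> cp cq pq q0; have := gD_gt0 cp cq pq; rewrite gDE q0 mul0r subr0.
rewrite pmulr_rgt0 // => ip2; rewrite lt_neqAle hip_ge0 andbT eq_sym.
by apply/eqP => ip0; move: ip2; rewrite ip0 expr0n ltxx.
Qed.

(** The traceless matrix whose fixed points form the geodesic through p and q; [rm] rescales it to
    determinant - 1. The order of p and q only affects the sign. *)
Definition gm p q := mx2 (ga p q) (gb p q) (gc p q) (- ga p q).
Definition rm p q := (Num.sqrt (gD p q))^-1 *: gm p q.

Lemma gmC p q : gm q p = - gm p q.
Proof. by rewrite /gm oppmx2; congr mx2; rewrite /ga /gb /gc; ring. Qed.

Lemma gDC p q : gD q p = gD p q.
Proof. by rewrite /gD /ga /gb /gc; ring. Qed.

Lemma rmC p q : rm q p = - rm p q.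
Proof. by rewrite /rm gDC gmC scalerN. Qed.

Lemma sqrtD_inv d : 0 < d -> (Num.sqrt d)^-1 ^+ 2 * d = 1 :> R.
Proof.
by move=> d0; rewrite exprVn sqr_sqrtr ?ltW // mulVf // gt_eqF.
Qed.

(** With w the conjugate of z = x + i y, a fixed point satisfies (a w + b) conj (c w + d) = z and |c
    w + d| = 1, that is, a w + b = z (c w + d). *)
Lemma isom_fix (g : 'M[R]_2) x y : 0 < y -> \det g = - 1 ->
  isom g (x, y) = (x, y) ->
  g 1 1 = - g 0 0 /\ g 1 0 * (x ^+ 2 + y ^+ 2) - 2 * g 0 0 * x - g 0 1 = 0.
Proof.
elim/mx2_ind: g => a b c d y0; rewrite /isom det_mx2 !mx2E => D.
rewrite D normrN1 mul1r => -[]; set den := (c * x + d) ^+ 2 + (c * y) ^+ 2 => E1 E2.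
have den0 : den != 0.
  by apply/eqP => den0; move: E2 y0; rewrite den0 invr0 mulr0 => <-; rewrite ltxx.
have den1 : den = 1.
  have yd : y = y * den by rewrite -{2}E2 mulfVK.
  have y0' : y != 0 by rewrite gt_eqF.
  by apply: (mulfI y0'); rewrite mulr1 -yd.
move: E1 E2; rewrite den1 divr1 => E1 _.
(* e + i f and u + i w are a w + b and c w + d at the conjugate w of x + i y. *)
set e := a * x + b; set f := - a * y.
set u := c * x + d; set w := - c * y.
have E3 : e * u + f * w = x by rewrite -[RHS]E1 /e /u /f /w; ring.
have E4 : f * u - e * w = y.
  by rewrite -[RHS]mul1r -[1]opprK -D /e /u /f /w; ring.
have uw1 : u ^+ 2 + w ^+ 2 = 1 by rewrite -den1 /den /u /w; ring.
have Ee : e = x * u - y * w.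
  by rewrite -[e]mulr1 -uw1 -E3 -E4; ring.
have Ef : f = x * w + y * u.
  by rewrite -[f]mulr1 -uw1 -E3 -E4; ring.
have da : d = - a.
  have y0' : y != 0 by rewrite gt_eqF.
  by apply: (mulfI y0'); move: Ef; rewrite /f /w /u => Ef; lra.
split=> //; move: Ee; rewrite /e /u /w da; lra.
Qed.

Lemma fix_isom a b c x y : a ^+ 2 + b * c = 1 ->
  c * (x ^+ 2 + y ^+ 2) - 2 * a * x - b = 0 ->
  isom (mx2 a b c (- a)) (x, y) = (x, y).
Proof.
move=> D E; rewrite /isom det_mx2 !mx2E.
have -> : a * - a - b * c = - 1 by rewrite -D; ring.
have -> : (c * x + - a) ^+ 2 + (c * y) ^+ 2 = 1.
  have -> : (c * x + - a) ^+ 2 + (c * y) ^+ 2 =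
     c * (c * (x ^+ 2 + y ^+ 2) - 2 * a * x - b) + (a ^+ 2 + b * c) by ring.
  by rewrite E D mulr0 add0r.
rewrite normrN1 mul1r !divr1; congr pair.
have -> : a * c * (x ^+ 2 + y ^+ 2) + (a * - a + b * c) * x + b * - a =
  a * (c * (x ^+ 2 + y ^+ 2) - 2 * a * x - b) + (a ^+ 2 + b * c) * x by ring.
by rewrite E D mulr0 add0r mul1r.
Qed.

(** Two points of the geodesic determine the second equation up to a factor: two heights on a
    vertical line, or the top and one more point of a half circle. *)
Lemma geodesic_prop a b c a' b' c' : 0 < a ^+ 2 + b * c ->
  (forall x y, 0 < y -> c * (x ^+ 2 + y ^+ 2) - 2 * a * x - b = 0 ->
     c' * (x ^+ 2 + y ^+ 2) - 2 * a' * x - b' = 0) ->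
  exists k, [/\ a' = k * a, b' = k * b & c' = k * c].
Proof.
move=> D H; have [c0|c0] := eqVneq c 0.
  have a0 : a != 0.
    by apply/eqP => a0; move: D; rewrite a0 c0 mulr0 expr0n addr0 ltxx.
  have E y : c * ((- b / (2 * a)) ^+ 2 + y ^+ 2) - 2 * a * (- b / (2 * a)) - b = 0.
    by rewrite c0; field.
  have := H _ 1 ltr01 (E _); have := H _ 2 (ltr0Sn _ _) (E _) => E1 E2.
  have c'0 : c' = 0.
    by move: E1 E2; move: (- b / (2 * a)) => x E1 E2; lra.
  exists (a' / a); rewrite c0 c'0 mulr0; split=> //; first by field.
  have b'E x : c' * (x ^+ 2 + 1 ^+ 2) - 2 * a' * x - b' = 0 -> b' = - 2 * a' * x.
    by rewrite c'0 mul0r => ?; lra.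
  by rewrite (b'E _ E2); field.
set x0 := a / c; set rho := Num.sqrt ((a ^+ 2 + b * c) / c ^+ 2).
have rho2 : rho ^+ 2 = (a ^+ 2 + b * c) / c ^+ 2.
  by rewrite sqr_sqrtr // divr_ge0 ?sqr_ge0 ?ltW.
have rho0 : 0 < rho.
  by rewrite sqrtr_gt0 divr_gt0 // exprn_even_gt0.
have E1 : c * (x0 ^+ 2 + rho ^+ 2) - 2 * a * x0 - b = 0.
  by rewrite rho2 /x0; field.
(* (3/5, 4/5) lies on the unit circle, so this is a second point of the half circle of centre x0 and
   radius rho. *)
have E2 : c * ((x0 + 3 / 5 * rho) ^+ 2 + (4 / 5 * rho) ^+ 2)
   - 2 * a * (x0 + 3 / 5 * rho) - b = 0.
  have -> : (x0 + 3 / 5 * rho) ^+ 2 + (4 / 5 * rho) ^+ 2 =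
     x0 ^+ 2 + rho ^+ 2 + 6 / 5 * x0 * rho by field.
  have -> : a = c * x0 by rewrite /x0; field.
  by rewrite -[RHS]E1 -[in RHS](_ : c * x0 = a); [ring | rewrite /x0; field].
have F1 := H _ _ rho0 E1.
have F2 := H _ (4 / 5 * rho) (mulr_gt0 _ rho0) E2.
have {}F2 : c' * ((x0 + 3 / 5 * rho) ^+ 2 + (4 / 5 * rho) ^+ 2)
   - 2 * a' * (x0 + 3 / 5 * rho) - b' = 0 by apply: F2; lra.
have a'E : a' = c' * x0.
  have rho0' : rho != 0 by rewrite gt_eqF.
  apply: (mulIf rho0'); move: F1 F2.
  have -> : (x0 + 3 / 5 * rho) ^+ 2 + (4 / 5 * rho) ^+ 2 =
     x0 ^+ 2 + rho ^+ 2 + 6 / 5 * (x0 * rho) by field.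
  by rewrite !mulrDr; lra.
exists (c' / c); split; first by rewrite a'E /x0; field.
- have -> : b' = c' * (x0 ^+ 2 + rho ^+ 2) - 2 * a' * x0 by lra.
  by rewrite a'E rho2 /x0; field.
- by field.
Qed.

(** As a linear form, (a, b, c) vanishes on two independent vectors, so it is a multiple of their
    cross product. *)
Lemma geodesic_uniq a b c p q : 0 < gD p q -> ev a b c p = 0 -> ev a b c q = 0 ->
  exists k, [/\ a = k * ga p q, b = k * gb p q & c = k * gc p q].
Proof.
move=> D Ep Eq; have D0 : gD p q != 0 by rewrite gt_eqF.
have E1 : a * gc p q = c * ga p q.
  apply/eqP; rewrite -subr_eq0; apply/eqP.
  have -> : a * gc p q - c * ga p q = ev a b c p * h2 q - ev a b c q * h2 p.
    by rewrite /ev /ga /gc; ring.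
  by rewrite Ep Eq; ring.
have E2 : a * gb p q = b * ga p q.
  apply/eqP; rewrite -subr_eq0; apply/eqP.
  have -> : a * gb p q - b * ga p q = ev a b c p * h0 q - ev a b c q * h0 p.
    by rewrite /ev /ga /gb; ring.
  by rewrite Ep Eq; ring.
have E3 : b * gc p q = c * gb p q.
  apply/eqP; rewrite -subr_eq0; apply/eqP.
  have -> : b * gc p q - c * gb p q =
     - 2 * (ev a b c p * h1 q - ev a b c q * h1 p).
    by rewrite /ev /gc /gb; ring.
  by rewrite Ep Eq; ring.
(* If (a, b, c) is k times (ga, gb, gc), then a ga + b gc = k gD. *)
exists ((a * ga p q + b * gc p q) / gD p q).
split; apply: (mulIf D0); rewrite mulrAC mulfVK //; rewrite /gD.
- have -> : a * (ga p q ^+ 2 + gb p q * gc p q) =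
     a * ga p q ^+ 2 + (a * gb p q) * gc p q by ring.
  by rewrite E2; ring.
- have -> : (a * ga p q + b * gc p q) * gb p q =
     ga p q * (a * gb p q) + b * gb p q * gc p q by ring.
  by rewrite E2; ring.
- have -> : (a * ga p q + b * gc p q) * gc p q =
     ga p q * (a * gc p q) + (b * gc p q) * gc p q by ring.
  by rewrite E1 E3; ring.
Qed.

(** A matrix that fixes the geodesic pointwise satisfies its equation by [isom_fix], so it is a
    multiple of [gm p q], and determinant - 1 leaves two scalars. *)
Lemma reflectionsE p q : 0 < gD p q ->
  reflections p q = [set rm p q; - rm p q].
Proof.
move=> D; apply/seteqP; split=> g.
  case=> a [b] [c] [abc [/on_geodesicE Ep /on_geodesicE Eq] dg fixg].
  have H x y : 0 < y -> c * (x ^+ 2 + y ^+ 2) - 2 * a * x - b = 0 ->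
      g 1 1 = - g 0 0 /\
      g 1 0 * (x ^+ 2 + y ^+ 2) - 2 * g 0 0 * x - g 0 1 = 0.
    by move=> y0 E; apply: isom_fix => //; apply: fixg.
  have [k [Ea Eb Ec]] := geodesic_prop abc (fun x y y0 E => (H x y y0 E).2).
  have [k' [Ea' Eb' Ec']] := geodesic_uniq D Ep Eq.
  have tr0 : g 1 1 = - g 0 0.
    have [c0|c0] := eqVneq c 0.
      have a0 : a != 0.
        by apply/eqP => a0; move: abc; rewrite a0 c0 mulr0 expr0n addr0 ltxx.
      by apply: (H (- b / (2 * a)) 1 ltr01 _).1; rewrite c0; field.
    apply: (H (a / c) (Num.sqrt ((a ^+ 2 + b * c) / c ^+ 2)) _ _).1.
      by rewrite sqrtr_gt0 divr_gt0 // exprn_even_gt0.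
    by rewrite sqr_sqrtr ?divr_ge0 ?sqr_ge0 ?ltW //; field.
  have gE : g = (k * k') *: gm p q.
    by rewrite (mx2_eta g) tr0 Ea Eb Ec Ea' Eb' Ec' /gm scalemx2; congr mx2; ring.
  have kk : (k * k') ^+ 2 = (Num.sqrt (gD p q))^-1 ^+ 2.
    have D0 : gD p q != 0 by rewrite gt_eqF.
    apply: (mulIf D0); rewrite sqrtD_inv //.
    move: dg; rewrite gE /gm scalemx2 det_mx2 => dg.
    by apply: oppr_inj; rewrite -dg /gD; ring.
  rewrite gE /=; move/eqP: kk; rewrite eqf_sqr => /orP[] /eqP ->; [left | right] => //.
  by rewrite scaleNr.
have Dg : \det (rm p q) = - 1.
  rewrite /rm /gm scalemx2 det_mx2 -(sqrtD_inv D) /gD; ring.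
have DN : \det (- rm p q) = - 1 by rewrite detN2.
have fixE s : s ^+ 2 * gD p q = 1 -> forall z : R * R, upper_half_plane z ->
    on_geodesic (ga p q) (gb p q) (gc p q) (Some z) -> isom (s *: gm p q) z = z.
  move=> s2 [x y] _ E; rewrite /gm scalemx2 mulrN; apply: fix_isom.
    by rewrite -s2 /gD; ring.
  move: E; rewrite /on_geodesic => E.
  by rewrite -[RHS](mulr0 s) -E; ring.
have sq : (- (Num.sqrt (gD p q))^-1) ^+ 2 * gD p q = 1 by rewrite sqrrN sqrtD_inv.
have S2 := sqrtD_inv D.
case=> ->; exists (ga p q), (gb p q), (gc p q); split=> //.
- by split; apply/on_geodesicE; rewrite (ev_gl, ev_gr).
- exact: fixE.
- by split; apply/on_geodesicE; rewrite (ev_gl, ev_gr).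
- by rewrite /rm -scaleNr; exact: fixE.
Qed.

Lemma tr_gm v p q :
  \tr (gm v p * gm v q) = 8 * (hip v p * hip v q - hq v * hip p q).
Proof.
by rewrite /gm mulmx2 tr_mx2 /ga /gb /gc /hip /hq; field.
Qed.

Lemma tr_rm v p q :
  \tr (rm v p * rm v q) =
  \tr (gm v p * gm v q) / (Num.sqrt (gD v p) * Num.sqrt (gD v q)).
Proof.
rewrite /rm -scalerAl -scalerAr scalerA linearZ /= -invfM mulrC.
by congr (_ / _); rewrite mulrC.
Qed.

Lemma directionE x y p :
  (direction (x, y) p).1 = gc (Some (x, y)) p * y /\
  (direction (x, y) p).2 = ga (Some (x, y)) p - gc (Some (x, y)) p * x.
Proof.
by case: p => [[x' y']|]; rewrite /direction /ga /gc /h0 /h1 /h2 /=;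
  split; ring.
Qed.

Lemma gD_direction x y p :
  gD (Some (x, y)) p = (direction (x, y) p).1 ^+ 2 + (direction (x, y) p).2 ^+ 2.
Proof.
have [-> ->] := directionE x y p.
have := ev_gl (Some (x, y)) p; rewrite /ev /= mulr1 => /eqP; rewrite subr_eq0 => /eqP E.
by rewrite /gD -E /=; ring.
Qed.

Lemma tr_gm_direction x y p q :
  \tr (gm (Some (x, y)) p * gm (Some (x, y)) q) = 2 * ((direction (x, y) p).1 * (direction (x, y) q).1 +
                     (direction (x, y) p).2 * (direction (x, y) q).2).
Proof.
have [-> ->] := directionE x y p; have [-> ->] := directionE x y q.
have := ev_gl (Some (x, y)) p; rewrite /ev /= mulr1 => /eqP; rewrite subr_eq0 => /eqP E.
have := ev_gl (Some (x, y)) q; rewrite /ev /= mulr1 => /eqP; rewrite subr_eq0 => /eqP E'.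
by rewrite /gm mulmx2 tr_mx2 -E -E' /=; ring.
Qed.

Lemma vertex_angle_tr v p q theta :
  closed_point v -> closed_point p -> closed_point q ->
  v <> p -> v <> q -> vertex_angle v p q = theta ->
  \tr (rm v p * rm v q) = 2 * cos theta.
Proof.
move=> cv cp cq vp vq; have Dp := gD_gt0 cv cp vp; have Dq := gD_gt0 cv cq vq.
have ideal : hq v = 0 -> \tr (rm v p * rm v q) = 2.
  move=> v0; rewrite tr_rm tr_gm !gDE v0 !mul0r !subr0.
  have ip := hip_gt0 cv cp vp v0; have iq := hip_gt0 cv cq vq v0.
  have sq x : 0 < x -> Num.sqrt (4 * x ^+ 2) = 2 * x.
    move=> x0; have -> : 4 * x ^+ 2 = (2 * x) ^+ 2 by ring.
    by rewrite sqrtr_sqr ger0_norm // mulr_ge0 // ltW.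
  rewrite !sq //; field.
  by rewrite !gt_eqF.
case: v => [[x y]|] in cv vp vq Dp Dq ideal *; last first.
  by move=> <-; rewrite /vertex_angle cos0 mulr1 ideal // hqE.
rewrite /vertex_angle /=; case: ifP => y0; last first.
  move=> <-; rewrite cos0 mulr1 ideal // hqE //=.
  have -> : y = 0 by apply/eqP; rewrite eq_le cv andbT leNgt y0.
  by rewrite expr0n.
move=> <-; rewrite tr_rm tr_gm_direction /vector_angle.
rewrite -!gD_direction acosK; first by rewrite mulrA.
have [Hp Hq] := (gD_direction x y p, gD_direction x y q).
move: Dp Dq Hp Hq; set u := direction _ p; set w := direction _ q.
set D := gD _ p; set D' := gD _ q => Dp Dq Hp Hq.
rewrite in_itv /= -ler_norml normrM normfV.
have S0 : 0 < Num.sqrt D * Num.sqrt D' by rewrite mulr_gt0 ?sqrtr_gt0.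
rewrite (gtr0_norm S0) ler_pdivrMr // mul1r.
rewrite -(ler_pXn2r (ltn0Sn 1)) ?nnegrE ?normr_ge0 ?(ltW S0) //.
rewrite exprMn (sqr_sqrtr (ltW Dp)) (sqr_sqrtr (ltW Dq)) real_normK ?num_real // Hp Hq -subr_ge0.
have -> : (u.1 ^+ 2 + u.2 ^+ 2) * (w.1 ^+ 2 + w.2 ^+ 2) -
  (u.1 * w.1 + u.2 * w.2) ^+ 2 = (u.1 * w.2 - u.2 * w.1) ^+ 2 by ring.
exact: sqr_ge0.
Qed.

Lemma triangle_neq p q r : triangle p q r -> [/\ p <> q, q <> r & r <> p].
Proof.
move=> [cp cq cr H].
have K u v : closed_point u -> closed_point v -> exists a b c,
    [/\ 0 < a ^+ 2 + b * c, on_geodesic a b c u & on_geodesic a b c v].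
  move=> cu cv; have [uv|uv] := pselect (u = v).
    pose w : pt := if u is Some _ then None else Some (0, 0).
    have cw : closed_point w by rewrite /w; case: (u) => //=.
    have uw : u <> w by rewrite /w; case: (u).
    exists (ga u w), (gb u w), (gc u w); rewrite -uv.
    by split; [exact: gD_gt0 | apply/on_geodesicE/ev_gl..].
  exists (ga u v), (gb u v), (gc u v).
  by split; [exact: gD_gt0 | apply/on_geodesicE/ev_gl | apply/on_geodesicE/ev_gr].
split=> E; apply: H.
- by have [a [b [c [? ? ?]]]] := K _ _ cp cr; exists a, b, c; rewrite -E.
- by have [a [b [c [? ? ?]]]] := K _ _ cp cr; exists a, b, c; rewrite E.
- by have [a [b [c [? ? ?]]]] := K _ _ cp cq; exists a, b, c; rewrite E.
Qed.

(** Up to sign, twice the determinant of the three vectors of homogeneous coordinates; hence the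
    cyclic symmetry. *)
Definition h3 p q r := ev (ga p q) (gb p q) (gc p q) r.

Lemma h3C p q r : h3 q r p = h3 p q r.
Proof. by rewrite /h3 /ev /ga /gb /gc; ring. Qed.

Lemma triangle_h3 p q r : triangle p q r -> h3 p q r != 0.
Proof.
move=> tr; have [pq _ _] := triangle_neq tr; case: tr => cp cq cr H.
apply/eqP => E; apply: H; exists (ga p q), (gb p q), (gc p q).
by split; [exact: gD_gt0 | apply/on_geodesicE..]; rewrite ?ev_gl ?ev_gr.
Qed.

Definition evm (g : 'M[R]_2) p := ev (g 0 0) (g 0 1) (g 1 0) p.

Lemma evmD g h p : evm (g + h) p = evm g p + evm h p.
Proof. by rewrite /evm /ev !mxE; ring. Qed.

Lemma evmZ k g p : evm (k *: g) p = k * evm g p.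
Proof. by rewrite /evm /ev !mxE; ring. Qed.

Lemma evm_gm p q r : evm (gm p q) r = h3 p q r.
Proof. by rewrite /evm /gm !mx2E. Qed.

(** Evaluation at a vertex kills the two walls through it and leaves the coefficient of the opposite
    wall. *)
Lemma rm_free p q r k1 k2 k3 : triangle p q r ->
  k1 *: rm p q + k2 *: rm q r + k3 *: rm r p = 0 -> [/\ k1 = 0, k2 = 0 & k3 = 0].
Proof.
move=> tr E; have [pq qr rp] := triangle_neq tr; have T0 := triangle_h3 tr.
case: (tr) => cp cq cr _.
have S u v : closed_point u -> closed_point v -> u <> v ->
    (Num.sqrt (gD u v))^-1 != 0.
  by move=> *; rewrite invr_eq0 gt_eqF // sqrtr_gt0 gD_gt0.
have {E} E v : k1 * ((Num.sqrt (gD p q))^-1 * h3 p q v) +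
    k2 * ((Num.sqrt (gD q r))^-1 * h3 q r v) +
    k3 * ((Num.sqrt (gD r p))^-1 * h3 r p v) = 0.
  move: (congr1 (evm^~ v) E); rewrite !evmD !evmZ !evm_gm => ->.
  by rewrite /evm /ev !mxE; ring.
have z1 u v : h3 u v u = 0 by exact: ev_gl.
have z2 u v : h3 u v v = 0 by exact: ev_gr.
have T1 : h3 q r p != 0 by rewrite h3C.
have T2 : h3 r p q != 0 by rewrite h3C.
split.
- move: (E r); rewrite z1 z2 !mulr0 !addr0 => /eqP.
  by rewrite !mulf_eq0 (negPf (S _ _ cp cq pq)) (negPf T0) !orbF => /eqP.
- move: (E p); rewrite z1 z2 !mulr0 add0r addr0 => /eqP.
  by rewrite !mulf_eq0 (negPf (S _ _ cq cr qr)) (negPf T1) !orbF => /eqP.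
- move: (E q); rewrite z1 z2 !mulr0 !add0r => /eqP.
  by rewrite !mulf_eq0 (negPf (S _ _ cr cp rp)) (negPf T2) !orbF => /eqP.
Qed.

Lemma det_rm p q : 0 < gD p q -> \det (rm p q) = - 1.
Proof.
by move=> D; rewrite /rm /gm scalemx2 det_mx2 -(sqrtD_inv D) /gD; ring.
Qed.

Lemma tr_rm0 p q : \tr (rm p q) = 0.
Proof. by rewrite /rm /gm scalemx2 tr_mx2; ring. Qed.

End Geodesics.

(** * Standard position of a triangle with an ideal vertex *)

Section Normalize.
Variable R : realType.
Implicit Types (g h C M : 'M[R]_2) (a b : R).

(* The walls of the normalized triangle with vertex oo: the unit circle and two
   vertical lines. *)
Definition Jm : 'M[R]_2 := mx2 0 1 1 0.
Definition Vam a : 'M[R]_2 := mx2 (- 1) (- a) 0 1.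
Definition Vbm b : 'M[R]_2 := mx2 (- 1) b 0 1.

(** The ideal vertex is already oo. C is z |-> |r| (z - p / r), which moves the circle of [M1] to
    the unit circle, followed by the reflection in the imaginary axis if the vertical walls are on
    the wrong sides; the four cases are the signs of r and eps. *)
Lemma normalize_upper (eps v w p q r a b : R) :
  eps ^+ 2 = 1 -> r != 0 -> p ^+ 2 + q * r = 1 ->
  let M1 := mx2 p q r (- p) in
  let M2 := mx2 eps v 0 (- eps) in let M3 := mx2 (- eps) w 0 eps in
  \tr (M1 * M3) = - a -> \tr (M1 * M2) = - b ->
  exists C, detpm1 C /\ exists N1 N2 N3, [/\ C * M1 = N1 * C,
    C * M2 = N2 * C, C * M3 = N3 * C & [/\ pm N1 Jm, pm N2 (Vbm b) & pm N3 (Vam a)]].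
Proof.
move=> eps2 r0 D M1 M2 M3; rewrite /M1 /M2 /M3 !mulmx2 !tr_mx2 => T3 T2.
have [s [s0 rE]] : exists s : R, s != 0 /\ (r = s ^+ 2 \/ r = - s ^+ 2).
  exists (Num.sqrt `|r|); rewrite gt_eqF ?sqrtr_gt0 ?normr_gt0 //.
  rewrite sqr_sqrtr //; split=> //; case: (ger0P r) => _; first by left.
  by right; rewrite opprK.
have qE : q = (1 - p ^+ 2) / r by rewrite -D; field.
have vE : v = (- b - 2 * p * eps) / r.
  by apply: (mulIf r0); rewrite mulfVK // -T2; ring.
have wE : w = (- a + 2 * p * eps) / r.
  by apply: (mulIf r0); rewrite mulfVK // -T3; ring.
have d1 : detpm1 (mx2 s (- s * p / r) 0 s^-1).
  by left; rewrite det_mx2 mulr0 subr0 divff.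
have d2 : detpm1 (mx2 s (- s * p / r) 0 (- s^-1)).
  by right; rewrite det_mx2 mulr0 subr0 mulrN divff.
have epsE : eps = 1 \/ eps = - 1.
  by have /eqP := eps2; rewrite sqrf_eq1 => /orP[] /eqP; auto.
rewrite /pm /Jm /Vam /Vbm {M1 M2 M3 T3 T2 eps2 D}.
case: rE => rE; case: epsE => epsE; subst eps r.
- exists (mx2 s (- s * p / s ^+ 2) 0 s^-1); split=> //.
  exists (mx2 0 1 1 0), (- mx2 (- 1) b 0 1), (mx2 (- 1) (- a) 0 1).
  rewrite !oppmx2 !mulmx2 qE vE wE.
  split; [by congr mx2; field|by congr mx2; field|by congr mx2; field|].
  by split; first [by left | by right; rewrite ?oppmx2].
- exists (mx2 s (- s * p / s ^+ 2) 0 (- s^-1)); split=> //.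
  exists (- mx2 0 1 1 0), (mx2 (- 1) b 0 1), (- mx2 (- 1) (- a) 0 1).
  rewrite !oppmx2 !mulmx2 qE vE wE.
  split; [by congr mx2; field|by congr mx2; field|by congr mx2; field|].
  by split; first [by left | by right; rewrite ?oppmx2].
- exists (mx2 s (- s * p / - s ^+ 2) 0 (- s^-1)); split=> //.
  exists (mx2 0 1 1 0), (- mx2 (- 1) b 0 1), (mx2 (- 1) (- a) 0 1).
  rewrite !oppmx2 !mulmx2 qE vE wE.
  split; [by congr mx2; field|by congr mx2; field|by congr mx2; field|].
  by split; first [by left | by right; rewrite ?oppmx2].
- exists (mx2 s (- s * p / - s ^+ 2) 0 s^-1); split=> //.
  exists (- mx2 0 1 1 0), (mx2 (- 1) b 0 1), (- mx2 (- 1) (- a) 0 1).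
  rewrite !oppmx2 !mulmx2 qE vE wE.
  split; [by congr mx2; field|by congr mx2; field|by congr mx2; field|].
  by split; first [by left | by right; rewrite ?oppmx2].
Qed.

(** M2 and M3 have square 1, and M2 M3 + M3 M2 is the scalar tr (M2 M3) = - 2, so that (M2 + M3)^2 =
    0. If the sum is not 0, its kernel is the common ideal endpoint of the two walls. *)
Lemma sum_nilpotent M2 M3 : \tr M2 = 0 -> \tr M3 = 0 ->
  \det M2 = - 1 -> \det M3 = - 1 -> \tr (M2 * M3) = - 2 ->
  exists be, let al := M2 0 0 + M3 0 0 in let ga := M2 1 0 + M3 1 0 in
    M2 + M3 = mx2 al be ga (- al) /\ al ^+ 2 + be * ga = 0.
Proof.
elim/mx2_ind: M2 => a b c d; elim/mx2_ind: M3 => a' b' c' d'.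
rewrite !mulmx2 !tr_mx2 !det_mx2 !mx2E => t2 t3 d2 d3 T.
exists (b + b'); split; first by rewrite addmx2; congr mx2; lra.
have dE : d = - a by lra.
have dE' : d' = - a' by lra.
subst d d'; nra.
Qed.

Lemma normalize_walls M1 M2 M3 a b :
  \tr M1 = 0 -> \tr M2 = 0 -> \tr M3 = 0 ->
  \det M1 = - 1 -> \det M2 = - 1 -> \det M3 = - 1 ->
  (forall k1 k2 k3, k1 *: M1 + k2 *: M2 + k3 *: M3 = 0 ->
     [/\ k1 = 0, k2 = 0 & k3 = 0]) ->
  \tr (M1 * M3) = - a -> \tr (M1 * M2) = - b -> \tr (M2 * M3) = - 2 ->
  exists C, detpm1 C /\ exists N1 N2 N3, [/\ C * M1 = N1 * C,
    C * M2 = N2 * C, C * M3 = N3 * C & [/\ pm N1 Jm, pm N2 (Vbm b) & pm N3 (Vam a)]].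
Proof.
wlog up : M1 M2 M3 / M2 1 0 + M3 1 0 = 0 => [WL|].
  move=> t1 t2 t3 d1 d2 d3 free T13 T12 T23.
  have [up|ga0] := eqVneq (M2 1 0 + M3 1 0) 0; first exact: WL.
  set ga := M2 1 0 + M3 1 0 in ga0; set al := M2 0 0 + M3 0 0.
  (* B sends the column (al, ga), which spans the kernel of M2 + M3, to (1, 0); the ideal vertex
     moves to oo. *)
  pose B := mx2 0 ga^-1 (- ga) al; pose B' := mx2 al (- ga^-1) ga 0.
  have BB' : B * B' = 1 by rewrite /B /B' mulmx2 onemx2; congr mx2; field.
  have B'B : B' * B = 1 by exact: mulmx1C.
  have dB : \det B = 1 by rewrite /B det_mx2; field.
  have trJ M : \tr (B * M * B') = \tr M.
    by rewrite mxtrace_mulC mulmxA -[X in \tr (X *m _)]/(B' * B) B'B mul1mx.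
  have detJ M : \det (B * M * B') = \det M.
    have := congr1 determinant BB'; rewrite detM2 det1 dB mul1r => dB'.
    by rewrite !detM2 dB dB' mul1r mulr1.
  have mulJ M N : B * M * B' * (B * N * B') = B * (M * N) * B'.
    by rewrite !mulrA -(mulrA (B * M)) B'B mulr1.
  have up : (B * M2 * B') 1 0 + (B * M3 * B') 1 0 = 0.
    have -> : (B * M2 * B') 1 0 + (B * M3 * B') 1 0 = (B * (M2 + M3) * B') 1 0.
      by rewrite mulrDr mulrDl [RHS]mxE.
    have [be [-> S0]] := sum_nilpotent t2 t3 d2 d3 T23.
    rewrite /B /B' !mulmx2 mx2E -/ga -/al.
    have -> : be = - al ^+ 2 / ga.
      by apply: (mulIf ga0); rewrite mulfVK //; move: S0; rewrite -/al -/ga; lra.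
    by field.
  have free' k1 k2 k3 : k1 *: (B * M1 * B') + k2 *: (B * M2 * B') +
      k3 *: (B * M3 * B') = 0 -> [/\ k1 = 0, k2 = 0 & k3 = 0].
    move=> E; apply: free; move: (congr1 (fun M => B' * M * B) E).
    rewrite !mulrDr !mulrDl mulr0 mul0r.
    have K k M : B' * (k *: (B * M * B')) * B = k *: M.
      by rewrite -scalerAr -scalerAl !mulrA B'B mul1r -mulrA B'B mulr1.
    by rewrite !K.
  have := WL (B * M1 * B') _ _ up; rewrite !mulJ !trJ !detJ => {}WL.
  have [C [dC [N1 [N2 [N3 [E1 E2 E3 N]]]]]] :=
    WL t1 t2 t3 d1 d2 d3 free' T13 T12 T23.
  have K M N' : C * (B * M * B') = N' * C -> C * B * M = N' * (C * B).
    move=> E; rewrite (mulrA N') -E -!mulrA B'B mulr1 //.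
  exists (C * B); split; first by apply: detpm1M => //; left.
  by exists N1, N2, N3; split=> //; exact: K.
elim/mx2_ind: M1 => p q r p'; elim/mx2_ind: M2 up => a2 b2 c2 a2' up.
elim/mx2_ind: M3 up => a3 b3 c3 a3'; rewrite !mx2E !mulmx2 !tr_mx2 !det_mx2 => up.
move=> t1 t2 t3 d1 d2 d3 free T13 T12 T23.
have ? : p' = - p by lra.
have ? : a2' = - a2 by lra.
have ? : a3' = - a3 by lra.
have ? : c3 = - c2 by lra.
subst p' a2' a3' c3.
have S0 : (a2 + a3) ^+ 2 = 0 by nra.
have ? : a3 = - a2 by move/eqP: S0; rewrite sqrf_eq0 => /eqP; lra.
subst a3; rewrite opprK in d3 free T13 T12 T23 *.
have be0 : b2 + b3 != 0.
  apply/eqP => be0; have [] := free 0 1 1; last by move=> _ /eqP; rewrite oner_eq0.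
  by rewrite !scalemx2 !addmx2 zeromx2; congr mx2; lra.
have c20 : c2 = 0.
  apply: (mulIf be0); rewrite mul0r; lra.
subst c2; have a2sq : a2 ^+ 2 = 1 by lra.
have r0 : r != 0.
  apply/eqP => r0; subst r.
  (* With r = 0 the three walls would be traceless and upper triangular, in a space of dimension 2;
     these are the coefficients of a linear relation. *)
  have [|/eqP] := free (b2 + b3) (- (b2 + b3) * p * a2 - (q - p * a2 * b2)) (- (q - p * a2 * b2)).
    rewrite !scalemx2 !addmx2 zeromx2; congr mx2; try ring.
    - have -> : (b2 + b3) * p + (- (b2 + b3) * p * a2 - (q - p * a2 * b2)) * a2 +
         - (q - p * a2 * b2) * - a2 = (b2 + b3) * p * (1 - a2 ^+ 2) by ring.
      by rewrite a2sq; ring.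
    - have -> : (b2 + b3) * - p + (- (b2 + b3) * p * a2 - (q - p * a2 * b2)) * - a2 +
         - (q - p * a2 * b2) * a2 = - (b2 + b3) * p * (1 - a2 ^+ 2) by ring.
      by rewrite a2sq; ring.
  by rewrite (negPf be0).
rewrite oppr0; apply: normalize_upper => //; first by lra.
- by rewrite mulmx2 tr_mx2; lra.
- by rewrite mulmx2 tr_mx2; lra.
Qed.

End Normalize.

(** * Groups with two generators over a commutative ring *)

Section TwoGenerated.
Variable A : comNzRingType.
Implicit Types (g h X Y : 'M[A]_2) (a b : A).

(** For determinant 1 this is the inverse over any commutative ring; the groups are later also taken
    over [R * R], which is not a field. *)
Definition adj2 g : 'M[A]_2 := mx2 (g 1 1) (- g 0 1) (- g 1 0) (g 0 0).

Lemma adj2E a b c d : adj2 (mx2 a b c d) = mx2 d (- b) (- c) a.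
Proof. by rewrite /adj2 !mx2E. Qed.

Lemma mul_adj2 g : \det g = 1 -> g * adj2 g = 1.
Proof.
elim/mx2_ind: g => a b c d; rewrite det_mx2 adj2E mulmx2 onemx2 => D.
by congr mx2; rewrite -?D; ring.
Qed.

Lemma adj2_mul g : \det g = 1 -> adj2 g * g = 1.
Proof.
elim/mx2_ind: g => a b c d; rewrite det_mx2 adj2E mulmx2 onemx2 => D.
by congr mx2; rewrite -?D; ring.
Qed.

Lemma adj2M g h : adj2 (g * h) = adj2 h * adj2 g.
Proof.
elim/mx2_ind: g => a b c d; elim/mx2_ind: h => a' b' c' d'.
by rewrite !(adj2E, mulmx2); congr mx2; ring.
Qed.

Lemma adj2K g : adj2 (adj2 g) = g.
Proof. by elim/mx2_ind: g => a b c d; rewrite !adj2E !opprK. Qed.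

Lemma adj2N g : adj2 (- g) = - adj2 g.
Proof. by elim/mx2_ind: g => a b c d; rewrite oppmx2 !adj2E oppmx2. Qed.

Lemma adj21 : adj2 1 = 1.
Proof. by rewrite onemx2 adj2E oppr0. Qed.

(* X and Y are meant to have determinant 1, so that adj2 is inversion. *)
Inductive gen2 X Y : 'M[A]_2 -> Prop :=
| gen2_1 : gen2 X Y 1
| gen2_N g : gen2 X Y g -> gen2 X Y (- g)
| gen2_X g : gen2 X Y g -> gen2 X Y (X * g)
| gen2_Xi g : gen2 X Y g -> gen2 X Y (adj2 X * g)
| gen2_Y g : gen2 X Y g -> gen2 X Y (Y * g)
| gen2_Yi g : gen2 X Y g -> gen2 X Y (adj2 Y * g).

Lemma gen2M X Y g h : gen2 X Y g -> gen2 X Y h -> gen2 X Y (g * h).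
Proof.
move=> + Hh; elim=> [|k _ IH|k _ IH|k _ IH|k _ IH|k _ IH].
- by rewrite mul1r.
- by rewrite mulNr; apply: gen2_N.
- by rewrite -mulrA; apply: gen2_X.
- by rewrite -mulrA; apply: gen2_Xi.
- by rewrite -mulrA; apply: gen2_Y.
- by rewrite -mulrA; apply: gen2_Yi.
Qed.

Lemma gen2X X Y : gen2 X Y X.
Proof. by rewrite -[X in gen2 _ _ X]mulr1; apply/gen2_X/gen2_1. Qed.

Lemma gen2Y X Y : gen2 X Y Y.
Proof. by rewrite -[X in gen2 _ _ X]mulr1; apply/gen2_Y/gen2_1. Qed.

Lemma gen2_adj X Y g : gen2 X Y g -> gen2 X Y (adj2 g).
Proof.
have iX : gen2 X Y (adj2 X).
  by rewrite -[X in gen2 _ _ X]mulr1; apply/gen2_Xi/gen2_1.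
have iY : gen2 X Y (adj2 Y).
  by rewrite -[X in gen2 _ _ X]mulr1; apply/gen2_Yi/gen2_1.
elim=> [|k _ IH|k _ IH|k _ IH|k _ IH|k _ IH].
- by rewrite adj21; apply: gen2_1.
- by rewrite adj2N; apply: gen2_N.
- by rewrite adj2M; apply: gen2M.
- by rewrite adj2M adj2K; apply: gen2M => //; apply: gen2X.
- by rewrite adj2M; apply: gen2M.
- by rewrite adj2M adj2K; apply: gen2M => //; apply: gen2Y.
Qed.

Lemma gen2_X_ind X Y g n : gen2 X Y g -> gen2 X Y (g ^+ n).
Proof.
move=> Gg; elim: n => [|n IH]; first by rewrite expr0; apply: gen2_1.
by rewrite exprS; apply: gen2M.
Qed.

Lemma gen2_det X Y g : \det X = 1 -> \det Y = 1 -> gen2 X Y g -> \det g = 1.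
Proof.
have dadj h : \det (adj2 h) = \det h.
  by elim/mx2_ind: h => a b c d; rewrite adj2E !det_mx2; ring.
move=> dX dY; elim=> [|k _ IH|k _ IH|k _ IH|k _ IH|k _ IH].
- exact: det1.
- by rewrite detN2.
- by rewrite detM2 dX mul1r.
- by rewrite detM2 dadj dX mul1r.
- by rewrite detM2 dY mul1r.
- by rewrite detM2 dadj dY mul1r.
Qed.

Lemma gen2_sub X Y X' Y' g : gen2 X' Y' X -> gen2 X' Y' Y ->
  gen2 X Y g -> gen2 X' Y' g.
Proof.
move=> GX GY; elim=> [|k _ IH|k _ IH|k _ IH|k _ IH|k _ IH].
- exact: gen2_1.
- exact: gen2_N.
- exact: gen2M.
- by apply: gen2M => //; apply: gen2_adj.
- exact: gen2M.
- by apply: gen2M => //; apply: gen2_adj.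
Qed.

Definition xm a : 'M[A]_2 := mx2 a 1 (- 1) 0.
Definition ym b : 'M[A]_2 := mx2 0 1 (- 1) b.
Definition tm t : 'M[A]_2 := mx2 1 t 0 1.
Definition gam a b := gen2 (xm a) (ym b).

Lemma det_xm a : \det (xm a) = 1.
Proof. by rewrite det_mx2; ring. Qed.

Lemma det_ym b : \det (ym b) = 1.
Proof. by rewrite det_mx2; ring. Qed.

Lemma gam_det a b g : gam a b g -> \det g = 1.
Proof. by apply: gen2_det; rewrite (det_xm, det_ym). Qed.

Lemma xym a b : xm a * ym b = - adj2 (tm (a + b)).
Proof. by rewrite mulmx2 adj2E oppmx2; congr mx2; ring. Qed.

Lemma gam_tm a b : gam a b (tm (a + b)).
Proof.
rewrite -[tm _]adj2K; apply: gen2_adj; rewrite -[adj2 _]opprK -xym.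
by apply: gen2_N; apply: gen2M; [apply: gen2X | apply: gen2Y].
Qed.

Lemma tmM s t : tm s * tm t = tm (s + t).
Proof. by rewrite mulmx2; congr mx2; ring. Qed.

Lemma tmX s n : tm s ^+ n = tm (s *+ n).
Proof.
elim: n => [|n IH]; first by rewrite expr0 mulr0n /tm -onemx2.
by rewrite exprS IH tmM mulrS.
Qed.

Lemma adj2_tm s : adj2 (tm s) = tm (- s).
Proof. by rewrite adj2E oppr0. Qed.

End TwoGenerated.

Lemma adj2_inv (F : fieldType) (g : 'M[F]_2) : \det g = 1 -> g^-1 = adj2 g.
Proof. by move=> dg; apply: mulmx2_inv; rewrite mul_adj2. Qed.

(** * Triangle groups as groups [gam a b] *)

Section GamTriangle.
Variable R : realType.
Implicit Types (g h C : 'M[R]_2) (a b : R).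

Lemma generated_psl (S : set 'M[R]_2) : (forall g, S g -> detpm1 g) ->
  psl_subgroup (generated_subgroup S).
Proof.
move=> dS.
have P0 : psl_subgroup [set g : 'M[R]_2 | detpm1 g].
  split=> /=; first by split; left; rewrite ?detN2 det1.
  - by [].
  - by move=> g h; apply: detpm1M.
  - by move=> g; apply: detpm1V.
split.
- by split=> P [[[P1 PN] _ _ _] _].
- by move=> g /(_ _ (conj P0 dS)).
- by move=> g h Hg Hh P PP; case: (PP) => -[_ _ PM _] _; apply: PM; [apply: Hg | apply: Hh].
- by move=> g Hg P PP; case: (PP) => -[_ _ _ PV] _; apply: PV; apply: Hg.
Qed.

Lemma generated_sub (S : set 'M[R]_2) g : S g -> generated_subgroup S g.
Proof. by move=> Sg P [_]; apply. Qed.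

Lemma psl_opp (G : set 'M[R]_2) g : psl_subgroup G -> G g -> G (- g).
Proof. by case=> -[_ GN] _ GM _ Gg; rewrite -mulN1r; apply: GM. Qed.

Lemma det_Jm : \det (Jm R) = - 1.
Proof. by rewrite det_mx2; ring. Qed.

Lemma JJ : Jm R * Jm R = 1.
Proof. by rewrite mulmx2 onemx2; congr mx2; ring. Qed.

(** Conjugation by the reflection [Jm] inverts both generators. *)
Lemma gam_J a b g : gam a b g -> gam a b (Jm R * g * Jm R).
Proof.
have K X h : Jm R * (X * h) * Jm R = (Jm R * X * Jm R) * (Jm R * h * Jm R).
  by rewrite -!mulrA [Jm R * (Jm R * _)]mulrA JJ mul1r.
have Jx : Jm R * xm a * Jm R = adj2 (xm a).
  by rewrite adj2E !mulmx2; congr mx2; ring.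
have Jy : Jm R * ym b * Jm R = adj2 (ym b).
  by rewrite adj2E !mulmx2; congr mx2; ring.
have Jx' : Jm R * adj2 (xm a) * Jm R = xm a.
  by rewrite adj2E !mulmx2; congr mx2; ring.
have Jy' : Jm R * adj2 (ym b) * Jm R = ym b.
  by rewrite adj2E !mulmx2; congr mx2; ring.
elim=> [|k _ IH|k _ IH|k _ IH|k _ IH|k _ IH].
- by rewrite mulr1 JJ; apply: gen2_1.
- by rewrite mulrN mulNr; apply: gen2_N.
- by rewrite K Jx; apply: gen2_Xi.
- by rewrite K Jx'; apply: gen2_X.
- by rewrite K Jy; apply: gen2_Yi.
- by rewrite K Jy'; apply: gen2_Y.
Qed.

(** The walls are, up to sign, [Jm], [Jm * ym b] and [xm a * Jm], so that an element of the
    reflection group lies in [gam a b] or becomes so after multiplication by [Jm]; the determinant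
    tells which. *)
Lemma dihedral_det1 a b (W : set 'M[R]_2) :
  W = generated_subgroup ([set Jm R; - Jm R] `|` [set Vbm b; - Vbm b] `|` [set Vam a; - Vam a]) ->
  W `&` [set g | \det g = 1] = gam a b.
Proof.
move=> WE.
have dV a' : \det (Vam a') = - 1 by rewrite det_mx2; ring.
have VaE : Vam a = - (xm a * Jm R).
  by rewrite mulmx2 oppmx2; congr mx2; ring.
have VbE : Vbm b = Jm R * ym b by rewrite mulmx2; congr mx2; ring.
have VaJ : Vam a * Jm R = - xm a by rewrite mulmx2 oppmx2; congr mx2; ring.
have JVb : Jm R * Vbm b = ym b by rewrite mulmx2; congr mx2; ring.
have pmdet g h : pm g h -> \det g = \det h by case=> ->; rewrite ?detN2.
have Wpsl : psl_subgroup W.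
  rewrite WE; apply: generated_psl => g [[|]|] /pmdet; rewrite /detpm1 => ->; right.
  - exact: det_Jm.
  - by rewrite det_mx2; ring.
  - exact: dV.
apply/seteqP; split=> g; last first.
  move=> Gg; split; last exact: gam_det Gg.
  have WJ : W (Jm R) by rewrite WE; apply: generated_sub; left; left; left.
  have WVb : W (Vbm b) by rewrite WE; apply: generated_sub; left; right; left.
  have WVa : W (Vam a) by rewrite WE; apply: generated_sub; right; left.
  case: (Wpsl) => -[W1 WN] _ WM WV.
  have WX : W (xm a).
    by rewrite -[xm a]opprK -VaJ; apply: psl_opp => //; apply: WM.
  have WY : W (ym b) by rewrite -JVb; apply: WM.
  have WXi : W (adj2 (xm a)) by rewrite -adj2_inv ?det_xm //; apply: WV.
  have WYi : W (adj2 (ym b)) by rewrite -adj2_inv ?det_ym //; apply: WV.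
  by elim: Gg => [|k _ IH|k _ IH|k _ IH|k _ IH|k _ IH] //;
    [exact: psl_opp | exact: WM | exact: WM | exact: WM | exact: WM].
case=> Wg dg.
pose H := [set h : 'M[R]_2 | gam a b h \/ gam a b (Jm R * h)].
have JHJ h : gam a b (Jm R * h) -> gam a b (h * Jm R).
  by move=> /gam_J; rewrite !mulrA JJ mul1r.
have HJ h : gam a b (h * Jm R) -> gam a b (Jm R * h).
  by move=> /gam_J; rewrite -!mulrA JJ mulr1.
have : H g.
  move: Wg; rewrite WE; apply; split; last first.
    have J1 : gam a b (Jm R * Jm R) by rewrite JJ; apply: gen2_1.
    have Jb : gam a b (Jm R * Vbm b) by rewrite JVb; apply: gen2Y.
    have Ja : gam a b (Jm R * Vam a).
      by apply: HJ; rewrite VaJ; apply/gen2_N/gen2X.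
    by move=> h [[|]|] [] ->; right; rewrite ?mulrN //; apply: gen2_N.
  split.
  - by split; left; [|apply: gen2_N]; apply: gen2_1.
  - move=> h [/gam_det ->|/gam_det]; first by left.
    by rewrite detM2 det_Jm mulN1r => <-; right; rewrite opprK.
  - move=> h k [Hh|Hh] [Hk|Hk].
    + by left; apply: gen2M.
    + by right; apply: HJ; rewrite -mulrA; apply: gen2M => //; apply: JHJ.
    + by right; rewrite mulrA; apply: gen2M.
    + left; have -> : h * k = (h * Jm R) * (Jm R * k).
        by rewrite -mulrA [Jm R * (Jm R * _)]mulrA JJ mul1r.
      by apply: gen2M => //; apply: JHJ.
  - move=> h [Hh|Hh]; first by left; rewrite adj2_inv ?(gam_det Hh) //; apply: gen2_adj.
    right; have -> : Jm R * h^-1 = (h * Jm R)^-1.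
      have UJ : Jm R \is a GRing.unit by rewrite mx2_unit det_Jm oppr_eq0 oner_eq0.
      have Uh : h \is a GRing.unit.
        rewrite mx2_unit; move/gam_det: Hh; rewrite detM2 det_Jm mulN1r => E.
        by apply/eqP => E0; move: E; rewrite E0 oppr0 => /eqP; rewrite eq_sym oner_eq0.
      by rewrite invrM // (mulmx2_inv JJ).
    by move/JHJ: Hh => Hh; rewrite adj2_inv ?(gam_det Hh) //; apply: gen2_adj.
case=> // /gam_det; rewrite detM2 det_Jm dg mulr1 => /eqP.
by rewrite eq_sym -subr_eq0 opprK (_ : 1 + 1 = 2%:R) ?pnatr_eq0.
Qed.

Lemma generated_conj (S : set 'M[R]_2) C : C \is a GRing.unit ->
  (forall g, S g -> detpm1 g) ->
  conjugate C (generated_subgroup S) = generated_subgroup (conjugate C S).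
Proof.
move=> UC.
have sub D T : D \is a GRing.unit -> (forall g, T g -> detpm1 g) ->
    conjugate D (generated_subgroup T) `<=` generated_subgroup (conjugate D T).
  move=> UD dT; have dJ g : \det (D * g * D^-1) = \det g.
    rewrite !detM2 det_inv2 mulrAC divff ?mul1r //.
    by rewrite -mx2_unit.
  have dcT g : conjugate D T g -> detpm1 g.
    by case=> h Th <-; rewrite /detpm1 dJ; apply: dT.
  have [[G1 GN] _ GM GV] := generated_psl dcT.
  move=> g [h Hh <-].
  suff: [set k | detpm1 k /\ generated_subgroup (conjugate D T) (D * k * D^-1)] h.
    by case.
  apply: Hh; split; last first.
    move=> k Tk; split; first exact: dT.
    by apply: generated_sub; exists k.
  split=> /=.
  - split; split; rewrite ?mulrN ?mulr1 ?mulNr ?divrr //.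
      by left; rewrite det1.
    by left; rewrite detN2 det1.
  - by move=> k [].
  - move=> k1 k2 [d1 H1] [d2 H2]; split; first exact: detpm1M.
    have -> : D * (k1 * k2) * D^-1 = (D * k1 * D^-1) * (D * k2 * D^-1).
      by rewrite -!mulrA [D^-1 * (D * _)]mulrA mulVr // mul1r.
    exact: GM.
  - move=> k [dk Hk]; split; first exact: detpm1V.
    have -> : D * k^-1 * D^-1 = (D * k * D^-1)^-1.
      apply/esym/mulmx2_inv; rewrite -!mulrA (mulrA D^-1) mulVr // mul1r.
      by rewrite (mulrA k) divrr ?detpm1_unit // mul1r divrr.
    exact: GV.
move=> dS; apply/seteqP; split; first exact: sub.
move=> g Hg; exists (C^-1 * g * C); last first.
  by rewrite !mulrA divrr // mul1r -mulrA divrr // mulr1.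
have KC (T : set 'M[R]_2) : conjugate C^-1 (conjugate C T) = T.
  apply/seteqP; split=> k.
    by case=> _ [h Th <-] <-; rewrite invrK !mulrA mulVr // mul1r -mulrA mulVr // mulr1.
  move=> Tk; exists (C * k * C^-1); first by exists k.
  by rewrite invrK !mulrA mulVr // mul1r -mulrA mulVr // mulr1.
have dcS k : conjugate C S k -> detpm1 k.
  case=> h Sh <-; rewrite /detpm1 !detM2 det_inv2 mulrAC divff ?mul1r; first exact: dS.
  by rewrite -mx2_unit.
have := @sub C^-1 _ (etrans (unitrV _) UC) dcS; rewrite KC => /(_ (C^-1 * g * C)); apply.
by exists g => //; rewrite invrK.
Qed.

Definition cf (k : option nat) : R := 2 * cos (angle_oo R k).

(** The angles give the traces of the products of two walls, and these traces determine the walls up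
    to conjugation. The vertex r, of angle 0, goes to oo. *)
Lemma triangle_group_gam (l m : option nat) (G : set 'M[R]_2) :
  triangle_group (l, m, None) G ->
  exists C, detpm1 C /\ conjugate C G = gam (cf l) (cf m).
Proof.
case=> p [q [r [tri Ap Aq Ar GE]]].
have [pq qr rp] := triangle_neq tri.
case: (tri) => cp cq cr _.
have [[qp rq] pr] := (nesym pq, nesym qr, nesym rp).
have Dpq := gD_gt0 cp cq pq; have Dqr := gD_gt0 cq cr qr.
have Drp := gD_gt0 cr cp rp.
have Tp := vertex_angle_tr cp cq cr pq pr Ap.
have Tq := vertex_angle_tr cq cr cp qr qp Aq.
have Tr := vertex_angle_tr cr cp cq rp rq Ar.
(* The minus sign appears because one of the two walls is read in the opposite direction; likewise
   in the next two traces. *)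
have T13 : \tr (rm p q * rm r p) = - cf l.
  by rewrite (rmC p r) mulrN linearN /= Tp.
have T12 : \tr (rm p q * rm q r) = - cf m.
  by rewrite (rmC q p) mulNr linearN /= mxtrace_mulC Tq.
have T23 : \tr (rm q r * rm r p) = - 2.
  by rewrite (rmC r q) mulNr linearN /= mxtrace_mulC Tr cos0 mulr1.
have [C [dC [N1 [N2 [N3 [E1 E2 E3 [P1 P2 P3]]]]]]] :=
  normalize_walls (tr_rm0 p q) (tr_rm0 q r) (tr_rm0 r p) (det_rm Dpq)
    (det_rm Dqr) (det_rm Drp) (fun k1 k2 k3 => @rm_free _ p q r k1 k2 k3 tri)
    T13 T12 T23.
exists C; split=> //.
have UC := detpm1_unit dC.
have cpm M N V : C * M = N * C -> pm N V ->
    conjugate C [set M; - M] = [set V; - V].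
  move=> E NV; have CM : C * M * C^-1 = N by rewrite E mulrK.
  apply/seteqP; split=> g.
    case=> h [] -> <-; rewrite ?mulrN ?mulNr CM //.
    by case: NV => ->; [right | left]; rewrite ?opprK.
  case=> ->; case: NV => NV; [exists M|exists (- M)|exists (- M)|exists M];
   rewrite ?mulrN ?mulNr ?CM ?NV ?opprK //; by [left | right].
have cU (S T : set 'M[R]_2) : conjugate C (S `|` T) = conjugate C S `|` conjugate C T.
  by rewrite /conjugate image_setU.
rewrite -(@dihedral_det1 (cf l) (cf m) _ (erefl _)).
have dE1 := det_rm Dpq; have dE2 := det_rm Dqr; have dE3 := det_rm Drp.
rewrite -(cpm _ _ _ E1 P1) -(cpm _ _ _ E2 P2) -(cpm _ _ _ E3 P3) -!cU.
rewrite -generated_conj //; last first.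
  by move=> g [[|]|] [] ->; right; rewrite ?detN2.
rewrite GE !reflectionsE //.
have dJ g : \det (C * g * C^-1) = \det g.
  by rewrite !detM2 det_inv2 mulrAC divff ?mul1r // -mx2_unit.
apply/seteqP; split=> g.
  by case=> h [Hh /= dh] <-; split; [exists h | rewrite /= dJ].
case=> -[h Hh <-] /=; rewrite dJ => dh; by exists h.
Qed.

End GamTriangle.

(** * Normal form of words and signs of their entries *)

Section NormalForm.
Variables (A : comNzRingType) (a b : A) (S : A -> Prop).
Implicit Types (g h u v M : 'M[A]_2).

(** The signs are such that in - v u, with v as in [yshape], all minus signs cancel and the entries
    are sums of products of elements of S. *)
Definition xshape u := exists q r : A,
  [/\ u = mx2 (q * a - r) q (- q) (- r), S (q * a - r), S q & S r].
Definition yshape v := exists p q : A,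
  [/\ v = mx2 (- p) q (- q) (q * b - p), S p, S q & S (q * b - p)].

(* PX and PY are the sets of nontrivial powers of xm a and ym b up to sign,
   each with the sign for which its entries have the above signs. *)
Variables (PX PY : 'M[A]_2 -> Prop).

Definition pmP (P : 'M[A]_2 -> Prop) g := exists2 h, P h & pm g h.
Definition opt1 (P : 'M[A]_2 -> Prop) u := u = 1 \/ P u.

Record power_sets : Prop := PowerSets {
  ps_S0 : S 0;
  ps_S1 : S 1;
  ps_SD : forall z w, S z -> S w -> S (z + w);
  ps_SM : forall z w, S z -> S w -> S (z * w);
  ps_X : forall u, PX u -> xshape u;
  ps_Y : forall v, PY v -> yshape v;
  ps_x : pmP PX (xm a);
  ps_xi : pmP PX (adj2 (xm a));
  ps_y : pmP PY (ym b);
  ps_yi : pmP PY (adj2 (ym b));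
  ps_XX : forall u u', PX u -> PX u' -> pmP (opt1 PX) (u * u');
  ps_YY : forall v v', PY v -> PY v' -> pmP (opt1 PY) (v * v')
}.

Hypothesis ps : power_sets.

Inductive mon : nat -> 'M[A]_2 -> Prop :=
| mon_1 : mon 0 1
| mon_S n u v M : PX u -> PY v -> mon n M -> mon n.+1 (- (v * u) * M).

(** An alternating word in powers of the two generators, cut into n blocks - v u; the outer u and v
    serve the words that begin with a power of x or end with a power of y. *)
Definition NF g := exists u n M v,
  [/\ opt1 PX u, mon n M, opt1 PY v & pm g (u * M * v)].

Lemma mon_entries n M : mon n M ->
  exists p q r s, [/\ M = mx2 p q r s & [/\ S p, S q, S r & S s]].
Proof.
have [S0 S1 SD SM _ _ _ _ _ _ _ _] := ps; elim=> [|k u v {}M Pu Pv _ [m1 [m2 [m3 [m4 [-> [? ? ? ?]]]]]]].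
  by exists 1, 0, 0, 1; split; [exact: onemx2 |].
have [q [r [-> ? ? ?]]] := ps_X ps Pu; have [p' [q' [-> ? ? ?]]] := ps_Y ps Pv.
rewrite !(mulmx2, oppmx2).
exists ((p' * (q * a - r) + q' * q) * m1 + (p' * q + q' * r) * m3),
  ((p' * (q * a - r) + q' * q) * m2 + (p' * q + q' * r) * m4),
  ((q' * (q * a - r) + (q' * b - p') * q) * m1 + (q' * q + (q' * b - p') * r) * m3),
  ((q' * (q * a - r) + (q' * b - p') * q) * m2 + (q' * q + (q' * b - p') * r) * m4).
by split; [congr mx2; ring | split; auto 10].
Qed.

Lemma NF_step_x z : pmP PX z -> forall g, NF g -> NF (z * g).
Proof.
move=> [u0 Pu0 zu0] g [u [n [M [v [Pu HM Pv gE]]]]].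
have E : pm (z * g) (u0 * (u * M * v)) by apply: pmM.
case: Pu => [u1|Pu].
  exists u0, n, M, v; split=> //; first by right.
  by rewrite u1 mul1r in E; rewrite -mulrA.
have [u' Pu' uu'] := ps_XX ps Pu0 Pu.
exists u', n, M, v; split=> //; apply: pm_trans E _.
by rewrite !mulrA; do 2!apply: pmMr.
Qed.

Lemma NF_step_y z : pmP PY z -> forall g, NF g -> NF (z * g).
Proof.
move=> [v0 Pv0 zv0] g [u [n [M [v [Pu HM Pv gE]]]]].
have E : pm (z * g) (v0 * (u * M * v)) by apply: pmM.
case: Pu => [u1|Pu]; last first.
  exists 1, n.+1, (- (v0 * u) * M), v; split=> //; [by left | exact: mon_S |].
  by apply: (pm_trans E); rewrite mul1r !mulNr pmNr !mulrA; exact: pm_refl.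
rewrite u1 mul1r in E; clear gE.
case: HM E => [|{}n u' v' {}M Pu' Pv' HM] E.
  rewrite mul1r in E; case: Pv => [v1|Pv].
    exists 1, 0, 1, v0; split; [by left | exact: mon_1 | by right |].
    by rewrite v1 mulr1 in E; rewrite !mul1r.
  have [v'' Pv'' vv] := ps_YY ps Pv0 Pv.
  exists 1, 0, 1, v''; split=> //; [by left | exact: mon_1 |].
  by rewrite !mul1r; apply: pm_trans E vv.
have [v'' [v1|Pv''] vv] := ps_YY ps Pv0 Pv'.
  exists u', n, M, v; split=> //; first by right.
  apply: (pm_trans E); rewrite !mulNr mulrN; apply/pmN; rewrite !mulrA; do 2!apply: pmMr.
  by rewrite -[X in pm _ X]mul1r -v1; exact: pmMr.
exists 1, n.+1, (- (v'' * u') * M), v; split=> //; [by left | exact: mon_S |].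
apply: (pm_trans E); rewrite mul1r !mulNr mulrN; apply/pmN/pmNr.
by rewrite !mulrA; do 3!apply: pmMr.
Qed.

Lemma NF_gam g : gam a b g -> NF g.
Proof.
elim=> [|k _ IH|k _ IH|k _ IH|k _ IH|k _ IH].
- exists 1, 0, 1, 1; split; [by left | exact: mon_1 | by left |].
  by rewrite !mul1r; left.
- have [u [n [M [v [? ? ? E]]]]] := IH.
  by exists u, n, M, v; split=> //; apply/pmN.
- exact: NF_step_x (ps_x ps) _ IH.
- exact: NF_step_x (ps_xi ps) _ IH.
- exact: NF_step_y (ps_y ps) _ IH.
- exact: NF_step_y (ps_yi ps) _ IH.
Qed.

(** The prefix u makes the bottom row the opposite of a row over S, and the first column of v is the
    opposite of a column over S, so that no cancellation occurs in the entry. *)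
Lemma gam_lower_left g : gam a b g -> S (g 1 0) \/ S (- g 1 0).
Proof.
move=> /NF_gam [u [n [M [v [Pu HM Pv E]]]]].
have [S0 S1 SD SM _ _ _ _ _ _ _ _] := ps.
have [m1 [m2 [m3 [m4 [ME [? ? ? ?]]]]]] := mon_entries HM.
suff : S ((u * M * v) 1 0) \/ S (- (u * M * v) 1 0).
  case: E => ->; first by [].
  by rewrite !mxE opprK => -[]; auto.
have uM : exists r3 r4, [/\ S r3, S r4 & exists x1 x2,
    pm (u * M) (mx2 x1 x2 r3 r4)].
  case: Pu => [->|/(ps_X ps) [q [r [-> ? ? ?]]]].
    by rewrite mul1r ME; exists m3, m4; split=> //; exists m1, m2; left.
  rewrite ME mulmx2; set x1 := _ + _; set x2 := _ + _.
  exists (q * m1 + r * m3), (q * m2 + r * m4); split; [by auto..|].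
  exists (- x1), (- x2); right; rewrite oppmx2 !opprK; congr mx2; ring.
have [r3 [r4 [? ? [x1 [x2 uME]]]]] := uM.
suff {uME uM E} : S ((mx2 x1 x2 r3 r4 * v) 1 0) \/ S (- (mx2 x1 x2 r3 r4 * v) 1 0).
  have neg (N : 'M[A]_2) : (- N) 1 0 = - N 1 0 by rewrite mxE.
  by case: uME => ->; rewrite ?mulNr // neg opprK => -[]; auto.
case: Pv => [->|/(ps_Y ps) [p [q [-> ? ? ?]]]].
  by rewrite mulr1 !mx2E; left.
rewrite mulmx2 !mx2E; right.
have -> : - (r3 * - p + r4 * - q) = r3 * p + r4 * q by ring.
by auto.
Qed.

End NormalForm.

(** * Parabolic elements *)

Section Parabolic.
Variables (R : realFieldType) (a b : R) (PX PY : 'M[R]_2 -> Prop).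
Implicit Types (g h u v M : 'M[R]_2).

Definition nat_like (z : R) := z = 0 \/ 1 <= z.
Hypothesis ps : power_sets a b nat_like PX PY.
Hypothesis t_gt0 : 0 < a + b.
Hypothesis PX_elliptic : forall u, PX u -> \tr u ^+ 2 != 4.
Hypothesis PY_elliptic : forall v, PY v -> \tr v ^+ 2 != 4.
Local Notation t := (a + b).
Local Notation T := (tm (a + b)).
Local Notation L := (mx2 1 0 (a + b) 1).
Local Notation mon := (mon PX PY).

Lemma nat_like_ge0 z : nat_like z -> 0 <= z.
Proof. by case=> [->|/(le_trans ler01)]. Qed.

Lemma nat_like_gt0 z : nat_like z -> z != 0 -> 1 <= z.
Proof. by case=> [->|//]; rewrite eqxx. Qed.

Lemma Lpow n : L ^+ n = mx2 1 0 (t *+ n) 1.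
Proof.
elim: n => [|n IH]; first by rewrite expr0 mulr0n -onemx2.
by rewrite exprS IH mulmx2 mulrS; congr mx2; ring.
Qed.

Definition pos2 M := 0 < M 0 1 /\ 0 < M 1 0.

Lemma PX_det u : PX u -> \det u = 1 -> exists q r : R,
  [/\ u = mx2 (q * a - r) q (- q) (- r), 0 <= q * a - r, 1 <= q & 0 <= r].
Proof.
move=> /(ps_X ps) [q [r [-> Sp Sq Sr]]]; rewrite det_mx2 => D.
exists q, r; split=> //; [exact: nat_like_ge0 | | exact: nat_like_ge0].
apply: nat_like_gt0 => //; apply/eqP => q0.
have := mulr_ge0 (nat_like_ge0 Sp) (nat_like_ge0 Sr).
move: D; rewrite q0; lra.
Qed.

Lemma PY_det v : PY v -> \det v = 1 -> exists p q : R,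
  [/\ v = mx2 (- p) q (- q) (q * b - p), 0 <= p, 1 <= q & 0 <= q * b - p].
Proof.
move=> /(ps_Y ps) [p [q [-> Sp Sq Sr]]]; rewrite det_mx2 => D.
exists p, q; split=> //; [exact: nat_like_ge0 | | exact: nat_like_ge0].
apply: nat_like_gt0 => //; apply/eqP => q0.
have := mulr_ge0 (nat_like_ge0 Sp) (nat_like_ge0 Sr).
move: D; rewrite q0; lra.
Qed.

Hypothesis PX_det1 : forall u, PX u -> \det u = 1.
Hypothesis PY_det1 : forall v, PY v -> \det v = 1.

(** An off-diagonal entry is a sum of two nonnegative terms. If it vanishes, so do both terms,
    determinant 1 forces q = q' = 1, and the block is T or L. *)
Lemma factor_cases u v : PX u -> PY v -> let F := - (v * u) in
  [\/ F = T, F = L | pos2 F] /\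
  [/\ 1 <= F 0 0, 1 <= F 1 1, 0 <= F 0 1 & 0 <= F 1 0].
Proof.
move=> Pu Pv; have := PX_det1 Pu; have := PY_det1 Pv.
have [q [r [-> p0 q1 r0]]] := PX_det Pu (PX_det1 Pu).
have [p' [q' [-> p'0 q'1 r'0]]] := PY_det Pv (PY_det1 Pv).
rewrite !det_mx2 !mulmx2 oppmx2 /pos2 !mx2E.
set p := q * a - r in p0 *; set r' := q' * b - p' in r'0 *.
move=> Dv Du.
have q0 : 0 <= q by lra.
have q'0 : 0 <= q' by lra.
have H1 : 0 <= p' * p by rewrite mulr_ge0.
have H2 : 0 <= r' * r by rewrite mulr_ge0.
have H3 : 1 <= q' * q by rewrite mulr_ege1.
have H4 : 0 <= p' * q by rewrite mulr_ge0.
have H5 : 0 <= q' * r by rewrite mulr_ge0.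
have H6 : 0 <= q' * p by rewrite mulr_ge0.
have H7 : 0 <= r' * q by rewrite mulr_ge0.
split; last by split; lra.
have [z1|z1] := eqVneq (p' * q + q' * r) 0.
  have /eqP : p' * q = 0 by lra.
  have /eqP : q' * r = 0 by lra.
  rewrite !mulf_eq0 (gt_eqF (lt_le_trans ltr01 q1)) (gt_eqF (lt_le_trans ltr01 q'1)).
  rewrite orbF /= => /eqP rz /eqP p'z.
  have qq : q = 1 by apply/eqP; rewrite -(eqrXn2 (ltn0Sn 1)) ?ler01 //; apply/eqP; move: Du; rewrite rz; lra.
  have qq' : q' = 1 by apply/eqP; rewrite -(eqrXn2 (ltn0Sn 1)) ?ler01 //; apply/eqP; move: Dv; rewrite p'z; lra.
  by constructor 2; rewrite /p /r' rz p'z qq qq'; congr mx2; ring.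
have [z2|z2] := eqVneq (q' * p + r' * q) 0.
  have /eqP : q' * p = 0 by lra.
  have /eqP : r' * q = 0 by lra.
  rewrite !mulf_eq0 (gt_eqF (lt_le_trans ltr01 q1)) (gt_eqF (lt_le_trans ltr01 q'1)).
  rewrite orbF /= => /eqP r'z /eqP pz.
  have qq : q = 1 by apply/eqP; rewrite -(eqrXn2 (ltn0Sn 1)) ?ler01 //; apply/eqP; move: Du; rewrite pz; lra.
  have qq' : q' = 1 by apply/eqP; rewrite -(eqrXn2 (ltn0Sn 1)) ?ler01 //; apply/eqP; move: Dv; rewrite r'z; lra.
  have rE : r = a by move: pz; rewrite /p qq; lra.
  have p'E : p' = b by move: r'z; rewrite /r' qq'; lra.
  by constructor 1; rewrite r'z pz qq qq' rE p'E; congr mx2; ring.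
constructor 3; split; rewrite lt_neqAle eq_sym.
  by apply/andP; split; [apply/eqP => E; move/eqP: z1; apply; lra | lra].
by apply/andP; split; [apply/eqP => E; move/eqP: z2; apply; lra | lra].
Qed.

Lemma mon_cases n M : mon n M ->
  [\/ exists k, M = T ^+ k, exists k, M = L ^+ k | pos2 M] /\
  [/\ 1 <= M 0 0, 1 <= M 1 1, 0 <= M 0 1 & 0 <= M 1 0].
Proof.
elim=> [|k u v {}M Pu Pv _].
  by split; [constructor 1; exists 0; rewrite expr0 | rewrite !mxE /=; split].
have := factor_cases Pu Pv; move: (- (v * u)) => F /= [cF [F1 F2 F3 F4]].
move=> [cM [M1 M2 M3 M4]].
have HF : pos2 F -> pos2 (F * M).
  rewrite /pos2 => -[]; move: F1 F2 M1 M2 M3 M4; elim/mx2_ind: F {cF F3 F4} => f1 f2 f3 f4.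
  elim/mx2_ind: M {cM} => m1 m2 m3 m4; rewrite mulmx2 !mx2E => *; split; nra.
have HM : pos2 M -> pos2 (F * M).
  rewrite /pos2 => -[]; move: F1 F2 F3 F4 M1 M2; elim/mx2_ind: F {cF HF} => f1 f2 f3 f4.
  elim/mx2_ind: M {cM M3 M4} => m1 m2 m3 m4; rewrite mulmx2 !mx2E => *; split; nra.
split; last first.
  move: F1 F2 F3 F4 M1 M2 M3 M4; elim/mx2_ind: F {cF HF HM} => f1 f2 f3 f4.
  elim/mx2_ind: M {cM} => m1 m2 m3 m4; rewrite mulmx2 !mx2E => *; split; nra.
case: cF => [FT|FL|/HF]; last by constructor 3.
- case: cM => [[j Mj]|[j Mj]|/HM]; last by constructor 3.
    by constructor 1; exists j.+1; rewrite exprS FT Mj.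
  case: j => [|j] in Mj.
    by constructor 1; exists 1; rewrite Mj expr0 mulr1 FT.
  constructor 3; rewrite FT Mj Lpow /pos2 mulmx2 !mx2E.
  by rewrite !mulr0 mul0r !add0r !mulr1 mul1r mulrn_wgt0.
- case: cM => [[j Mj]|[j Mj]|/HM]; last by constructor 3; last first.
    case: j => [|j] in Mj.
      by constructor 2; exists 1; rewrite Mj expr0 mulr1 FL.
    constructor 3; rewrite FL Mj tmX /pos2 mulmx2 !mx2E.
    have : 0 < t *+ j.+1 by rewrite mulrn_wgt0.
    by move=> w0; rewrite mul1r mul0r mulr1 mulr0 !addr0.
  by constructor 2; exists j.+1; rewrite exprS FL Mj.
Qed.

Lemma mon_det n M : mon n M -> \det M = 1.
Proof.
elim=> [|k u v {}M Pu Pv _ IH]; first exact: det1.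
by rewrite detM2 detN2 detM2 (PX_det1 Pu) (PY_det1 Pv) IH !mulr1.
Qed.

(** If both off-diagonal entries are positive, the diagonal entries are at least 1 with a product
    above 1, and the trace exceeds 2. *)
Lemma mon_unipotent n M : mon n M -> \tr M ^+ 2 = 4 ->
  exists k, M = T ^+ k \/ M = L ^+ k.
Proof.
move=> HM; have := mon_det HM; have [[] ] := mon_cases HM.
- by move=> [k ->] *; exists k; left.
- by move=> [k ->] *; exists k; right.
rewrite /pos2; elim/mx2_ind: M HM => m1 m2 m3 m4 _; rewrite !mx2E tr_mx2 det_mx2.
move=> [m2_0 m3_0] [m1_1 m4_1 _ _] D E; exfalso.
have : 0 < m2 * m3 by rewrite mulr_gt0.
nra.
Qed.

Lemma mon_rdecomp n M : mon n.+1 M ->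
  exists M' u v, [/\ mon n M', PX u, PY v & M = M' * - (v * u)].
Proof.
elim: n M => [|n IH] M H; inversion H as [|k u v M' Pu Pv HM' E1 E2].
  inversion HM'; exists 1, u, v; split=> //; first exact: mon_1.
  by rewrite mulr1 mul1r.
have [M'' [u' [v' [HM'' Pu' Pv' ->]]]] := IH _ HM'.
exists (- (v * u) * M''), u', v'; split=> //; first exact: mon_S.
by rewrite mulrA.
Qed.

(** The fixed point of such a g lies in the orbit of oo; if all parabolic elements are of this kind,
    the group has one class of cusps. *)
Definition Tconj g := exists d, gam a b d /\ exists k : int,
  pm g (d * tm (t *~ k) * adj2 d).

Lemma Tconj_conj e g : gam a b e -> Tconj (e * g * adj2 e) -> Tconj g.
Proof.
move=> Ge [d [Gd [k E]]]; exists (adj2 e * d); split.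
  by apply: gen2M => //; apply: gen2_adj.
exists k; rewrite adj2M adj2K.
have De := gam_det Ge.
have -> : g = adj2 e * (e * g * adj2 e) * e.
  by rewrite !mulrA adj2_mul // mul1r -mulrA adj2_mul // mulr1.
have -> : adj2 e * d * tm (t *~ k) * (adj2 d * e) =
   adj2 e * (d * tm (t *~ k) * adj2 d) * e by rewrite !mulrA.
by apply: pmMr; apply: pmMl.
Qed.

Lemma Tconj_pm g h : pm g h -> Tconj h -> Tconj g.
Proof.
by move=> gh [d [Gd [k E]]]; exists d; split=> //; exists k; apply: pm_trans E.
Qed.

Hypothesis PX_gam : forall u, PX u -> gam a b u.
Hypothesis PY_gam : forall v, PY v -> gam a b v.

Lemma mon_Tconj n M : mon n M -> \tr M ^+ 2 = 4 -> Tconj M.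
Proof.
move=> HM /(mon_unipotent HM) [k [->|->]].
  exists 1; split; first exact: gen2_1.
  by exists k%:Z; rewrite adj21 mulr1 mul1r tmX; left.
(* [ym b] sends oo to 0 and conjugates T^(- k) to L^k. *)
exists (ym b); split; first exact: gen2Y.
exists (- k%:Z); left; rewrite Lpow adj2E !mulmx2 mulrNz -pmulrn.
by congr mx2; ring.
Qed.

Lemma trJ2 e g : \det e = 1 -> \tr (e * g * adj2 e) = \tr g.
Proof.
move=> De; rewrite mxtrace_mulC mulmxA -[X in \tr (X *m _)]/(adj2 e * e).
by rewrite adj2_mul // mul1mx.
Qed.

Lemma trJ2' e g : \det e = 1 -> \tr (adj2 e * g * e) = \tr g.
Proof.
move=> De; rewrite mxtrace_mulC mulmxA -[X in \tr (X *m _)]/(e * adj2 e).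
by rewrite mul_adj2 // mul1mx.
Qed.

Lemma tr_pm g h : pm g h -> \tr g ^+ 2 = \tr h ^+ 2.
Proof. by case=> ->; rewrite ?linearN /= ?sqrrN. Qed.

(** Cyclic reduction: conjugation by an outer letter moves it to the other end, where it merges. The
    induction ends at a product of blocks or at a single power, whose trace is not +-2. *)
Lemma word_Tconj n u M v : mon n M -> opt1 PX u -> opt1 PY v ->
  \tr (u * M * v) ^+ 2 = 4 -> Tconj (u * M * v).
Proof.
have both k u' v' M' : PX u' -> PY v' -> mon k M' ->
    \tr (u' * M' * v') ^+ 2 = 4 -> Tconj (u' * M' * v').
  move=> Pu Pv HM E; apply: (Tconj_conj (PY_gam Pv)).
  have HM' := mon_S Pu Pv HM.
  have K : pm (v' * (u' * M' * v') * adj2 v') (- (v' * u') * M').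
    by rewrite -!mulrA mul_adj2 ?PY_det1 // mulr1 mulNr pmNr mulrA; left.
  apply: (Tconj_pm K); apply: mon_Tconj HM' _.
  by rewrite -(tr_pm K) trJ2 ?PY_det1.
elim: n u M v => [|n IH] u M v HM.
  inversion HM => -[->|Pu] [->|Pv]; rewrite ?mulr1 ?mul1r => E.
  - by apply: mon_Tconj; [exact: mon_1 | exact: E].
  - by move/eqP: E; rewrite (negPf (PY_elliptic Pv)).
  - by move/eqP: E; rewrite (negPf (PX_elliptic Pu)).
  - by have := both _ u v 1 Pu Pv (mon_1 PX PY); rewrite mulr1; apply.
move=> [->|Pu] [->|Pv]; last exact: (both _ _ _ _ Pu Pv HM).
- by rewrite mulr1 mul1r; apply: mon_Tconj HM.
- inversion HM as [|k u' v' M' Pu' Pv' HM' E1 E2]; rewrite mul1r => E.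
  apply: (Tconj_conj (PY_gam Pv)).
  have [v'' Pv'' vv] := ps_YY ps Pv Pv'.
  have K : pm (v * (- (v' * u') * M' * v) * adj2 v) (v'' * u' * M').
    rewrite -!mulrA mul_adj2 ?PY_det1 // mulr1 !mulNr mulrN; apply/pmN.
    by rewrite !mulrA; do 2!apply: pmMr.
  have E' : \tr (v'' * u' * M') ^+ 2 = 4 by rewrite -(tr_pm K) trJ2 ?PY_det1.
  apply: (Tconj_pm K); case: Pv'' E' => [->|Pv'']; rewrite ?mul1r => E'.
    have := IH u' M' 1 HM' (or_intror Pu') (or_introl erefl).
    by rewrite mulr1; apply.
  have K' : pm (v'' * u' * M') (- (v'' * u') * M') by rewrite mulNr pmNr; left.
  apply: (Tconj_pm K'); apply: mon_Tconj (mon_S Pu' Pv'' HM') _.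
  by rewrite -(tr_pm K').
- have [M' [u' [v' [HM' Pu' Pv' ->]]]] := mon_rdecomp HM; rewrite mulr1 => E.
  have iG : gam a b (adj2 u) by apply: gen2_adj; apply: PX_gam.
  apply: (Tconj_conj iG); rewrite adj2K.
  have [u'' Pu'' uu] := ps_XX ps Pu' Pu.
  have K : pm (adj2 u * (u * (M' * - (v' * u'))) * u) (M' * v' * u'').
    rewrite !mulrA adj2_mul ?PX_det1 // mul1r mulrN mulNr; apply/pmN.
    by rewrite !mulrA -[_ * u' * u]mulrA; apply: pmMl.
  have E' : \tr (M' * v' * u'') ^+ 2 = 4.
    by rewrite -(tr_pm K) trJ2' ?PX_det1.
  apply: (Tconj_pm K); case: Pu'' E' => [->|Pu'']; rewrite ?mulr1 => E'.
    have := IH 1 M' v' HM' (or_introl erefl) (or_intror Pv').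
    by rewrite mul1r; apply.
  apply: (Tconj_conj (PX_gam Pu'')).
  have K2 : u'' * (M' * v' * u'') * adj2 u'' = u'' * M' * v'.
    by rewrite -!mulrA mul_adj2 ?PX_det1 // mulr1.
  rewrite K2; apply: (both _ _ _ _ Pu'' Pv' HM').
  by rewrite -K2 trJ2 ?PX_det1.
Qed.

Lemma gam_parabolic g : gam a b g -> \tr g ^+ 2 = 4 -> Tconj g.
Proof.
move=> /(NF_gam ps) [u [n [M [v [Pu HM Pv E]]]]] tr4.
apply: (Tconj_pm E); apply: word_Tconj HM Pu Pv _.
by rewrite -(tr_pm E).
Qed.

End Parabolic.

(** * Powers of the generators and Chebyshev sequences *)

Section Powers.
Variable A : comNzRingType.
Implicit Types (a b c : A) (S : A -> Prop).

(** Chebyshev polynomials of the second kind, with the index shifted by one: at c = 2 cos th the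
    value is sin (n th) / sin th. *)
Fixpoint sq c n : A :=
  if n is n'.+1 then if n' is n''.+1 then c * sq c n' - sq c n'' else 1 else 0.

Lemma sqSS c n : sq c n.+2 = c * sq c n.+1 - sq c n.
Proof. by []. Qed.

Lemma xmX a n : xm a ^+ n.+1 =
  mx2 (sq a n.+1 * a - sq a n) (sq a n.+1) (- sq a n.+1) (- sq a n).
Proof.
elim: n => [|n IH]; first by rewrite expr1 /=; congr mx2; ring.
by rewrite exprS IH sqSS mulmx2; congr mx2; ring.
Qed.

Lemma ymX b n : ym b ^+ n.+1 =
  mx2 (- sq b n) (sq b n.+1) (- sq b n.+1) (sq b n.+1 * b - sq b n).
Proof.
elim: n => [|n IH]; first by rewrite expr1 /=; congr mx2; ring.
by rewrite exprS IH sqSS mulmx2; congr mx2; ring.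
Qed.

(* c behaves like 2 cos (pi j / l) with j odd and prime to l, and the entries of
   the l - 1 nontrivial powers lie in S *)
Definition order_seq S c l :=
  [/\ (2 <= l)%N, sq c l = 0, sq c l.-1 = 1 & forall k, (k < l)%N -> S (sq c k)].

Definition powers (x : 'M[A]_2) l u := exists2 k, (0 < k < l)%N & u = x ^+ k.

Lemma order_seqX S a l : order_seq S a l -> xm a ^+ l = - 1.
Proof.
case: l => [|[|l]] [] // _ E1 E2 _; rewrite xmX E1 E2 onemx2 oppmx2.
by congr mx2; ring.
Qed.

Lemma order_seqY S b l : order_seq S b l -> ym b ^+ l = - 1.
Proof.
case: l => [|[|l]] [] // _ E1 E2 _; rewrite ymX E1 E2 onemx2 oppmx2.
by congr mx2; ring.
Qed.

Lemma powersM (x : 'M[A]_2) l u u' : x ^+ l = - 1 ->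
  powers x l u -> powers x l u' -> pmP (opt1 (powers x l)) (u * u').
Proof.
move=> xl [k /andP[k0 kl] ->] [k' /andP[k'0 k'l] ->]; rewrite -exprD.
have [lt|ge] := ltnP (k + k') l.
  by exists (x ^+ (k + k')); [right; exists (k + k') => //; rewrite ltn_addr | left].
have E : x ^+ (k + k') = - x ^+ (k + k' - l).
  by rewrite -{1}(subnKC ge) exprD xl mulN1r.
exists (x ^+ (k + k' - l)); last by right.
have [z|z] := posnP (k + k' - l)%N; first by left; rewrite z expr0.
right; exists (k + k' - l)%N => //; rewrite z ltn_subLR // .
by rewrite -addnS; apply: leq_add => //; rewrite ltnW.
Qed.

Lemma powers_gen (x : 'M[A]_2) l : (2 <= l)%N -> pmP (powers x l) x.
Proof. by move=> l2; exists x; [exists 1; rewrite ?expr1 ?l2 | left]. Qed.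

Lemma powers_adj (x : 'M[A]_2) l : (2 <= l)%N -> \det x = 1 -> x ^+ l = - 1 ->
  pmP (powers x l) (adj2 x).
Proof.
move=> l2 dx xl; exists (x ^+ l.-1).
  by exists l.-1; rewrite //; case: (l) l2 => [|[|n]] //=.
right; rewrite -[adj2 x]mulr1 -[1]opprK -xl mulrN -{1}(prednK (ltnW l2)) exprS.
by rewrite mulrA adj2_mul // mul1r.
Qed.

Lemma order_power_sets S a b l m :
  S 0 -> S 1 -> (forall z w, S z -> S w -> S (z + w)) ->
  (forall z w, S z -> S w -> S (z * w)) ->
  order_seq S a l -> order_seq S b m ->
  power_sets a b S (powers (xm a) l) (powers (ym b) m).
Proof.
move=> S0 S1 SD SM Oa Ob.
have xl := order_seqX Oa; have ym' := order_seqY Ob.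
have [l2 La _ Sa] := Oa; have [m2 Mb _ Sb] := Ob.
have Sa' k : (k <= l)%N -> S (sq a k).
  by rewrite leq_eqVlt => /orP[/eqP ->|/Sa //]; rewrite La.
have Sb' k : (k <= m)%N -> S (sq b k).
  by rewrite leq_eqVlt => /orP[/eqP ->|/Sb //]; rewrite Mb.
split=> //.
- move=> u [[|k] // /= kl ->]; rewrite xmX.
  exists (sq a k.+1), (sq a k); split=> //.
  + by rewrite mulrC -sqSS; apply: Sa'.
  + by apply: Sa'; rewrite ltnW.
  + by apply: Sa'; rewrite ltnW // ltnW.
- move=> v [[|k] // /= kl ->]; rewrite ymX.
  exists (sq b k), (sq b k.+1); split=> //; [by apply: Sb'; rewrite ltnW // ltnW|by apply: Sb'; rewrite ltnW|].
  by rewrite mulrC -sqSS; apply: Sb'.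
- exact: powers_gen.
- by apply: powers_adj => //; exact: det_xm.
- exact: powers_gen.
- by apply: powers_adj => //; exact: det_ym.
- by move=> u u'; apply: powersM.
- by move=> u u'; apply: powersM.
Qed.

Lemma powers_gam_x a b l u : powers (xm a) l u -> gam a b u.
Proof. by case=> k _ ->; apply/gen2_X_ind/gen2X. Qed.

Lemma powers_gam_y a b l u : powers (ym b) l u -> gam a b u.
Proof. by case=> k _ ->; apply/gen2_X_ind/gen2Y. Qed.

End Powers.

(** * The powers for c = 2 cos (pi / l), and for l = oo *)

Section CosPowers.
Variable R : realType.
Implicit Types (a b : R) (g h : 'M[R]_2).

Lemma sq_sin (th : R) n : sq (2 * cos th) n * sin th = sin (n%:R * th).
Proof.
elim/ltn_ind: n => -[|[|n]] IH; first by rewrite !mul0r sin0.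
  by rewrite /= !mul1r.
rewrite sqSS mulrBl -mulrA IH // IH // -!natr1.
have -> : (n%:R + 1 + 1) * th = (n%:R + 1) * th + th by ring.
have -> : n%:R * th = (n%:R + 1) * th - th by ring.
by rewrite sinB sinD; ring.
Qed.

(** The difference of the two sides is 2 cos ((k + 1) th / 2) sin ((k - 1) th / 2), and (k + 1) th
    <= l th = pi. *)
Lemma sin_mul_ge (th : R) l k : l%:R * th = pi -> (0 < k < l)%N ->
  sin th <= sin (k%:R * th).
Proof.
move=> lth /andP[k0 kl].
have th0 : 0 < th.
  rewrite -(pmulr_rgt0 _ (x := l%:R)) ?lth ?pi_gt0 // ltr0n.
  exact: leq_ltn_trans kl.
have k1 : 1 <= k%:R :> R by rewrite ler1n.
have kl1 : (k%:R + 1) * th <= pi by rewrite -lth ler_pM2r // natr1 ler_nat.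
pose al := (k%:R + 1) * th / 2; pose be := (k%:R - 1) * th / 2.
have -> : k%:R * th = al + be by rewrite /al /be; field.
have thE : th = al - be by rewrite /al /be; field.
have -> : sin th = sin (al - be) by rewrite -thE.
rewrite sinB sinD -subr_ge0.
have -> : sin al * cos be + cos al * sin be - (sin al * cos be - cos al * sin be) =
  2 * (cos al * sin be) by ring.
have be0 : 0 <= be by rewrite /be divr_ge0 // mulr_ge0 ?subr_ge0 // ltW.
have al2 : al <= pi / 2 by rewrite /al ler_pM2r // invr_gt0.
have beal : be <= al by rewrite -subr_ge0 -thE ltW.
have pi0 := pi_gt0 R.
rewrite mulr_ge0 // mulr_ge0 //.
  by apply: cos_ge0_pihalf; rewrite al2 andbT; apply: le_trans (le_trans be0 beal); lra.
by apply: sin_ge0_pi; rewrite be0 /=; lra.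
Qed.

Lemma order_seq_cos l : (2 <= l)%N -> order_seq (@nat_like R) (2 * cos (pi / l%:R)) l.
Proof.
move=> l2; set th := pi / l%:R.
have l0 : l%:R != 0 :> R by rewrite pnatr_eq0 -lt0n ltnW.
have lth : l%:R * th = pi by rewrite /th mulrC mulfVK.
have s0 : 0 < sin th.
  apply: sin_gt0_pi; rewrite divr_gt0 ?pi_gt0 ?ltr0n ?(ltnW l2) //=.
  by rewrite ltr_pdivrMr ?ltr0n ?(ltnW l2) // ltr_pMr ?pi_gt0 // ltr1n.
have sn0 : sin th != 0 by rewrite gt_eqF.
split=> //.
- by apply: (mulIf sn0); rewrite sq_sin lth sinpi mul0r.
- apply: (mulIf sn0); rewrite sq_sin mul1r -subn1 natrB ?(ltnW l2) //.
  by rewrite mulrBl lth mul1r sinB sinpi cospi; ring.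
- move=> [|k] kl; [by left | right].
  by rewrite -(ler_pM2r s0) sq_sin mul1r; apply: sin_mul_ge lth _.
Qed.

Lemma nat_likeD (z w : R) : nat_like z -> nat_like w -> nat_like (z + w).
Proof.
move=> [->|Hz]; first by rewrite add0r.
by move=> [->|Hw]; rewrite ?addr0; right => //; lra.
Qed.

Lemma nat_likeM (z w : R) : nat_like z -> nat_like w -> nat_like (z * w).
Proof.
move=> [->|Hz]; first by rewrite mul0r; left.
by move=> [->|Hw]; rewrite ?mulr0; [left | right; rewrite mulr_ege1].
Qed.

(* xm 2 ^+ n = px2 n%:R and ym 2 ^+ n = py2 n%:R. *)
Definition px2 (z : R) : 'M[R]_2 := mx2 (z + 1) z (- z) (1 - z).
Definition py2 (z : R) : 'M[R]_2 := mx2 (1 - z) z (- z) (z + 1).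
Definition par_powers (p : R -> 'M[R]_2) u :=
  exists n : nat, u = p n.+1%:R \/ u = - p (- n.+1%:R).

Lemma par_powersM (p : R -> 'M[R]_2) : (forall z w, p z * p w = p (z + w)) ->
  p 0 = 1 -> forall u u', par_powers p u -> par_powers p u' ->
  pmP (opt1 (par_powers p)) (u * u').
Proof.
move=> pD p0 u u'.
have K (z : int) : pmP (opt1 (par_powers p)) (p z%:~R).
  case: z => [[|n]|n].
  - by exists 1; [left | rewrite p0; left].
  - by exists (p n.+1%:R); [right; exists n; left | left].
  - exists (- p (- n.+1%:R)); first by right; exists n; right.
    by right; rewrite opprK NegzE mulrNz.
have K2 v : par_powers p v -> exists z : int, pm v (p z%:~R).
  move=> [n [->|->]]; [exists n.+1%:Z | exists (- n.+1%:Z)]; first by left.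
  by right; rewrite mulrNz.
move=> /K2 [z Ez] /K2 [w Ew].
have [h Ph E] := K (z + w); exists h => //; apply: pm_trans E.
by rewrite intrD -pD; apply: pmM.
Qed.

Definition Xset (k : option nat) (a : R) :=
  if k is Some l then powers (xm a) l else par_powers px2.
Definition Yset (k : option nat) (b : R) :=
  if k is Some l then powers (ym b) l else par_powers py2.

Lemma cf_oo : cf R None = 2.
Proof. by rewrite /cf /= cos0 mulr1. Qed.

Lemma gam_power_sets (l m : option nat) : le_oo (Some 2%N) l -> le_oo (Some 2%N) m ->
  power_sets (cf R l) (cf R m) (@nat_like R) (Xset l (cf R l)) (Yset m (cf R m)).
Proof.
move=> l2 m2.
have nl n : nat_like (n%:R : R).
  by case: n => [|n]; [left | right; rewrite ler1n].
have nlB n (x : R) : x = n%:R -> nat_like x by move=> ->; apply: nl.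
pose P c d := power_sets (cf R l) (cf R m) (@nat_like R) c d.
have psx : [/\ forall u, Xset l (cf R l) u -> xshape (cf R l) (@nat_like R) u,
  pmP (Xset l (cf R l)) (xm (cf R l)), pmP (Xset l (cf R l)) (adj2 (xm (cf R l))) &
  forall u u', Xset l (cf R l) u -> Xset l (cf R l) u' ->
     pmP (opt1 (Xset l (cf R l))) (u * u')].
  case: l l2 {P} => [l|] l2.
    have O := order_seq_cos l2.
    by case: (order_power_sets (nl 0) (nl 1) nat_likeD nat_likeM O O).
  rewrite /Xset cf_oo; split.
  - move=> u [n [->|->]].
      exists n.+1%:R, n%:R; rewrite /px2 -natr1; split; [congr mx2; ring| | |exact: nl].
        by apply: (@nlB n.+2); rewrite -!natr1; ring.
      by apply: (@nlB n.+1); rewrite -!natr1.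
    exists n.+1%:R, n.+2%:R; rewrite /px2 oppmx2 -!natr1; split; [congr mx2; ring| | |].
    + by apply: (@nlB n); ring.
    + by apply: (@nlB n.+1); rewrite -!natr1.
    + by apply: (@nlB n.+2); rewrite -!natr1.
  - exists (xm 2); last by left.
    by exists 0; left; rewrite /px2; congr mx2; ring.
  - exists (- adj2 (xm 2)); last by right; rewrite opprK.
    by exists 0; right; rewrite /px2 adj2E !oppmx2; congr mx2; ring.
  - apply: par_powersM => [z w|]; first by rewrite /px2 mulmx2; congr mx2; ring.
    by rewrite /px2 onemx2; congr mx2; ring.
have psy : [/\ forall u, Yset m (cf R m) u -> yshape (cf R m) (@nat_like R) u,
  pmP (Yset m (cf R m)) (ym (cf R m)), pmP (Yset m (cf R m)) (adj2 (ym (cf R m))) &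
  forall u u', Yset m (cf R m) u -> Yset m (cf R m) u' ->
     pmP (opt1 (Yset m (cf R m))) (u * u')].
  case: m m2 {P psx} => [m|] m2.
    have O := order_seq_cos m2.
    by case: (order_power_sets (nl 0) (nl 1) nat_likeD nat_likeM O O).
  rewrite /Yset cf_oo; split.
  - move=> u [n [->|->]].
      exists n%:R, n.+1%:R; rewrite /py2 -natr1; split; [congr mx2; ring|exact: nl| |].
        by apply: (@nlB n.+1); rewrite -!natr1.
      by apply: (@nlB n.+2); rewrite -!natr1; ring.
    exists n.+2%:R, n.+1%:R; rewrite /py2 oppmx2 -!natr1; split; [congr mx2; ring| | |].
    + by apply: (@nlB n.+2); rewrite -!natr1.
    + by apply: (@nlB n.+1); rewrite -!natr1.
    + by apply: (@nlB n); ring.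
  - exists (ym 2); last by left.
    by exists 0; left; rewrite /py2; congr mx2; ring.
  - exists (- adj2 (ym 2)); last by right; rewrite opprK.
    by exists 0; right; rewrite /py2 adj2E !oppmx2; congr mx2; ring.
  - apply: par_powersM => [z w|]; first by rewrite /py2 mulmx2; congr mx2; ring.
    by rewrite /py2 onemx2; congr mx2; ring.
have [? ? ? ?] := psx; have [? ? ? ?] := psy.
by split=> //; [exact: (nl 0) | exact: (nl 1) | exact: nat_likeD | exact: nat_likeM].
Qed.

Lemma gam_cf_lower_left (l m : option nat) g :
  le_oo (Some 2%N) l -> le_oo (Some 2%N) m ->
  gam (cf R l) (cf R m) g -> g 1 0 = 0 \/ 1 <= `|g 1 0|.
Proof.
move=> l2 m2 /(gam_lower_left (gam_power_sets l2 m2)) [[]|[]].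
- by left.
- by move=> H; right; rewrite ger0_norm // (le_trans ler01).
- by move/eqP; rewrite oppr_eq0 => /eqP; left.
- by move=> H; right; rewrite -normrN ger0_norm // (le_trans ler01).
Qed.

Lemma cf_lt2 l : (2 <= l)%N -> 0 <= cf R (Some l) < 2.
Proof.
move=> l2; have pi0 := pi_gt0 R.
have l0 : 0 < l%:R :> R by rewrite ltr0n ltnW.
have th0 : 0 < pi / l%:R :> R by rewrite divr_gt0.
have th2 : pi / l%:R <= pi / 2 :> R.
  by rewrite ler_pM2l // lef_pV2 ?posrE // ler_nat.
rewrite /cf /= mulr_ge0 //=; last first.
  by apply: cos_ge0_pihalf; rewrite th2 andbT; lra.
rewrite gtr_pMr // -subr_gt0.
have s0 : 0 < sin (pi / l%:R) :> R by apply: sin_gt0_pi; rewrite th0 /=; lra.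
have := cos2Dsin2 (pi / l%:R : R); nra.
Qed.

Lemma gam_cf_parabolic l m g : (2 <= l)%N -> (2 <= m)%N -> (2 < l)%N || (2 < m)%N ->
  gam (cf R (Some l)) (cf R (Some m)) g -> \tr g ^+ 2 = 4 ->
  Tconj (cf R (Some l)) (cf R (Some m)) g.
Proof.
move=> l2 m2 lm.
have cpos k : (2 < k)%N -> 0 < cf R (Some k).
  move=> k2; rewrite mulr_gt0 //; apply: cos_gt0_pihalf.
  have pi0 := pi_gt0 R; have k0 : 0 < k%:R :> R by rewrite ltr0n ltnW // ltnW.
  have : 0 < pi / k%:R :> R by rewrite divr_gt0.
  have : pi / k%:R < pi / 2 :> R by rewrite ltr_pM2l // ltf_pV2 ?posrE // ltr_nat.
  by move=> H1 H2; apply/andP; split; rewrite /=; lra.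
have /andP[a0 a2] := cf_lt2 l2; have /andP[b0 b2] := cf_lt2 m2.
have ps := @gam_power_sets (Some l) (Some m) l2 m2.
apply: (gam_parabolic ps).
- by case/orP: lm => /cpos; move: a0 b0; lra.
- move=> u [k kl uE].
  have dX : \det u = 1 by rewrite uE; apply: (@gam_det _ (cf R (Some l)) 0); apply/gen2_X_ind/gen2X.
  have Pu : Xset (Some l) (cf R (Some l)) u by exists k.
  have [q [r [uE' _ q1 _]]] := PX_det ps Pu dX.
  move: dX; rewrite uE' det_mx2 tr_mx2; apply: contra_eqN => /eqP E.
  move: E a0 a2 q1; move: (cf R (Some l)) => c E c0 c2 q1.
  (* tr^2 - 4 det of a power is q^2 (c^2 - 4), which is not 0 since q >= 1 and 0 <= c < 2. *)
  apply/eqP => D; have H : q ^+ 2 * (c ^+ 2 - 4) = 0.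
    have -> : q ^+ 2 * (c ^+ 2 - 4) = (q * c - r + - r) ^+ 2 - 4 * ((q * c - r) * - r - q * - q) by ring.
    by rewrite E D; ring.
  have /eqP := H; rewrite mulf_eq0 expf_eq0 /= => /orP[/eqP|/eqP]; nra.
- move=> u [k kl uE].
  have dX : \det u = 1 by rewrite uE; apply: (@gam_det _ 0 (cf R (Some m))); apply/gen2_X_ind/gen2Y.
  have Pu : Yset (Some m) (cf R (Some m)) u by exists k.
  have [q [r [uE' _ q1 _]]] := PY_det ps Pu dX.
  move: dX; rewrite uE' det_mx2 tr_mx2; apply: contra_eqN => /eqP E.
  move: E b0 b2 q1; move: (cf R (Some m)) => c E c0 c2 q1.
  apply/eqP => D; have H : r ^+ 2 * (c ^+ 2 - 4) = 0.
    have -> : r ^+ 2 * (c ^+ 2 - 4) = (- q + (r * c - q)) ^+ 2 - 4 * (- q * (r * c - q) - r * - r) by ring.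
    by rewrite E D; ring.
  have /eqP := H; rewrite mulf_eq0 expf_eq0 /= => /orP[/eqP|/eqP]; nra.
- move=> u /powers_gam_x; apply: (fun f => gam_det (f 0)).
- move=> u /powers_gam_y; apply: (fun f => gam_det (f 0)).
- by move=> u /powers_gam_x.
- by move=> u /powers_gam_y.
Qed.

End CosPowers.

(** * Conjugates of 2 cos (2 pi / N) over the rationals *)

Section CyclotomicConjugates.
Import complex.
Variable R : realType.
Implicit Types (P Q : {poly rat}) (x y : R).

Definition evq P x : R := (map_poly ratr P).[x].

Lemma evqB P Q x : evq (P - Q) x = evq P x - evq Q x.
Proof. by rewrite /evq rmorphB hornerD hornerN. Qed.

Lemma evqM P Q x : evq (P * Q) x = evq P x * evq Q x.
Proof. by rewrite /evq rmorphM hornerM. Qed.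

Lemma evq1 x : evq 1 x = 1.
Proof. by rewrite /evq rmorph1 hornerC. Qed.

Lemma evq0 x : evq 0 x = 0.
Proof. by rewrite /evq rmorph0 horner0. Qed.

Lemma evqX x : evq 'X x = x.
Proof. by rewrite /evq map_polyX hornerX. Qed.

Lemma evqC c x : evq c%:P x = ratr c.
Proof. by rewrite /evq map_polyC hornerC. Qed.

(** z^n - 1 is the product of the Phi_d (z) with d dividing n; a factor that vanishes gives z^d = 1,
    hence d = n. *)
Lemma Phi_root (F : numFieldType) n (z : F) : n.-primitive_root z ->
  root (map_poly intr 'Phi_n) z.
Proof.
move=> pz; have n0 := prim_order_gt0 pz.
pose v d := (map_poly intr 'Phi_d : {poly F}).[z].
have vE d : (0 < d)%N -> \prod_(e <- divisors d) v e = z ^+ d - 1.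
  move=> d0; rewrite -horner_prod -(rmorph_prod (map_poly (intr : int -> F))).
  by rewrite prod_Cyclotomic // rmorphB /= map_polyXn rmorph1 !hornerE.
have := vE n n0; rewrite (prim_expr_order pz) subrr => /eqP.
rewrite prodf_seq_eq0 => /hasP[d]; rewrite -dvdn_divisors // => dn /= /eqP vd.
have d0 : (0 < d)%N by apply: dvdn_gt0 dn.
suff nd : n = d by rewrite nd; apply/eqP.
apply/eqP; rewrite eqn_dvd dn andbT (prim_order_dvd pz) -subr_eq0 -vE //.
by rewrite prodf_seq_eq0; apply/hasP; exists d; rewrite -?dvdn_divisors //= vd.
Qed.

(** The gcd of P and Phi_n is not constant because of the root z. An algebraic root r of it is a
    primitive root of order n, whose minimal polynomial is Phi_n, so that Phi_n divides the gcd and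
    hence P. *)
Lemma Phi_irreducible n P (F : numFieldType) (z w : F) :
  n.-primitive_root z -> n.-primitive_root w ->
  root (map_poly ratr P) z -> root (map_poly ratr P) w.
Proof.
move=> pz pw Pz; have n0 := prim_order_gt0 pz.
pose Phi : {poly rat} := map_poly intr 'Phi_n.
have PhiE (K : numFieldType) : map_poly ratr Phi = map_poly intr 'Phi_n :> {poly K}.
  by rewrite /Phi -map_poly_comp; apply: eq_map_poly => c /=; rewrite ratr_int.
suff : Phi %| P.
  case/dvdpP => Q ->; rewrite rmorphM rootM; apply/orP; right.
  by move: (Phi_root pw); rewrite -PhiE.
pose g := gcdp P Phi.
have g_nc : size g != 1%N.
  apply/negP => /eqP g1; have : coprimep P Phi by rewrite /coprimep g1.
  case/Bezout_eq1_coprimepP => -[u v] /= /(congr1 (map_poly (ratr : rat -> F))).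
  rewrite rmorphD !rmorphM rmorph1 => /(congr1 (horner^~ z)).
  have Phz : root (map_poly ratr Phi) z by rewrite PhiE Phi_root.
  rewrite hornerD !hornerM (rootP Pz) (rootP Phz) !mulr0 addr0 hornerC.
  by move=> /eqP; rewrite eq_sym oner_eq0.
have gPhi : g %| Phi by exact: dvdp_gcdr.
have [r rg] : exists r : algC, root (map_poly ratr g) r.
  by apply/closed_rootP; rewrite size_map_poly.
have [c pc] := C_prim_root_exists n0.
have rPhi : root (map_poly ratr Phi) r.
  by case/dvdpP: gPhi => Q ->; rewrite rmorphM rootM rg orbT.
have pr : n.-primitive_root r.
  by move: rPhi; rewrite PhiE (Cintr_Cyclotomic pc) root_cyclotomic.
have [p [Ep mp dvp]] := minCpolyP r.
have Phip : Phi = p.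
  apply: (map_inj_poly (fmorph_inj (ratr : {rmorphism rat -> algC})) (rmorph0 _)).
  by rewrite /= -Ep (minCpoly_cyclotomic pr) -(Cintr_Cyclotomic pr) PhiE.
have := rg; rewrite dvp -Phip => /dvdp_trans; apply; exact: dvdp_gcdl.
Qed.

Definition czeta N j : R[i] := (cos (2 * pi * j%:R / N%:R) +i* sin (2 * pi * j%:R / N%:R))%C.

Lemma czetaD N j k : czeta N (j + k) = czeta N j * czeta N k.
Proof.
rewrite /czeta natrD mulrDr mulrDl cosD sinD; congr (_ +i* _)%C; ring.
Qed.

Lemma czeta0 N : czeta N 0 = 1.
Proof. by rewrite /czeta mulr0 mul0r cos0 sin0. Qed.

Lemma czetaX N j k : czeta N j ^+ k = czeta N (j * k).
Proof.
elim: k => [|k IH]; first by rewrite expr0 muln0 czeta0.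
by rewrite exprS IH mulnS czetaD.
Qed.

(** If the order d were less than N, the angle th would lie strictly between 0 and 2 pi with cos th
    = 1, against sin (th / 2) > 0. *)
Lemma czeta_prim N : (0 < N)%N -> N.-primitive_root (czeta N 1).
Proof.
move=> N0; have N0' : 0 < N%:R :> R by rewrite ltr0n.
have zN : czeta N 1 ^+ N = 1.
  rewrite czetaX mul1n /czeta mulfK ?gt_eqF //.
  have -> : 2 * pi = pi + pi :> R by ring.
  by rewrite cosD sinD cospi sinpi; congr (_ +i* _)%C; ring.
have [d pd dN] := prim_order_exists N0 zN.
suff E : d = N by rewrite E in pd.
apply/eqP; rewrite eqn_leq dvdn_leq //= leqNgt; apply/negP => dltN.
have d0 := prim_order_gt0 pd.
have := prim_expr_order pd; rewrite czetaX mul1n /czeta => -[c1 s0].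
set th := 2 * pi * d%:R / N%:R in c1 s0.
have pi0 := pi_gt0 R.
have th0 : 0 < th by rewrite /th divr_gt0 // mulr_gt0 ?ltr0n // mulr_gt0.
have th2 : th < 2 * pi.
  by rewrite /th ltr_pdivrMr // ltr_pM2l ?ltr_nat // mulr_gt0.
have c2 : cos th = 1 - 2 * sin (th / 2) ^+ 2.
  have {1}-> : th = th / 2 + th / 2 by field.
  by rewrite cosD -!expr2 cos2sin2; ring.
have : 0 < sin (th / 2).
  by apply: sin_gt0_pi; apply/andP; split; lra.
by nra.
Qed.

Lemma czeta_cop N j : (0 < N)%N -> coprime j N -> N.-primitive_root (czeta N j).
Proof.
move=> N0 cj; have -> : czeta N j = czeta N 1 ^+ j by rewrite czetaX mul1n.
by rewrite prim_root_exp_coprime ?czeta_prim.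
Qed.

Definition tcos N j : R := 2 * cos (2 * pi * j%:R / N%:R).

(** 2 cos (2 pi j / N) is z + z^(N - 1) for z = [czeta N j], so that P becomes a polynomial Q in z,
    and the primitive roots of order N are conjugate. *)
Lemma evq_conj N j k P : (0 < N)%N -> coprime j N -> coprime k N ->
  evq P (tcos N j) = 0 -> evq P (tcos N k) = 0.
Proof.
move=> N0 cj ck; have N0' : 0 < N%:R :> R by rewrite ltr0n.
pose Q := P \Po ('X + 'X^(N.-1)).
have QE i : (map_poly ratr Q).[czeta N i] = (evq P (tcos N i))%:C%C.
  have -> : map_poly ratr Q = map_poly ratr P \Po ('X + 'X^(N.-1)) :> {poly R[i]}.
    by rewrite map_comp_poly rmorphD /= map_polyX map_polyXn.
  rewrite horner_comp hornerD hornerX hornerXn czetaX.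
  have -> : czeta N i + czeta N (i * N.-1) = (tcos N i)%:C%C.
    have -> : czeta N (i * N.-1) = (cos (2 * pi * i%:R / N%:R) -i* sin (2 * pi * i%:R / N%:R))%C.
      have -> : 2 * pi * i%:R / N%:R = 2 * pi * i%:R - 2 * pi * (i * N.-1)%N%:R / N%:R :> R.
        by rewrite natrM -subn1 natrB //; field; rewrite gt_eqF.
      have E1 n : cos (2 * pi * n%:R) = 1 :> R /\ sin (2 * pi * n%:R) = 0 :> R.
        elim: n => [|n [IH1 IH2]]; first by rewrite mulr0 cos0 sin0.
        have -> : 2 * pi * n.+1%:R = 2 * pi * n%:R + pi + pi :> R by rewrite -natr1; ring.
        by rewrite !cosDpi !sinDpi !opprK IH1 IH2.
      have [c1 s1] := E1 i.
      rewrite /czeta cosB sinB c1 s1; congr (_ +i* _)%C; ring.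
    by rewrite /czeta /tcos; apply/eqP; rewrite eq_complex /=; apply/andP; split; apply/eqP; ring.
  rewrite /evq -horner_map /= -map_poly_comp; congr (_.[_]).
  by apply: eq_map_poly => c /=; rewrite fmorph_rat.
move=> E; have : root (map_poly ratr Q) (czeta N j) by rewrite rootE QE E.
move/(Phi_irreducible (czeta_cop N0 cj) (czeta_cop N0 ck)).
by rewrite rootE QE => /eqP [].
Qed.

End CyclotomicConjugates.

(** * Subfields of the reals and their real places *)

Section Subfields.
Variable R : realType.
Implicit Types (K S : set R) (x y : R).

Lemma subfieldP K : subfield K <-> [/\ K 1,
  forall x y, K x -> K y -> K (x - y) & forall x y, K x -> K y -> K (x / y)].
Proof.
split=> [[K1 KB KV]|[K1 KB KV]].
  split; first by apply: set_mem.
    by move=> x y Kx Ky; apply: set_mem; apply: KB; apply: mem_set.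
  by move=> x y Kx Ky; apply: set_mem; apply: KV; apply: mem_set.
split; first by apply: mem_set.
  by move=> x y /set_mem Kx /set_mem Ky; apply: mem_set; apply: KB.
by move=> x y /set_mem Kx /set_mem Ky; apply: mem_set; apply: KV.
Qed.

Section Closure.
Variable K : set R.
Hypothesis HK : subfield K.

Lemma subfield1 : K 1. Proof. by have /subfieldP[] := HK. Qed.

Lemma subfieldB x y : K x -> K y -> K (x - y).
Proof. by have /subfieldP[_ + _] := HK; apply. Qed.

Lemma subfieldV_div x y : K x -> K y -> K (x / y).
Proof. by have /subfieldP[_ _] := HK; apply. Qed.

Lemma subfield0 : K 0.
Proof. by rewrite -(subrr 1); apply: subfieldB; exact: subfield1. Qed.

Lemma subfieldN x : K x -> K (- x).
Proof. by move=> Kx; rewrite -sub0r; apply: subfieldB => //; exact: subfield0. Qed.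

Lemma subfieldD x y : K x -> K y -> K (x + y).
Proof. by move=> Kx Ky; rewrite -[y]opprK; apply: subfieldB => //; exact: subfieldN. Qed.

Lemma subfieldV x : K x -> K x^-1.
Proof. by move=> Kx; rewrite -div1r; apply: subfieldV_div => //; exact: subfield1. Qed.

Lemma subfieldM x y : K x -> K y -> K (x * y).
Proof. by move=> Kx Ky; rewrite -[y]invrK; apply: subfieldV_div => //; exact: subfieldV. Qed.

Lemma subfield_nat n : K n%:R.
Proof.
elim: n => [|n IH]; first exact: subfield0.
by rewrite -natr1; apply: subfieldD => //; exact: subfield1.
Qed.

Lemma subfield_int (z : int) : K z%:~R.
Proof.
case: z => n; first exact: subfield_nat.
by rewrite NegzE mulrNz; apply/subfieldN/subfield_nat.
Qed.

Lemma subfield_rat (q : rat) : K (ratr q).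
Proof. by apply: subfieldV_div; exact: subfield_int. Qed.

End Closure.

Lemma subfield_generated S : subfield (generated_field S).
Proof.
apply/subfieldP; split.
- by move=> P [/subfieldP[]].
- move=> x y Hx Hy P PP; case: (PP) => /subfieldP[_ PB _] _.
  by apply: PB; [apply: Hx | apply: Hy].
- move=> x y Hx Hy P PP; case: (PP) => /subfieldP[_ _ PV] _.
  by apply: PV; [apply: Hx | apply: Hy].
Qed.

Lemma generated_field_in S x : S x -> generated_field S x.
Proof. by move=> Sx P [_]; apply. Qed.

Lemma generated_field_min S K : subfield K -> S `<=` K -> generated_field S `<=` K.
Proof. by move=> HK SK x; apply; split. Qed.

Lemma generated_field_eq S S' : S `<=` generated_field S' -> S' `<=` generated_field S ->
  generated_field S = generated_field S'.
Proof.
by move=> H H'; apply/seteqP; split; apply: generated_field_min => //;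
  exact: subfield_generated.
Qed.

Section RealPlaces.
Variables (K : set R) (sigma : R -> R).
Hypotheses (HK : subfield K) (Hs : real_place K sigma).

Lemma place1 : sigma 1 = 1. Proof. by case: Hs. Qed.

Lemma placeD x y : K x -> K y -> sigma (x + y) = sigma x + sigma y.
Proof. by case: Hs => _ + _ _; apply. Qed.

Lemma placeM x y : K x -> K y -> sigma (x * y) = sigma x * sigma y.
Proof. by case: Hs => _ _ + _; apply. Qed.

Lemma place0 : sigma 0 = 0.
Proof.
have := placeD (subfield0 HK) (subfield0 HK); rewrite addr0.
by move/eqP; rewrite -subr_eq0 opprD addrA subrr sub0r oppr_eq0 => /eqP.
Qed.

Lemma placeN x : K x -> sigma (- x) = - sigma x.
Proof.
move=> Kx; apply/eqP; rewrite -addr_eq0 -placeD //; last exact: subfieldN.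
by rewrite addNr place0.
Qed.

Lemma place_nat n : sigma n%:R = n%:R.
Proof.
elim: n => [|n IH]; first exact: place0.
rewrite -natr1 placeD ?IH ?place1 //; first exact: subfield_nat.
exact: subfield1.
Qed.

Lemma place_int (z : int) : sigma z%:~R = z%:~R.
Proof.
case: z => n; first exact: place_nat.
by rewrite NegzE mulrNz placeN ?place_nat //; apply: subfield_nat.
Qed.

Lemma place_rat (q : rat) : sigma (ratr q) = ratr q.
Proof.
have d0 : (denq q)%:~R != 0 :> R by rewrite intr_eq0 denq_neq0.
apply: (mulIf d0); rewrite -{1}place_int -placeM; last 2 first.
- exact: subfield_rat.
- exact: subfield_int.
have -> : ratr q * (denq q)%:~R = (numq q)%:~R :> R by rewrite /ratr mulfVK.
exact: place_int.
Qed.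

End RealPlaces.

End Subfields.

(** * Invariant trace field and quaternion algebra of [gam a b] *)

Section TraceField.
Variable R : realType.
Implicit Types (g h C : 'M[R]_2) (K : set R) (a b : R).

(** The parity of the word length: the generators satisfy [typ2] and products of two of them [typ1].
    Since b^2 lies in K, the condition on b times an entry says that the entry lies in b K. *)
Definition typ1 K b g := [/\ K (g 0 0), K (b * g 0 1), K (b * g 1 0) & K (g 1 1)].
Definition typ2 K b g := [/\ K (b * g 0 0), K (g 0 1), K (g 1 0) & K (b * g 1 1)].

Definition abfield a b := generated_field [set x | [\/ x = a ^+ 2, x = b ^+ 2 | x = a * b]].

Section Types.
Variables (K : set R) (b : R).
Hypotheses (HK : subfield K) (b0 : b != 0) (Kbb : K (b ^+ 2)).

Lemma K_b2 x y : K (b * x) -> K (b * y) -> K (x * y).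
Proof.
move=> Kx Ky; have -> : x * y = (b * x) * (b * y) / b ^+ 2 by field.
by apply: subfieldV_div => //; apply: subfieldM.
Qed.

Lemma typ11 g h : typ1 K b g -> typ1 K b h -> typ1 K b (g * h).
Proof.
elim/mx2_ind: g => p q r s; elim/mx2_ind: h => p' q' r' s'.
rewrite /typ1 mulmx2 !mx2E => -[? ? ? ?] [? ? ? ?]; split.
- by apply: subfieldD; [|exact: subfieldM|exact: K_b2].
- have -> : b * (p * q' + q * s') = p * (b * q') + (b * q) * s' by ring.
  by apply: subfieldD => //; apply: subfieldM.
- have -> : b * (r * p' + s * r') = (b * r) * p' + s * (b * r') by ring.
  by apply: subfieldD => //; apply: subfieldM.
- by apply: subfieldD; [|exact: K_b2|exact: subfieldM].
Qed.

Lemma typ21 g h : typ2 K b g -> typ1 K b h -> typ2 K b (g * h).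
Proof.
elim/mx2_ind: g => p q r s; elim/mx2_ind: h => p' q' r' s'.
rewrite /typ1 /typ2 mulmx2 !mx2E => -[? ? ? ?] [? ? ? ?]; split.
- have -> : b * (p * p' + q * r') = (b * p) * p' + q * (b * r') by ring.
  by apply: subfieldD => //; apply: subfieldM.
- by apply: subfieldD; [|exact: K_b2|exact: subfieldM].
- by apply: subfieldD; [|exact: subfieldM|exact: K_b2].
- have -> : b * (r * q' + s * s') = r * (b * q') + (b * s) * s' by ring.
  by apply: subfieldD => //; apply: subfieldM.
Qed.

Lemma typ22 g h : typ2 K b g -> typ2 K b h -> typ1 K b (g * h).
Proof.
elim/mx2_ind: g => p q r s; elim/mx2_ind: h => p' q' r' s'.
rewrite /typ1 /typ2 mulmx2 !mx2E => -[? ? ? ?] [? ? ? ?]; split.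
- by apply: subfieldD; [|exact: K_b2|exact: subfieldM].
- have -> : b * (p * q' + q * s') = (b * p) * q' + q * (b * s') by ring.
  by apply: subfieldD => //; apply: subfieldM.
- have -> : b * (r * p' + s * r') = r * (b * p') + (b * s) * r' by ring.
  by apply: subfieldD => //; apply: subfieldM.
- by apply: subfieldD; [|exact: subfieldM|exact: K_b2].
Qed.

Lemma typ1_1 : typ1 K b 1.
Proof.
have K0 := subfield0 HK; have K1 := subfield1 HK.
by rewrite onemx2 /typ1 !mx2E mulr0; split.
Qed.

Lemma typN g : (typ1 K b g -> typ1 K b (- g)) /\ (typ2 K b g -> typ2 K b (- g)).
Proof.
elim/mx2_ind: g => p q r s; rewrite /typ1 /typ2 oppmx2 !mx2E !mulrN.
by split=> -[? ? ? ?]; split; apply: subfieldN.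
Qed.



Lemma typ1Z k g : K k -> typ1 K b g -> typ1 K b (k *: g).
Proof.
move=> Kk; elim/mx2_ind: g => p q r s; rewrite /typ1 scalemx2 !mx2E => -[? ? ? ?].
by split; rewrite ?(mulrCA b); apply: subfieldM.
Qed.

Lemma typ1D g h : typ1 K b g -> typ1 K b h -> typ1 K b (g + h).
Proof.
elim/mx2_ind: g => p q r s; elim/mx2_ind: h => p' q' r' s'.
rewrite /typ1 addmx2 !mx2E => -[? ? ? ?] [? ? ? ?].
by split; rewrite ?mulrDr; apply: subfieldD.
Qed.

Lemma typ_adj g : (typ1 K b g -> typ1 K b (adj2 g)) /\ (typ2 K b g -> typ2 K b (adj2 g)).
Proof.
elim/mx2_ind: g => p q r s; rewrite /typ1 /typ2 adj2E !mx2E !mulrN.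
by split=> -[? ? ? ?]; split=> //; apply: subfieldN.
Qed.

Lemma gam_typ a g : K (a * b) -> gam a b g -> typ1 K b g \/ typ2 K b g.
Proof.
have K0 := subfield0 HK; have K1 := subfield1 HK.
have KN1 := subfieldN HK K1.
move=> Kab.
have Tx : typ2 K b (xm a) by rewrite /typ2 !mx2E mulr0 mulrC; split.
have Ty : typ2 K b (ym b) by rewrite /typ2 !mx2E mulr0 -expr2; split.
have step z h : typ2 K b z -> typ1 K b h \/ typ2 K b h ->
    typ1 K b (z * h) \/ typ2 K b (z * h).
  by move=> Hz [Hh|Hh]; [right; apply: typ21 | left; apply: typ22].
elim=> [|k _ IH|k _ IH|k _ IH|k _ IH|k _ IH].
- by left; exact: typ1_1.
- by have [N1 N2] := typN k; case: IH; [left; apply: N1 | right; apply: N2].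
- exact: step.
- by apply: step => //; apply: (typ_adj _).2.
- exact: step.
- by apply: step => //; apply: (typ_adj _).2.
Qed.

End Types.

Lemma tr_conj C g : C \is a GRing.unit -> \tr (C * g * C^-1) = \tr g.
Proof.
move=> UC; rewrite mxtrace_mulC mulmxA -[X in \tr (X *m _)]/(C^-1 * C).
by rewrite mulVr // mul1mx.
Qed.

Lemma det_conj C g : C \is a GRing.unit -> \det (C * g * C^-1) = \det g.
Proof.
by rewrite mx2_unit => UC; rewrite !detM2 det_inv2 mulrAC divff ?mul1r.
Qed.

Lemma conjM C g h : C \is a GRing.unit ->
  C * (g * h) * C^-1 = (C * g * C^-1) * (C * h * C^-1).
Proof.
by move=> UC; rewrite -!mulrA [C^-1 * (C * _)]mulrA mulVr // mul1r.
Qed.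

Lemma squares_conj C (G : set 'M[R]_2) : C \is a GRing.unit ->
  (forall g, G g -> detpm1 g) ->
  conjugate C (squares_subgroup G) = squares_subgroup (conjugate C G).
Proof.
move=> UC dG; rewrite /squares_subgroup generated_conj //; last first.
  by move=> _ [g Gg <-]; apply: detpm1M; apply: dG.
congr generated_subgroup; apply/seteqP; split=> h.
  by move=> [_ [g Gg <-] <-]; exists (C * g * C^-1); [exists g | rewrite conjM].
by move=> [_ [g Gg <-] <-]; exists (g * g); [exists g | rewrite conjM].
Qed.

Lemma invariant_trace_field_conj C (G : set 'M[R]_2) : C \is a GRing.unit ->
  (forall g, G g -> detpm1 g) ->
  invariant_trace_field (conjugate C G) = invariant_trace_field G.
Proof.
move=> UC dG; rewrite /invariant_trace_field -squares_conj //.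
congr generated_field; apply/seteqP; split=> x.
  by move=> [_ [g Sg <-] <-]; exists g; rewrite ?tr_conj.
by move=> [g Sg <-]; exists (C * g * C^-1); [exists g | rewrite tr_conj].
Qed.

Section Gam.
Variables (a b : R).
Hypothesis b0 : b != 0.
Local Notation K := (abfield a b).
Local Notation G := (gam a b : set 'M[R]_2).

Lemma abfield_sub : subfield K. Proof. exact: subfield_generated. Qed.
Lemma abfield_aa : K (a ^+ 2). Proof. by apply: generated_field_in; constructor 1. Qed.
Lemma abfield_bb : K (b ^+ 2). Proof. by apply: generated_field_in; constructor 2. Qed.
Lemma abfield_ab : K (a * b). Proof. by apply: generated_field_in; constructor 3. Qed.

Lemma gam_sq_psl : psl_subgroup [set g : 'M[R]_2 | typ1 K b g /\ detpm1 g].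
Proof.
have HK := abfield_sub; split=> /=.
- split; split; [exact: typ1_1|by left; rewrite det1| |by left; rewrite detN2 det1].
  by have [N1 _] := typN b HK 1; apply: N1; exact: typ1_1.
- by move=> g [].
- move=> g h [Tg Dg] [Th Dh]; split; last exact: detpm1M.
  by apply: typ11 => //; exact: abfield_bb.
- move=> g [Tg Dg]; split; last exact: detpm1V.
  have gV : g^-1 = (\det g)^-1 *: adj2 g.
    move: (detpm1_neq0 Dg); elim/mx2_ind: g {Tg Dg} => p q r s; rewrite det_mx2 adj2E => D.
    by rewrite invmx2.
  rewrite gV; apply: typ1Z => //; last by apply: (typ_adj b HK _).1.
  case: Dg => ->; rewrite ?invrN invr1; first exact: subfield1.
  exact: (subfieldN HK (subfield1 HK)).
Qed.

Lemma gam_squares_typ1 g : squares_subgroup G g -> typ1 K b g.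
Proof.
have HK := abfield_sub; have Kbb := abfield_bb.
move=> Sg; suff : [set g : 'M[R]_2 | typ1 K b g /\ detpm1 g] g by case.
apply: Sg; split; first exact: gam_sq_psl.
move=> _ [h Gh <-]; split; last first.
  by left; rewrite detM2 (gam_det Gh) mulr1.
by have [T|T] := gam_typ HK b0 Kbb abfield_ab Gh; [apply: typ11 | apply: typ22].
Qed.

Lemma gam_squares_in g : G g -> squares_subgroup G (g * g).
Proof. by move=> Gg; apply: generated_sub; exists g. Qed.

Lemma gam_squares_is_psl : psl_subgroup (squares_subgroup G).
Proof.
apply: generated_psl => _ [h Gh <-]; left.
by rewrite detM2 (gam_det Gh) mulr1.
Qed.

(** Products of squares have even length, so their traces lie in K; conversely the traces of x^2,
    y^2 and x^2 y^2 give a^2, b^2 and a b. *)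
Lemma gam_trace_field : invariant_trace_field G = K.
Proof.
have HK := abfield_sub; apply/seteqP; split.
  apply: generated_field_min => // _ [g Sg <-].
  have [? _ _ ?] := gam_squares_typ1 Sg.
  by rewrite /mxtrace big_ord2; apply: (subfieldD HK).
set F := invariant_trace_field G; have HF : subfield F by exact: subfield_generated.
have tF g : squares_subgroup G g -> F (\tr g).
  by move=> Sg; apply: generated_field_in; exists g.
have F2 := subfield_nat HF 2.
have Sx := gam_squares_in (gen2X (xm a) (ym b)).
have Sy := gam_squares_in (gen2Y (xm a) (ym b)).
have Sxy : squares_subgroup G (xm a * xm a * (ym b * ym b)).
  by have [_ _ SM _] := gam_squares_is_psl; apply: SM.
have Faa : F (a ^+ 2).
  have -> : a ^+ 2 = \tr (xm a * xm a) + 2 by rewrite mulmx2 tr_mx2; ring.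
  by apply: (subfieldD HF) => //; apply: tF.
have Fbb : F (b ^+ 2).
  have -> : b ^+ 2 = \tr (ym b * ym b) + 2 by rewrite mulmx2 tr_mx2; ring.
  by apply: (subfieldD HF) => //; apply: tF.
apply: generated_field_min => // x [] -> //.
have -> : a * b = (2 - a ^+ 2 - b ^+ 2 - \tr (xm a * xm a * (ym b * ym b))) / 2.
  by rewrite !mulmx2 tr_mx2; field.
apply: (subfieldV_div HF) => //; do 3?apply: (subfieldB HF) => //; exact: tF.
Qed.

Hypothesis t0 : a + b != 0.

(** The square of the translation gives the multiples of the matrix unit E12, and y^2 produces the
    other matrix units from it. *)
Lemma gam_algebra : generated_algebra K (squares_subgroup G) = typ1 K b.
Proof.
have HK := abfield_sub; have Kbb := abfield_bb.
apply/seteqP; split=> g.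
  apply; split; last by move=> h; apply: gam_squares_typ1.
  split; [exact: typ1_1 | by move=> *; apply: typ1D | by move=> *; apply: typ11 |].
  by move=> *; apply: typ1Z.
move=> Tg B [[B1 BD BM BZ] SB].
have BB x y : B x -> B y -> B (x - y).
  move=> Bx By; rewrite -scaleN1r; apply: BD => //; apply: BZ => //.
  exact: (subfieldN HK (subfield1 HK)).
have Kbt : K (b * (a + b)).
  have -> : b * (a + b) = a * b + b ^+ 2 by ring.
  by apply: (subfieldD HK) => //; exact: abfield_ab.
have E12 k : K (b * k) -> B (mx2 0 k 0 0).
  move=> Kk.
  have -> : mx2 0 k 0 0 = (b * k / (2 * (b * (a + b)))) *: (tm (a + b) * tm (a + b) - 1).
    rewrite tmM onemx2 oppmx2 addmx2 scalemx2.
    by congr mx2; field; rewrite b0 t0.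
  apply: BZ; first by apply: (subfieldV_div HK) => //; apply: (subfieldM HK) => //; exact: (subfield_nat HK).
  by apply: BB => //; exact: (SB _ (gam_squares_in (gam_tm a b))).
have By : B (ym b * ym b) by exact: (SB _ (gam_squares_in (gen2Y (xm a) (ym b)))).
have E11 : B (mx2 1 0 0 0).
  pose k := b * (1 - b ^+ 2).
  have -> : mx2 1 0 0 0 = (- (b ^+ 2)^-1) *: (mx2 0 b 0 0 * (ym b * ym b) + mx2 0 k 0 0).
    by rewrite !mulmx2 addmx2 scalemx2 /k; congr mx2; field.
  apply: BZ; first by apply: (subfieldN HK); apply: (subfieldV HK).
  apply: BD; first by apply: BM => //; apply: E12; rewrite -expr2.
  apply: E12; rewrite /k mulrA -expr2; apply: (subfieldM HK) => //.
  by apply: (subfieldB HK) => //; exact: (subfield1 HK).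
have E22 : B (mx2 0 0 0 1).
  have -> : mx2 0 0 0 1 = 1 - mx2 1 0 0 0 :> 'M[R]_2.
    by rewrite onemx2 oppmx2 addmx2; congr mx2; ring.
  exact: BB.
have E21 k : K (b * k) -> B (mx2 0 0 k 0).
  move=> Kk; have -> : mx2 0 0 k 0 =
      (- (b * k) / b ^+ 2) *: (mx2 0 0 0 1 * (ym b * ym b) * mx2 1 0 0 0).
    by rewrite !mulmx2 scalemx2; congr mx2; field.
  apply: BZ; first by apply: (subfieldV_div HK) => //; apply: (subfieldN HK).
  by apply: (BM) => //; apply: (BM).
case: Tg; elim/mx2_ind: g => p q r s; rewrite !mx2E => Kp Kq Kr Ks.
have -> : mx2 p q r s = p *: mx2 1 0 0 0 + mx2 0 q 0 0 + mx2 0 0 r 0 + s *: mx2 0 0 0 1.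
  by rewrite !scalemx2 !addmx2; congr mx2; ring.
by apply: (BD); [apply: (BD); [apply: (BD); [apply: (BZ) | apply: E12] | apply: E21] | apply: (BZ)].
Qed.

End Gam.

Lemma generated_algebra_conj C (F : set R) (S : set 'M[R]_2) : C \is a GRing.unit ->
  generated_algebra F (conjugate C S) = conjugate C (generated_algebra F S).
Proof.
have sub D T : D \is a GRing.unit ->
    conjugate D (generated_algebra F T) `<=` generated_algebra F (conjugate D T).
  move=> UD _ [h Hh <-] B [[B1 BD BM BZ] TB].
  apply: (Hh [set k | B (D * k * D^-1)]); split; last first.
    by move=> k Tk; apply: TB; exists k.
  split=> /=; first by rewrite mulr1 divrr.
  - by move=> x y Bx By; rewrite mulrDr mulrDl; apply: BD.
  - by move=> x y Bx By; rewrite conjM //; apply: BM.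
  - by move=> k x Fk Bx; rewrite -scalerAr -scalerAl; apply: BZ.
move=> UC; have UCV : C^-1 \is a GRing.unit by rewrite unitrV.
have KC (T : set 'M[R]_2) : conjugate C^-1 (conjugate C T) = T.
  apply/seteqP; split=> k.
    by case=> _ [h Th <-] <-; rewrite invrK !mulrA mulVr // mul1r -mulrA mulVr // mulr1.
  move=> Tk; exists (C * k * C^-1); first by exists k.
  by rewrite invrK !mulrA mulVr // mul1r -mulrA mulVr // mulr1.
apply/seteqP; split; last exact: sub.
move=> g Hg; exists (C^-1 * g * C); last first.
  by rewrite !mulrA divrr // mul1r -mulrA divrr // mulr1.
have := sub _ (conjugate C S) UCV; rewrite KC => /(_ (C^-1 * g * C)); apply.
by exists g => //; rewrite invrK.
Qed.

Lemma big_ord4 (V : zmodType) (F : 'I_4 -> V) :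
  \sum_i F i = F (inord 0) + F (inord 1) + F (inord 2) + F (inord 3).
Proof.
rewrite !big_ord_recl big_ord0 addr0 !addrA.
by do 3?congr (_ + _); congr F; apply/val_inj; rewrite /= ?inordK.
Qed.

Definition ffun4 (x0 x1 x2 x3 : R) : {ffun 'I_4 -> R} :=
  [ffun i : 'I_4 => nth 0 [:: x0; x1; x2; x3] i].

Lemma ffun4E x0 x1 x2 x3 : [/\ ffun4 x0 x1 x2 x3 (inord 0) = x0,
  ffun4 x0 x1 x2 x3 (inord 1) = x1, ffun4 x0 x1 x2 x3 (inord 2) = x2 &
  ffun4 x0 x1 x2 x3 (inord 3) = x3].
Proof. by rewrite !ffunE !inordK. Qed.

Lemma ord4P (P : 'I_4 -> Prop) :
  P (inord 0) -> P (inord 1) -> P (inord 2) -> P (inord 3) -> forall i, P i.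
Proof.
move=> P0 P1 P2 P3 [[|[|[|[|i]]]] lt_i] //;
 [move: P0 | move: P1 | move: P2 | move: P3];
 by congr P; apply/val_inj; rewrite /= inordK.
Qed.

(** Conjugation by diag (b, 1) turns [typ1] into the full matrix algebra over K, on which sigma acts
    entrywise. *)
Lemma split_at_gam a b C (sigma : R -> R) (A : set 'M[R]_2) :
  b != 0 -> C \is a GRing.unit -> conjugate C A = typ1 (abfield a b) b ->
  real_place (abfield a b) sigma -> split_at (abfield a b) A sigma.
Proof.
set K := abfield a b => b0 UC AE Hs.
have HK : subfield K by exact: subfield_generated.
have Kbb : K (b ^+ 2) by exact: abfield_bb.
have AT g : A g -> typ1 K b (C * g * C^-1) by move=> Ag; rewrite -AE; exists g.
have CK g : C^-1 * (C * g * C^-1) * C = g.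
  by rewrite !mulrA mulVr // mul1r -mulrA mulVr // mulr1.
have TA g : typ1 K b (C * g * C^-1) -> A g.
  rewrite -AE => -[h Ah] /(congr1 (fun k => C^-1 * k * C)).
  by rewrite !CK => <-.
pose psi g := mx2 (sigma (g 0 0)) (sigma (b * g 0 1)) (sigma (g 1 0 / b)) (sigma (g 1 1)).
pose e (i : 'I_4) : 'M[R]_2 := C^-1 * nth 0 [:: mx2 1 0 0 0; mx2 0 b^-1 0 0; mx2 0 0 b 0; mx2 0 0 0 1] i * C.
have Kdiv x : K (b * x) -> K (x / b).
  move=> Kx; have -> : x / b = (b * x) / b ^+ 2 by field.
  exact: (subfieldV_div HK).
exists (fun g => psi (C * g * C^-1)), e; split.
- rewrite mulr1 divrr // onemx2 /psi !mx2E mulr0 mul0r (place1 Hs) (place0 HK Hs).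
  by [].
- move=> x y /AT + /AT; rewrite mulrDr mulrDl.
  move: (C * x * C^-1) (C * y * C^-1) => g h.
  elim/mx2_ind: g => p q r s; elim/mx2_ind: h => p' q' r' s'.
  rewrite /typ1 /psi !(addmx2, mx2E) => -[? ? /Kdiv ? ?] [? ? /Kdiv ? ?].
  by rewrite mulrDr mulrDl !(placeD Hs).
- move=> x y /AT + /AT; rewrite conjM //.
  move: (C * x * C^-1) (C * y * C^-1) => g h.
  elim/mx2_ind: g => p q r s; elim/mx2_ind: h => p' q' r' s'.
  rewrite /typ1 /psi !(mulmx2, mx2E) => -[Kp Kq /Kdiv Kr Ks] [Kp' Kq' /Kdiv Kr' Ks'].
  have -> : p * p' + q * r' = p * p' + (b * q) * (r' / b) by field.
  have -> : b * (p * q' + q * s') = p * (b * q') + (b * q) * s' by ring.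
  have -> : (r * p' + s * r') / b = (r / b) * p' + s * (r' / b) by field.
  have -> : r * q' + s * s' = (r / b) * (b * q') + s * s' by field.
  move: (b * q) (b * q') (r / b) (r' / b) Kq Kq' Kr Kr' => Q Q' Z Z' Kq Kq' Kr Kr'.
  by rewrite !(placeD Hs) ?(placeM Hs) //; apply: (subfieldM HK).
- move=> k x Kk /AT; rewrite -scalerAr -scalerAl.
  move: (C * x * C^-1) => g; elim/mx2_ind: g => p q r s.
  rewrite /typ1 /psi !(scalemx2, mx2E) => -[Kp Kq /Kdiv Kr Ks].
  rewrite mulrCA -[k * r / b]mulrA.
  by move: (b * q) (r / b) Kq Kr => Q Z Kq Kr; rewrite !(placeM Hs).
have eE c : \sum_i c i *: e i = C^-1 *
    mx2 (c (inord 0)) (c (inord 1) / b) (c (inord 2) * b) (c (inord 3)) * C.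
  have eZ k N : k *: (C^-1 * N * C) = C^-1 * (k *: N) * C.
    by rewrite -scalerAr -scalerAl.
  rewrite big_ord4 /e !inordK //= !eZ -!mulrDl -!mulrDr.
  by congr (_ * _ * _); rewrite !scalemx2 !addmx2; congr mx2; ring.
have CJ h : C * (C^-1 * h * C) * C^-1 = h.
  by rewrite !mulrA divrr // mul1r -mulrA divrr // mulr1.
have pe c : \sum_i c i *: (fun g => psi (C * g * C^-1)) (e i) =
    mx2 (c (inord 0)) (c (inord 1)) (c (inord 2)) (c (inord 3)).
  rewrite big_ord4 /e !inordK //= !CJ /psi !mx2E !mulr0 !mul0r divff //.
  rewrite !(place1 Hs) !(place0 HK Hs) !scalemx2 !addmx2; congr mx2; ring.
have [K0 K1] := (subfield0 HK, subfield1 HK).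
split; split.
- apply: ord4P; apply: TA; rewrite /e inordK //= CJ /typ1 !mx2E ?mulr0; split=> //.
    by rewrite divff.
- move=> u /AT Tu; have [Kp Kq /Kdiv Kr Ks] := Tu.
  set h := C * u * C^-1 in Kp Kq Kr Ks.
  exists (ffun4 (h 0 0) (b * h 0 1) (h 1 0 / b) (h 1 1)).
  have [f0 f1 f2 f3] := ffun4E (h 0 0) (b * h 0 1) (h 1 0 / b) (h 1 1).
  split; first split.
  + by apply: ord4P; rewrite ?f0 ?f1 ?f2 ?f3.
  + rewrite eE f0 f1 f2 f3 -{1}(CK u); congr (_ * _ * _).
    rewrite -/h [LHS]mx2_eta; congr mx2; field; done.
  + move=> c [_ uE]; have hE : h = mx2 (c (inord 0)) (c (inord 1) / b) (c (inord 2) * b) (c (inord 3)).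
      by rewrite /h uE eE CJ.
    apply/ffunP; apply: ord4P; rewrite ?f0 ?f1 ?f2 ?f3 hE !mx2E //; field; done.
- by [].
- move=> u _; exists (ffun4 (u 0 0) (u 0 1) (u 1 0) (u 1 1)).
  have [f0 f1 f2 f3] := ffun4E (u 0 0) (u 0 1) (u 1 0) (u 1 1).
  split; first split=> //.
    by rewrite pe f0 f1 f2 f3 -mx2_eta.
  move=> c [_ uE]; rewrite pe in uE.
  by apply/ffunP; apply: ord4P; rewrite ?f0 ?f1 ?f2 ?f3 uE !mx2E.
Qed.

End TraceField.

(** * Quadratic fields and their real places *)

Section PlacesAndDegree.
Variable R : realType.
Implicit Types (K F : set R) (x y : R) (a b : R).

Lemma card_eq_I2 (T : Type) (S : set T) : (S #= `I_2)%card ->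
  exists u v : T, u <> v /\ S = [set u; v].
Proof.
move=> /card_set_bijP [f [fS finj fsurj]].
have [x Sx fx] := fsurj 0%N isT; have [y Sy fy] := fsurj 1%N isT.
exists x, y; split; first by move=> E; move: fx; rewrite E fy.
apply/seteqP; split=> z; last by case=> ->.
move=> Sz; have := fS z Sz; rewrite /=; case fz : (f z) => [|[|n]] // _; [left | right].
  by apply: finj; rewrite ?fx ?fz //; apply: mem_set.
by apply: finj; rewrite ?fy ?fz //; apply: mem_set.
Qed.

Lemma card_set2_I2 (T : Type) (x y : T) : x <> y -> ([set x; y] #= `I_2)%card.
Proof.
move=> xy; apply/card_set_bijP; exists (fun z => if `[< z = x >] then 0%N else 1%N).
have fx : `[< x = x >] by apply/asboolP.
have fy : `[< y = x >] = false by apply/negbTE/asboolP => /esym.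
split.
- by move=> z _ /=; case: ifP.
- move=> u v /set_mem [] -> /set_mem [] ->; rewrite ?fx ?fy //.
- move=> [|[|n]] // _; [exists x | exists y]; rewrite /= ?fx ?fy //; [left | right] => //.
Qed.

Lemma places_eq K (s s' : R -> R) : real_place K s -> real_place K s' ->
  (forall x, K x -> s x = s' x) -> s = s'.
Proof.
move=> [_ _ _ s0] [_ _ _ s0'] E; apply/funext => x.
by have [/E //|Kx] := pselect (K x); rewrite s0 ?s0'.
Qed.

Definition rationals : set R := range (@ratr R).

Lemma rationals_subfield : subfield rationals.
Proof.
apply/subfieldP; split; first by exists 1; rewrite ?rmorph1.
  by move=> _ _ [p _ <-] [q _ <-]; exists (p - q); rewrite ?rmorphB.
by move=> _ _ [p _ <-] [q _ <-]; exists (p / q); rewrite ?fmorph_div.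
Qed.

Lemma rational_one_place K (s s' : R -> R) : subfield K -> K `<=` rationals ->
  real_place K s -> real_place K s' -> s = s'.
Proof.
move=> HK KQ Hs Hs'; apply: (places_eq Hs Hs') => x /KQ [q _ <-].
by rewrite (place_rat HK Hs) (place_rat HK Hs').
Qed.

Lemma big_ordI2 (F : 'I_2 -> R) : \sum_i F i = F 0 + F 1.
Proof. exact: big_ord2. Qed.

Definition ffun2 x0 x1 : {ffun 'I_2 -> R} := [ffun i : 'I_2 => if i == 0 then x0 else x1].

(** Write 1 in the basis: a basis element with nonzero coefficient can be exchanged for 1, and the
    other one is the generator. *)
Lemma degree2_generator F : subfield F -> degree_over_Q F 2 ->
  exists be, [/\ F be, ~ rationals be &
    forall x, F x -> exists u v : rat, x = ratr u + ratr v * be].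
Proof.
move=> HF [e [Fe He]].
have indep (p q : rat) : ratr p * (e 0 : R) + ratr q * (e 1 : R) = 0 -> p = 0 /\ q = 0.
  move=> E; have [c [_ cU]] := He 0 (subfield0 HF).
  have H1 : c = ffun2 (ratr p) (ratr q).
    apply: cU; split; first by move=> i; rewrite ffunE; case: ifP => _; [exists p | exists q].
    by rewrite -[LHS]E big_ordI2 !ffunE.
  have H2 : c = ffun2 0 0.
    apply: cU; split; first by move=> i; rewrite ffunE; case: ifP => _; exists 0; rewrite ?rmorph0.
    by rewrite big_ordI2 !ffunE /= !scale0r addr0.
  have /ffunP E2 := etrans (esym H1) H2.
  by split; [move: (E2 0) | move: (E2 1)]; rewrite !ffunE /= => /eqP;
    rewrite fmorph_eq0 => /eqP.
have span x : F x -> exists p q : rat, x = ratr p * (e 0 : R) + ratr q * (e 1 : R).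
  move=> Fx; have [c [[cQ ->] _]] := He x Fx.
  have [p _ cp] := cQ 0; have [q _ cq] := cQ 1.
  by exists p, q; rewrite big_ordI2 cp cq.
have [p0 [p1 E1]] := span 1 (subfield1 HF).
have r10 : (1 : rat) <> 0 by apply/eqP; rewrite oner_eq0.
have fin (be ga : R) (q0 q1 : rat) : F be -> 1 = ratr q0 * be + ratr q1 * ga -> q1 != 0 ->
    (forall x, F x -> exists p q : rat, x = ratr p * be + ratr q * ga) -> ~ rationals be ->
  exists be0, [/\ F be0, ~ rationals be0 &
    forall x, F x -> exists u v : rat, x = ratr u + ratr v * be0].
  move=> Fbe E q10 sp nq; exists be; split=> // x /sp [p [q ->]].
  have q10' : ratr q1 != 0 :> R by rewrite fmorph_eq0.
  have gaE : ga = (1 - ratr q0 * be) / ratr q1 by rewrite E; field.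
  exists (q / q1), (p - q * q0 / q1).
  rewrite gaE !(rmorphB, rmorphM, fmorphV) /=; field; done.
have [p10|p10] := eqVneq p1 0; last first.
  apply: (fin (e 0) (e 1) p0 p1) => //; try exact: Fe.
  move=> [q _ qE]; have [] := indep (q * p0 - 1) (q * p1).
    rewrite !(rmorphB, rmorphM, rmorph1) /=.
    have -> : (ratr q * ratr p0 - 1) * e 0 + ratr q * ratr p1 * e 1 =
        ratr q * (ratr p0 * e 0 + ratr p1 * e 1) - e 0 :> R by ring.
    by rewrite -E1 mulr1 qE subrr.
  move=> + /eqP; rewrite mulf_eq0 (negPf p10) orbF => + /eqP q0.
  by rewrite q0 mul0r sub0r => /eqP; rewrite oppr_eq0 oner_eq0.
have p00 : p0 != 0.
  by apply/eqP => p00; move: E1; rewrite p10 p00 rmorph0 !mul0r addr0 => /eqP; rewrite oner_eq0.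
apply: (fin (e 1) (e 0) p1 p0) => //; try exact: Fe.
- by rewrite addrC.
- by move=> x /span [p [q ->]]; exists q, p; rewrite addrC.
- move=> [q _ qE]; have [] := indep (q * p0) (q * p1 - 1).
    rewrite !(rmorphB, rmorphM, rmorph1) /=.
    have -> : ratr q * ratr p0 * e 0 + (ratr q * ratr p1 - 1) * e 1 =
        ratr q * (ratr p0 * e 0 + ratr p1 * e 1) - e 1 :> R by ring.
    by rewrite -E1 mulr1 qE subrr.
  move=> /eqP; rewrite mulf_eq0 (negPf p00) orbF => /eqP q0.
  by rewrite q0 mul0r sub0r => /eqP; rewrite oppr_eq0 oner_eq0.
Qed.

Lemma degree2_not_rational F : subfield F -> F `<=` rationals -> ~ degree_over_Q F 2.
Proof. by move=> HF FQ /(degree2_generator HF) [be [/FQ]]. Qed.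

(** A place is determined by the image of the generator, which is a root of a fixed quadratic
    equation over the rationals. *)
Lemma degree2_places F s1 s2 s3 : subfield F -> degree_over_Q F 2 ->
  real_place F s1 -> real_place F s2 -> real_place F s3 ->
  [\/ s1 = s2, s1 = s3 | s2 = s3].
Proof.
move=> HF /(degree2_generator HF) [be [Fbe nq sp]] P1 P2 P3.
have [u [v E]] := sp _ (subfieldM HF Fbe Fbe).
have Fr q : F (ratr q) by exact: subfield_rat.
have sE s (x y : rat) : real_place F s -> s (ratr x + ratr y * be) = ratr x + ratr y * s be.
  move=> Ps; rewrite (placeD Ps (Fr x) (subfieldM HF (Fr y) Fbe)).
  by rewrite (placeM Ps (Fr y) Fbe) !(place_rat HF Ps).
have root s : real_place F s -> s be * s be = ratr u + ratr v * s be.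
  by move=> Ps; rewrite -(placeM Ps) // E sE.
have eqs s s' : real_place F s -> real_place F s' -> s be = s' be -> s = s'.
  move=> Ps Ps' E'; apply: (places_eq Ps Ps') => x /sp [x1 [x2 ->]].
  by rewrite !sE // E'.
have [E1|E1] := eqVneq (s1 be) (s2 be); first by constructor 1; apply: eqs.
have [E2|E2] := eqVneq (s1 be) (s3 be); first by constructor 2; apply: eqs.
constructor 3; apply: eqs => //.
have := root _ P1; have := root _ P2; have := root _ P3 => R3 R2 R1.
have sum s : s be * s be = ratr u + ratr v * s be -> s1 be != s be -> s1 be + s be = ratr v.
  move=> Rs ne; have ne' : s1 be - s be != 0 by rewrite subr_eq0.
  apply: (mulIf ne').
  have -> : (s1 be + s be) * (s1 be - s be) = s1 be * s1 be - s be * s be by ring.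
  by rewrite R1 Rs; ring.
by apply: (@addrI _ (s1 be)); rewrite (sum _ R2 E1) (sum _ R3 E2).
Qed.

Lemma sqrt_irrational (d : nat) : (forall k : nat, (k * k != d)%N) ->
  ~ rationals (Num.sqrt d%:R).
Proof.
move=> nsq [q _ qE].
have q2 : q ^+ 2 = d%:R.
  apply: (fmorph_inj (ratr : {rmorphism rat -> R})).
  by rewrite /= rmorphXn /= qE sqr_sqrtr ?ler0n // rmorph_nat.
have Eint : numq q ^+ 2 = d%:Z * denq q ^+ 2.
  have nq : (numq q)%:~R = q * (denq q)%:~R :> rat.
    by rewrite -{2}[q]divq_num_den mulfVK // intr_eq0 denq_neq0.
  apply: (intr_inj (R := rat)); rewrite !expr2 !intrM nq.
  by rewrite -[(d%:Z)%:~R]/(d%:R : rat) -q2; ring.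
have En : (`|numq q| * `|numq q| = d * (`|denq q| * `|denq q|))%N.
  by move: (congr1 absz Eint); rewrite abszM !abszX !mulnn absz_nat.
have den1 : `|denq q|%N = 1%N.
  have cop := coprime_num_den q.
  have : (`|denq q| %| `|numq q| * `|numq q|)%N by rewrite En !dvdn_mull.
  rewrite Gauss_dvdr; last by rewrite coprime_sym.
  move: cop; rewrite coprime_sym /coprime => /eqP cop dv.
  by apply/eqP; rewrite -dvdn1 -cop dvdn_gcd dvdnn dv.
by have := nsq `|numq q|%N; rewrite En den1 !muln1 eqxx.
Qed.

Section QSqrt.
Variable d : nat.
Hypothesis nsq : forall k : nat, (k * k != d)%N.
Local Notation s := (Num.sqrt d%:R : R).

Lemma sqrt_sq : s * s = d%:R.
Proof. by rewrite -expr2 sqr_sqrtr ?ler0n. Qed.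

Lemma qs_zero (u v : rat) : ratr u + ratr v * s = 0 -> u = 0 /\ v = 0.
Proof.
move=> E; have [v0|v0] := eqVneq v 0.
  by move: E; rewrite v0 rmorph0 mul0r addr0 => /eqP; rewrite fmorph_eq0 => /eqP.
case: (sqrt_irrational nsq); exists (- u / v) => //.
have v0' : ratr v != 0 :> R by rewrite fmorph_eq0.
rewrite rmorphM fmorphV rmorphN /=; apply: (mulIf v0'); rewrite mulfVK //.
by move/eqP: E; rewrite addrC addr_eq0 mulrC => /eqP ->.
Qed.

Lemma qs_inj (u v u' v' : rat) : ratr u + ratr v * s = ratr u' + ratr v' * s ->
  u = u' /\ v = v'.
Proof.
move=> E; have [] := @qs_zero (u - u') (v - v').
  rewrite !rmorphB /=; have -> : ratr u - ratr u' + (ratr v - ratr v') * s =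
    (ratr u + ratr v * s) - (ratr u' + ratr v' * s) by ring.
  by rewrite E subrr.
by move=> /eqP + /eqP; rewrite !subr_eq0 => /eqP -> /eqP ->.
Qed.

Lemma Q_sqrtP x : @Q_sqrt R d x <-> exists u v : rat, x = ratr u + ratr v * s.
Proof.
have HQ : subfield (@Q_sqrt R d) by exact: subfield_generated.
split; last first.
  move=> [u [v ->]]; apply: (subfieldD HQ); first exact: subfield_rat.
  apply: (subfieldM HQ); first exact: subfield_rat.
  by apply: generated_field_in.
pose S := [set x : R | exists u v : rat, x = ratr u + ratr v * s].
move=> Hx; suff : S x by [].
apply: Hx; split; last by move=> _ ->; exists 0, 1; rewrite rmorph0 rmorph1; ring.
apply/subfieldP; split.
- by exists 1, 0; rewrite rmorph0 rmorph1; ring.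
- move=> _ _ [u [v ->]] [u' [v' ->]]; exists (u - u'), (v - v').
  by rewrite !rmorphB /=; ring.
- move=> _ _ [u [v ->]] [u' [v' ->]].
  have [z|z] := eqVneq (ratr u' + ratr v' * s) 0.
    by exists 0, 0; rewrite z invr0 mulr0 rmorph0; ring.
  have n0 : ratr u' - ratr v' * s != 0.
    apply/eqP => E; have [] := @qs_zero u' (- v').
      by rewrite rmorphN mulNr.
    move=> u'0 /eqP; rewrite oppr_eq0 => /eqP v'0.
    by move: z; rewrite u'0 v'0 rmorph0 mul0r addr0 eqxx.
  have [n nE] : exists n : rat, ratr n = (ratr u' + ratr v' * s) * (ratr u' - ratr v' * s).
    exists (u' ^+ 2 - d%:R * v' ^+ 2).
    rewrite !(rmorphB, rmorphM, rmorphXn, rmorph_nat) /=.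
    by have sq := sqrt_sq; set t := Num.sqrt _ in sq *; rewrite -sq; ring.
  exists ((u * u' - d%:R * (v * v')) / n), ((v * u' - u * v') / n).
  rewrite !(rmorphM, fmorphV, rmorphB, rmorph_nat) /= nE.
  have sq := sqrt_sq; set t := Num.sqrt _ in sq z n0 *; rewrite -sq.
  by field; rewrite z n0.
Qed.

Lemma Q_sqrt_degree : degree_over_Q (@Q_sqrt R d) 2.
Proof.
exists (fun i => if i == 0 then 1 else s); split.
  move=> i; apply/Q_sqrtP; case: ifP => _.
    by exists 1, 0; rewrite rmorph0 rmorph1; ring.
  by exists 0, 1; rewrite rmorph0 rmorph1; ring.
move=> x /Q_sqrtP [u [v ->]]; exists (ffun2 (ratr u) (ratr v)); split; first split.
- by move=> i; rewrite ffunE; case: ifP => _; [exists u | exists v].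
- by rewrite big_ordI2 !ffunE /=; congr (_ + _); rewrite /GRing.scale /= mulr1.
- move=> c [cQ]; rewrite big_ordI2 /=; have [p _ cp] := cQ 0; have [q _ cq] := cQ 1.
  have -> : c 0 *: (1 : R^o) + c 1 *: (s : R^o) = ratr p + ratr q * s.
    by rewrite -cp -cq; congr (_ + _); rewrite /GRing.scale /= mulr1.
  move=> /qs_inj [-> ->]; apply/ffunP => i; rewrite ffunE.
  by case: (ord2P i) => ->; rewrite /= ?cp ?cq.
Qed.

Lemma Q_sqrt_two_places :
  ([set sigma | real_place (@Q_sqrt R d) sigma] #= `I_2)%card.
Proof.
have HQ : subfield (@Q_sqrt R d) by exact: subfield_generated.
(* For e = +-1 this sends sqrt d to e sqrt d; outside the field the default value of [xget] is the
   extension by zero. *)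
pose g (e : R) x := xget 0 [set y | exists u v : rat,
   x = ratr u + ratr v * s /\ y = ratr u + ratr v * (e * s)].
have gE e (u v : rat) : g e (ratr u + ratr v * s) = ratr u + ratr v * (e * s).
  rewrite /g; case: xgetP => [y _ [u' [v' [/qs_inj [<- <-] ->]]] //|].
  by move=> /(_ (ratr u + ratr v * (e * s))); case; exists u, v.
have gP e : e * e = 1 -> real_place (@Q_sqrt R d) (g e).
  move=> e1; split.
  - have -> : 1 = ratr 1 + ratr 0 * s by rewrite rmorph1 rmorph0; ring.
    by rewrite gE rmorph0; ring.
  - move=> x y /Q_sqrtP [u [v ->]] /Q_sqrtP [u' [v' ->]].
    have -> : ratr u + ratr v * s + (ratr u' + ratr v' * s) =
      ratr (u + u') + ratr (v + v') * s by rewrite !rmorphD /=; ring.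
    by rewrite !gE !rmorphD /=; ring.
  - move=> x y /Q_sqrtP [u [v ->]] /Q_sqrtP [u' [v' ->]].
    have -> : (ratr u + ratr v * s) * (ratr u' + ratr v' * s) =
      ratr (u * u' + d%:R * (v * v')) + ratr (u * v' + v * u') * s.
      rewrite !(rmorphD, rmorphM, rmorph_nat) /=.
      by have sq := sqrt_sq; set t := Num.sqrt _ in sq *; rewrite -sq; ring.
    rewrite !gE !(rmorphD, rmorphM, rmorph_nat) /=.
    have sq := sqrt_sq; set t := Num.sqrt _ in sq *.
    have -> : d%:R = e * e * (t * t) by rewrite e1 mul1r sq.
    by ring.
  - move=> x nx; rewrite /g; case: xgetP => // y _ [u [v [xE _]]].
    by case: nx; apply/Q_sqrtP; exists u, v.
have s_in : @Q_sqrt R d s by apply: generated_field_in.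
have s0 : s != 0.
  apply/eqP => E; have [] := @qs_zero 0 1; first by rewrite rmorph0 rmorph1 E; ring.
  by move=> _ /eqP; rewrite oner_eq0.
have sE : s = ratr 0 + ratr 1 * s by rewrite rmorph0 rmorph1; ring.
have -> : [set sigma | real_place (@Q_sqrt R d) sigma] = [set g 1; g (- 1)].
  apply/seteqP; split=> f; last by case=> ->; apply: gP; ring.
  move=> /= Pf; have fs : f s * f s = s * s.
    by rewrite -(placeM Pf) // sqrt_sq (place_nat HQ Pf).
  have fE e : f s = e * s -> e * e = 1 -> f = g e.
    move=> E e1; apply: (places_eq Pf (gP e e1)) => x /Q_sqrtP [u [v ->]].
    have Fr q : @Q_sqrt R d (ratr q) by exact: subfield_rat.
    rewrite gE (placeD Pf (Fr u) (subfieldM HQ (Fr v) s_in)).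
    by rewrite (placeM Pf (Fr v) s_in) !(place_rat HQ Pf) E.
  move/eqP: fs; rewrite -!expr2 eqf_sqr => /orP[] /eqP E; [left | right]; apply: fE.
  - by rewrite mul1r.
  - by rewrite mul1r.
  - by rewrite mulN1r.
  - by ring.
apply: card_set2_I2 => E.
have : g 1 s = g (- 1) s by rewrite E.
rewrite sE !gE rmorph0 rmorph1 => /eqP.
rewrite -subr_eq0 (_ : _ - _ = 2 * s); last by ring.
by rewrite mulf_eq0 (negPf s0) orbF pnatr_eq0.
Qed.

End QSqrt.

(** By [split_at_gam] the algebra splits at every real place, so that the arithmetic dimension
    counts all real places. *)
Lemma arith_dim_gam a b C (G : set 'M[R]_2) d : b != 0 -> a + b != 0 ->
  detpm1 C -> (forall g, G g -> detpm1 g) -> conjugate C G = gam a b ->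
  invariant_trace_field G = abfield a b /\
  (arithmetic_dimension G d <->
    ([set sigma | real_place (abfield a b) sigma] #= `I_d)%card).
Proof.
move=> b0 t0 dC dG CG; have UC := detpm1_unit dC.
have FE : invariant_trace_field G = abfield a b.
  by rewrite -(invariant_trace_field_conj UC dG) CG gam_trace_field.
split=> //; rewrite /arithmetic_dimension FE.
set A := generated_algebra _ _.
have AE : conjugate C A = typ1 (abfield a b) b.
  rewrite -generated_algebra_conj // squares_conj // CG.
  exact: gam_algebra.
suff -> : [set sigma | real_place (abfield a b) sigma /\ split_at (abfield a b) A sigma] =
  [set sigma | real_place (abfield a b) sigma] by [].
apply/seteqP; split=> f; first by case.
by move=> Pf; split=> //; exact: (split_at_gam b0 UC AE Pf).
Qed.

End PlacesAndDegree.

(** * Real places obtained from cyclotomic conjugation *)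

Section CyclotomicPlaces.
Variable R : realType.
Implicit Types (K : set R) (x y : R).

(** Two consecutive Dickson polynomials, defined by D_n (2 cos th) = 2 cos (n th). *)
Fixpoint dickson_pair n : {poly rat} * {poly rat} :=
  if n is n'.+1 then let: (p, q) := dickson_pair n' in (q, 'X * q - p)
  else (2%:P, 'X).
Definition dickson n := (dickson_pair n).1.

Lemma dicksonSS n : dickson n.+2 = 'X * dickson n.+1 - dickson n.
Proof. by rewrite /dickson /=; case: (dickson_pair n). Qed.

Lemma dickson_cos n (th : R) : evq (dickson n) (2 * cos th) = 2 * cos (n%:R * th).
Proof.
elim/ltn_ind: n => -[|[|n]] IH.
- by rewrite evqC mul0r cos0 mulr1 rmorph_nat.
- by rewrite evqX mul1r.
- rewrite dicksonSS evqB evqM evqX !IH // -!natr1.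
  have -> : (n%:R + 1 + 1) * th = (n%:R + 1) * th + th by ring.
  have -> : n%:R * th = (n%:R + 1) * th - th by ring.
  by rewrite cosB cosD; ring.
Qed.

Section Gal.
Variables N k : nat.
Hypotheses (N0 : (0 < N)%N) (ckN : coprime k N).

(** The graph of the conjugation of Q (2 cos (2 pi / N)) that sends 2 cos (2 pi / N) to 2 cos (2 pi
    k / N). A relation needs no choice of the fraction P / Q; by [gal_fun] it is single-valued. *)
Definition gal x y := exists P Q : {poly rat}, [/\ evq Q (tcos R N 1) != 0,
  x = evq P (tcos R N 1) / evq Q (tcos R N 1) & y = evq P (tcos R N k) / evq Q (tcos R N k)].

Lemma gal_neq0 Q : evq Q (tcos R N 1) != 0 -> evq Q (tcos R N k) != 0.
Proof.
by apply: contra_neq; apply: evq_conj => //; rewrite coprime1n.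
Qed.

Lemma gal_fun x y y' : gal x y -> gal x y' -> y = y'.
Proof.
move=> [P [Q [Q0 -> ->]]] [P' [Q' [Q0' E ->]]].
have := gal_neq0 Q0; have := gal_neq0 Q0' => Qk0' Qk0.
have E1 : evq (P * Q' - P' * Q) (tcos R N 1) = 0.
  rewrite evqB !evqM; apply/eqP; rewrite subr_eq0; apply/eqP.
  by move: E => /(congr1 (fun z => z * evq Q (tcos R N 1) * evq Q' (tcos R N 1))) E;
     rewrite mulfVK // mulrAC mulfVK // in E.
have := evq_conj N0 (coprime1n _) ckN E1.
rewrite evqB !evqM => /eqP; rewrite subr_eq0 => /eqP E2.
by apply: (mulIf Qk0); apply: (mulIf Qk0'); rewrite mulfVK // E2 mulrAC mulfVK.
Qed.

Lemma gal1 : gal 1 1.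
Proof. by exists 1, 1; rewrite !evq1 divr1 oner_neq0. Qed.

Lemma galB x y x' y' : gal x y -> gal x' y' -> gal (x - x') (y - y').
Proof.
move=> [P [Q [Q0 -> ->]]] [P' [Q' [Q0' -> ->]]].
have := gal_neq0 Q0; have := gal_neq0 Q0' => Qk0' Qk0.
exists (P * Q' - P' * Q), (Q * Q'); rewrite !evqB !evqM mulf_neq0 //.
by split=> //; field; rewrite ?Q0 ?Q0' ?Qk0 ?Qk0'.
Qed.

Lemma galM x y x' y' : gal x y -> gal x' y' -> gal (x * x') (y * y').
Proof.
move=> [P [Q [Q0 -> ->]]] [P' [Q' [Q0' -> ->]]].
have := gal_neq0 Q0; have := gal_neq0 Q0' => Qk0' Qk0.
exists (P * P'), (Q * Q'); rewrite !evqM mulf_neq0 //.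
by split=> //; field; rewrite ?Q0 ?Q0' ?Qk0 ?Qk0'.
Qed.

Lemma galV x y : gal x y -> gal x^-1 y^-1.
Proof.
move=> [P [Q [Q0 -> ->]]]; have Qk0 := gal_neq0 Q0.
have [P0|P0] := eqVneq (evq P (tcos R N 1)) 0.
  have Pk0 := evq_conj N0 (coprime1n _) ckN P0.
  exists 0, 1; rewrite !evq1 !evq0 P0 Pk0 !mul0r invr0 oner_neq0.
  by split.
by exists Q, P; rewrite P0 !invf_div.
Qed.

Lemma gal_tcos j : gal (tcos R N j) (tcos R N (j * k)).
Proof.
exists (dickson j), 1; rewrite !evq1 !divr1 oner_neq0 /tcos !dickson_cos.
by split=> //; congr (2 * cos _); rewrite ?natrM; ring.
Qed.

Lemma gal_dom_subfield : subfield [set x | exists y, gal x y].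
Proof.
apply/subfieldP; split; first by exists 1; exact: gal1.
  by move=> x x' [y Hx] [y' Hx']; exists (y - y'); exact: galB.
by move=> x x' [y Hx] [y' Hx']; exists (y / y'); apply: galM => //; exact: galV.
Qed.

Lemma gal_place K : subfield K -> (forall x, K x -> exists y, gal x y) ->
  exists sigma, real_place K sigma /\ forall x y, K x -> gal x y -> sigma x = y.
Proof.
move=> HK dom; pose sigma x := xget 0 [set y | K x /\ gal x y].
have sE x y : K x -> gal x y -> sigma x = y.
  move=> Kx Hxy; rewrite /sigma; case: xgetP => [z _ [_ Hz]|].
    exact: gal_fun Hz Hxy.
  by move=> /(_ y) H; case: H.
exists sigma; split=> //; split.
- by apply: sE; [exact: subfield1 | exact: gal1].
- move=> x y Kx Ky; have [x' Hx] := dom _ Kx; have [y' Hy] := dom _ Ky.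
  rewrite (sE _ _ Kx Hx) (sE _ _ Ky Hy); apply: sE; first exact: subfieldD.
  have H0 := galB gal1 gal1; rewrite subrr in H0.
  by have := galB Hx (galB H0 Hy); rewrite !sub0r !opprK.
- move=> x y Kx Ky; have [x' Hx] := dom _ Kx; have [y' Hy] := dom _ Ky.
  rewrite (sE _ _ Kx Hx) (sE _ _ Ky Hy); apply: sE; first exact: subfieldM.
  exact: galM.
- move=> x nK; rewrite /sigma; case: xgetP => // y _ [Kx].
  by case: nK.
Qed.

End Gal.

Definition cfk k (o : option nat) : R := 2 * cos (k%:R * angle_oo R o).
Definition odn (o : option nat) := odflt 1%N o.

Lemma cfk1 o : cfk 1 o = cf R o.
Proof. by rewrite /cfk mul1r. Qed.

Lemma gal_cf N k o j : (0 < N)%N -> coprime k N -> N = (2 * odn o * j)%N ->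
  (0 < odn o)%N -> (0 < j)%N -> gal N k (cf R o) (cfk k o).
Proof.
move=> N0 ck NE o0 j0; case: o NE o0 => [l|] /= NE o0; last first.
  have -> : cf R None = 1 - (0 - 1) by rewrite cf_oo; ring.
  have -> : cfk k None = 1 - (0 - 1) by rewrite /cfk /= mulr0 cos0; ring.
  have H1 := gal1 N k; have H0 := galB N0 ck H1 H1; rewrite subrr in H0.
  by apply: galB => //; apply: galB.
have l0 : l%:R != 0 :> R by rewrite pnatr_eq0 -lt0n.
have j0' : j%:R != 0 :> R by rewrite pnatr_eq0 -lt0n.
have E i : 2 * pi * (j * i)%N%:R / N%:R = i%:R * (pi / l%:R) :> R.
  by rewrite NE !natrM; field; rewrite l0 j0'.
have := gal_tcos N k j; rewrite /tcos E.
by rewrite -{1}[j]muln1 E mul1r.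
Qed.

(** N = 2 l m makes pi / l and pi / m multiples of 2 pi / N; oo counts as 1, because its value 2 is
    rational. *)
Lemma gam_place (l m : option nat) k : (0 < odn l)%N -> (0 < odn m)%N ->
  coprime k (2 * odn l * odn m) ->
  exists s, [/\ real_place (abfield (cf R l) (cf R m)) s,
    s (cf R l ^+ 2) = cfk k l ^+ 2, s (cf R m ^+ 2) = cfk k m ^+ 2 &
    s (cf R l * cf R m) = cfk k l * cfk k m].
Proof.
move=> l0 m0 ck; set N := (2 * odn l * odn m)%N in ck.
have N0 : (0 < N)%N by rewrite /N !muln_gt0 l0.
have gl : gal N k (cf R l) (cfk k l) by exact: (gal_cf N0 ck (erefl _)).
have gm : gal N k (cf R m) (cfk k m).
  by apply: (gal_cf N0 ck _ m0 l0); rewrite /N mulnAC.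
have HK : subfield (abfield (cf R l) (cf R m)) by exact: subfield_generated.
have [|s [Ps sE]] := gal_place N0 ck HK.
  apply: generated_field_min; first exact: gal_dom_subfield.
  by move=> x [] ->; [exists (cfk k l ^+ 2) | exists (cfk k m ^+ 2) |
    exists (cfk k l * cfk k m)]; rewrite ?expr2; apply: galM.
exists s; split=> //; apply: sE; rewrite ?expr2; try exact: galM.
- exact: abfield_aa.
- exact: abfield_bb.
- exact: abfield_ab.
Qed.

Lemma cos_period n (x : R) : cos (x + 2 * pi * n%:R) = cos x.
Proof.
elim: n => [|n IH]; first by rewrite mulr0 addr0.
have -> : x + 2 * pi * n.+1%:R = x + 2 * pi * n%:R + pi + pi :> R.
  by rewrite -natr1; ring.
by rewrite !cosDpi opprK.
Qed.

Lemma cos_double (x : R) : cos (2 * x) = 2 * cos x ^+ 2 - 1.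
Proof.
have -> : 2 * x = x + x by ring.
by rewrite cosD -!expr2 sin2cos2; ring.
Qed.

Lemma cfk_sq k l : cfk k (Some l) ^+ 2 = 2 + 2 * cos (2 * pi * k%:R / l%:R).
Proof.
have -> : 2 * pi * k%:R / l%:R = 2 * (k%:R * (pi / l%:R)) :> R by ring.
by rewrite cos_double /cfk /=; ring.
Qed.

Lemma cfk_sq_mod k l : (0 < l)%N -> cfk (k %% l) (Some l) ^+ 2 = cfk k (Some l) ^+ 2.
Proof.
move=> l0; rewrite !cfk_sq; have l0' : l%:R != 0 :> R by rewrite pnatr_eq0 -lt0n.
rewrite {2}(divn_eq k l).
have -> : 2 * pi * (k %/ l * l + k %% l)%N%:R / l%:R =
   2 * pi * (k %% l)%N%:R / l%:R + 2 * pi * (k %/ l)%N%:R :> R.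
  by rewrite natrD natrM; field.
by rewrite cos_period.
Qed.

(** cos is injective on [0, pi], and 2 pi r / l lies there when 2 r <= l. *)
Lemma cfk_sq_inj r r' l : (0 < l)%N -> (2 * r <= l)%N -> (2 * r' <= l)%N ->
  cfk r (Some l) ^+ 2 = cfk r' (Some l) ^+ 2 -> r = r'.
Proof.
move=> l0 rl rl'; have l0' : 0 < l%:R :> R by rewrite ltr0n.
have pi0 := pi_gt0 R.
rewrite !cfk_sq => /addrI /(mulfI _) E; have {}E := E (lt0r_neq0 (ltr0Sn _ 1)).
have rng i : (2 * i <= l)%N -> (2 * pi * i%:R / l%:R : R) \in `[0, pi]%R.
  move=> il; have l0'' : l%:R != 0 :> R by rewrite gt_eqF.
  have -> : 2 * pi * i%:R / l%:R = (2 * i)%N%:R / l%:R * pi :> R.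
    by rewrite natrM; field.
  have h0 : 0 <= (2 * i)%N%:R / l%:R :> R by rewrite divr_ge0 ?ler0n // ltW.
  have h1 : (2 * i)%N%:R / l%:R <= 1 :> R by rewrite ler_pdivrMr // mul1r ler_nat.
  by rewrite in_itv /= mulr_ge0 ?(ltW pi0) //= ler_piMl // ltW.
have := cos_inj (rng _ rl) (rng _ rl') E.
move=> /(congr1 (fun z => z * l%:R / (2 * pi))).
have pi0' : (pi : R) != 0 by rewrite gt_eqF.
have K i : 2 * pi * i%:R / l%:R * l%:R / (2 * pi) = i%:R :> R.
  by move: (pi : R) pi0' => P P0; field; rewrite P0 gt_eqF.
by rewrite !K => /eqP; rewrite eqr_nat => /eqP.
Qed.

Lemma cfk_sq_opp r l : (r <= l)%N -> (0 < l)%N ->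
  cfk (l - r) (Some l) ^+ 2 = cfk r (Some l) ^+ 2.
Proof.
move=> rl l0; have l0' : l%:R != 0 :> R by rewrite pnatr_eq0 -lt0n.
rewrite !cfk_sq natrB //.
have -> : 2 * pi * (l%:R - r%:R) / l%:R = - (2 * pi * r%:R / l%:R) + 2 * pi * 1%:R :> R.
  by field.
by rewrite cos_period cosN.
Qed.

(* The k-th Galois conjugation moves 4 cos^2 (pi / l) unless k = +-1 mod l. *)
Definition moves (o : option nat) k :=
  if o is Some l then ((k %% l)%N != 1%N) && ((k %% l)%N != l.-1) else false.

Lemma movesP o k : le_oo (Some 2%N) o -> moves o k -> cfk k o ^+ 2 != cf R o ^+ 2.
Proof.
case: o => [l|] //= l2 /andP[k1 kl]; have l0 : (0 < l)%N by exact: ltnW.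
rewrite -cfk1 -(cfk_sq_mod k l0); apply/eqP.
have rl : (k %% l < l)%N by rewrite ltn_pmod.
have [r2|r2] := leqP (2 * (k %% l)) l.
  by move/(cfk_sq_inj l0 r2 (l2 : (2 * 1 <= l)%N))/eqP; rewrite (negPf k1).
rewrite -cfk_sq_opp ?(ltnW rl) // => /(cfk_sq_inj l0) E.
have r2' : (2 * (l - k %% l) <= l)%N.
  by rewrite mulnBr leq_subLR mul2n -addnn leq_add2r ltnW.
have {}E := E r2' (l2 : (2 * 1 <= l)%N); move/eqP: kl; apply.
by rewrite -(subKn (ltnW rl)) E subn1.
Qed.

(** cos (k pi / l) depends on k mod 2 l only; the residues listed are those for which it is - cos
    (pi / l), when s holds, or cos (pi / l). *)
Definition sgn_of (o : option nat) k (s : bool) :=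
  if o is Some l then
    let r := (k %% (2 * l))%N in
    if s then (r == l.-1) || (r == l.+1) else (r == 1%N) || (r == (2 * l).-1)
  else ~~ s.

Lemma sgn_ofP o k s : le_oo (Some 2%N) o -> sgn_of o k s ->
  cfk k o = (-1) ^+ s * cf R o.
Proof.
case: o => [l|] l2; last first.
  by case: s => // _; rewrite expr0 mul1r /cfk /cf /= mulr0.
have l0 : (0 < l)%N by exact: ltnW.
have l0' : l%:R != 0 :> R by rewrite pnatr_eq0 -lt0n.
have kE : cfk k (Some l) = cfk (k %% (2 * l)) (Some l).
  rewrite /cfk /= {1}(divn_eq k (2 * l)).
  have -> : (k %/ (2 * l) * (2 * l) + k %% (2 * l))%N%:R * (pi / l%:R) =
    (k %% (2 * l))%N%:R * (pi / l%:R) + 2 * pi * (k %/ (2 * l))%N%:R :> R.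
    by rewrite natrD !natrM; field.
  by rewrite cos_period.
have lpi : l%:R * (pi / l%:R) = pi :> R by rewrite mulrC mulfVK.
rewrite /sgn_of kE /cfk /cf /=; case: s => /orP[] /eqP ->.
- rewrite -subn1 natrB // mulrBl lpi mul1r cosB cospi sinpi; ring.
- rewrite -(@natr1 _ l) (mulrDl l%:R 1) lpi mul1r cosD cospi sinpi; ring.
- by rewrite expr0 !mul1r.
- rewrite -subn1 natrB ?muln_gt0 // natrM mulrBl -mulrA lpi mul1r.
  have -> : 2 * pi - pi / l%:R = - (pi / l%:R) + 2 * pi * 1%:R :> R by ring.
  by rewrite cos_period cosN; ring.
Qed.

(** The excluded i are those with phi (i) <= 4. For the others 1, k2 and k3 are three units that
    differ even up to sign, which yields three conjugates of 4 cos^2 (pi / i). They are explicit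
    according to i mod 8. *)
Lemma three_units i : (1 < i)%N -> i \notin [:: 2; 3; 4; 5; 6; 8; 10; 12]%N ->
  exists k2 k3, [/\ (1 < k2 < k3)%N, (2 * k3 < i)%N, coprime k2 i & coprime k3 i].
Proof.
have cop4 n : odd n -> coprime n 4.
  by move=> on; rewrite -[4%N]/(2 * 2)%N coprimeMr coprimen2 on.
have copD n j : coprime n (n + j) = coprime n j by rewrite /coprime gcdnDl.
have lift n q c : (i = c * q)%N -> coprime n c -> coprime n q -> coprime n i.
  by move=> -> Hc Hq; rewrite coprimeMr Hc.
rewrite !inE => i1 ni.
have [oi|ei] := boolP (odd i).
  have [i7|i7] := eqVneq i 7%N; first by exists 2%N, 3%N; rewrite i7.
  exists 2%N, 4%N; split; [by []|lia|by rewrite coprime2n|].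
  by rewrite coprime_sym cop4.
have [q iq] : exists q, i = (2 * q)%N by exists (i./2); lia.
have [oq|eq] := boolP (odd q).
  have [n qn] : exists n, q = (n + 4)%N by exists (q - 4)%N; lia.
  have on : odd n by lia.
  exists n, (n + 2)%N; split; [lia|lia| |].
    by apply: (lift _ _ _ iq); rewrite ?coprimen2 // qn copD cop4.
  apply: (lift _ _ _ iq); first by rewrite coprimen2; lia.
  have -> : q = (n + 2 + 2)%N by lia.
  by rewrite copD coprimen2; lia.
have [h qh] : exists h, i = (4 * h)%N by exists (q./2); lia.
have [oh|eh] := boolP (odd h).
  have [n hn] : exists n, h = (n + 2)%N by exists (h - 2)%N; lia.
  exists n, (2 * n + 3)%N; split; [lia|lia| |].
    apply: (lift _ _ _ qh); first by apply: cop4; lia.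
    by rewrite hn copD coprimen2; lia.
  apply: (lift _ _ _ qh); first by apply: cop4; lia.
  have -> : (2 * n + 3 = h + n.+1)%N by lia.
  rewrite coprime_sym copD hn (_ : n + 2 = n.+2)%N; last by lia.
  exact: coprimeSn.
have [n hn] : exists n, h = n.+1 by exists h.-1; lia.
exists n, (n + n.+1)%N; split; [lia|lia| |].
  apply: (lift _ _ _ qh); first by apply: cop4; lia.
  by rewrite hn -[n.+1]addn1 copD coprimen1.
apply: (lift _ _ _ qh); first by apply: cop4; lia.
by rewrite addnC coprime_sym hn copD coprimeSn.
Qed.

(* t is the product of the primes of N not dividing k, so that k + t i is a unit
   at each prime of N. *)
Lemma lift_coprime k i N : (0 < N)%N -> coprime k i ->
  exists k', (k' = k %[mod i])%N /\ coprime k' N.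
Proof.
move=> N0 cki; pose t := (\prod_(p <- primes N | ~~ (p %| k)%N) p)%N.
exists (k + t * i)%N; split; first by rewrite addnC modnMDl.
have g0 : (0 < gcdn (k + t * i) N)%N by rewrite gcdn_gt0 N0 orbT.
rewrite /coprime; apply/eqP; apply: contraTeq (isT) => g1.
have [|p pp] := @pdivP (gcdn (k + t * i) N).
  by rewrite ltn_neqAle g0 andbT eq_sym.
rewrite dvdn_gcd => /andP[pk pN].
have pt : (p %| t)%N = ~~ (p %| k)%N.
  rewrite /t Euclid_dvd_prod // big_has_cond; apply/hasP/idP.
    move=> [r Hr /= /andP[rk pr]]; move: Hr; rewrite mem_primes => /and3P[rp _ _].
    by move: pr; rewrite dvdn_prime2 // => /eqP ->.
  by move=> npk; exists p; [rewrite mem_primes pp N0 | rewrite /= npk dvdnn].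
have [pk'|pk'] := boolP (p %| k)%N.
  move: pk; rewrite dvdn_addr // Euclid_dvdM // pt pk' /= => pi.
  have : (p %| gcdn k i)%N by rewrite dvdn_gcd pk' pi.
  by rewrite (eqP cki) dvdn1 => /eqP p1; move: pp; rewrite p1.
by move: pk; rewrite dvdn_addl ?(negPf pk') // dvdn_mulr // pt pk'.
Qed.

Definition small_orders : seq (option nat) :=
  None :: [seq Some i | i <- [:: 2; 3; 4; 5; 6; 8; 10; 12]%N].
Definition rational_pairs : seq (option nat * option nat) :=
  [:: (Some 2, Some 3); (Some 2, Some 4); (Some 2, Some 6); (Some 2, None);
      (Some 3, Some 3); (Some 3, None); (Some 4, Some 4); (Some 6, Some 6);
      (None, None)]%N.
(** One conjugation fixes a^2 and b^2 but changes the sign of a b, which is not 0; another one moves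
    a^2 or b^2. Together with the identity these are three places. *)
Definition flips (l m : option nat) :=
  let N := (2 * odn l * odn m)%N in
  [&& l != Some 2%N, m != Some 2%N,
  has (fun k => coprime k N && ((sgn_of l k true && sgn_of m k false) ||
                                (sgn_of l k false && sgn_of m k true))) (iota 0 N) &
  has (fun k => coprime k N && (moves l k || moves m k)) (iota 0 N)].

Lemma small_table l m : l \in small_orders -> m \in small_orders ->
  le_oo l m -> (l, m) != (Some 2, Some 2)%N ->
  [|| (l, m, None) \in sixteen_signatures, (l, m) \in rational_pairs | flips l m].
Proof.
have : all (fun p => (le_oo p.1 p.2 && (p != (Some 2, Some 2)%N)) ==>
   [|| (p.1, p.2, None) \in sixteen_signatures, p \in rational_pairs | flips p.1 p.2])
   [seq (l', m') | l' <- small_orders, m' <- small_orders] by vm_compute.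
move=> /allP H Hl Hm lm ne; have := H (l, m); rewrite lm ne; apply.
exact: allpairs_f.
Qed.

Lemma cf_neq0 o : le_oo (Some 2%N) o -> o != Some 2%N -> cf R o != 0.
Proof.
case: o => [l|]; last by rewrite cf_oo pnatr_eq0.
move=> /= l2 ne; rewrite gt_eqF // mulr_gt0 //; apply: cos_gt0_pihalf.
have pi0 := pi_gt0 R; have l0 : 0 < l%:R :> R by rewrite ltr0n ltnW.
have : 0 < pi / l%:R :> R by rewrite divr_gt0.
have : pi / l%:R < pi / 2 :> R.
  rewrite ltr_pM2l // ltf_pV2 ?posrE // ltr_nat ltn_neqAle l2 andbT.
  by apply: contra ne => /eqP ->.
by move=> H1 H2; rewrite /=; apply/andP; split; lra.
Qed.

(** An order outside [small_orders] alone yields three conjugates of a^2 or of b^2; the remaining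
    pairs are finite in number and are checked by computation. *)
Lemma three_places (l m : option nat) :
  le_oo (Some 2%N) l -> le_oo l m -> (l, m) != (Some 2, Some 2)%N ->
  [\/ (l, m, None) \in sixteen_signatures, (l, m) \in rational_pairs |
   exists s1 s2 s3, [/\ real_place (abfield (cf R l) (cf R m)) s1,
     real_place (abfield (cf R l) (cf R m)) s2, real_place (abfield (cf R l) (cf R m)) s3 &
     [/\ s1 <> s2, s1 <> s3 & s2 <> s3]]].
Proof.
move=> l2 lm ne.
have m2 : le_oo (Some 2%N) m.
  by move: l2 lm; case: (l) => [l'|]; case: (m) => [m'|] //=; exact: leq_trans.
have od o : le_oo (Some 2%N) o -> (0 < odn o)%N.
  by case: o => [i|] //=; exact: ltnW.
have [l0 m0] := (od _ l2, od _ m2).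
set N := (2 * odn l * odn m)%N.
have N0 : (0 < N)%N by rewrite !muln_gt0 l0.
have big i : (1 < i)%N -> i \notin [:: 2; 3; 4; 5; 6; 8; 10; 12]%N ->
    exists k2 k3, [/\ coprime k2 N, coprime k3 N & [/\
      cfk k2 (Some i) ^+ 2 != cfk 1 (Some i) ^+ 2,
      cfk k3 (Some i) ^+ 2 != cfk 1 (Some i) ^+ 2 &
      cfk k3 (Some i) ^+ 2 != cfk k2 (Some i) ^+ 2]].
  move=> i1 /(three_units i1) [k2 [k3 [/andP[k21 k23] k3i c2 c3]]].
  have [k2' [E2 c2']] := lift_coprime N0 c2.
  have [k3' [E3 c3']] := lift_coprime N0 c3.
  have i0 : (0 < i)%N by exact: ltnW.
  have K k k' : (k' = k %[mod i])%N -> cfk k' (Some i) ^+ 2 = cfk k (Some i) ^+ 2.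
    by move=> E; rewrite -(cfk_sq_mod k') // E cfk_sq_mod.
  have k2i : (2 * k2 <= i)%N.
    by apply: leq_trans (ltnW k3i); rewrite leq_mul2l ltnW.
  exists k2', k3'; split=> //; rewrite (K _ _ E2) (K _ _ E3).
  split; apply/eqP => /(cfk_sq_inj i0) E.
  - by move: k21; rewrite (E k2i i1).
  - by move: k21 k23; rewrite (E (ltnW k3i) i1) ltnNge ltnS; case: (k2).
  - by move: k23; rewrite (E (ltnW k3i) k2i) ltnn.
have [s1 [P1 s1l s1m s1lm]] := @gam_place l m 1 l0 m0 (coprime1n _).
have bigP : (exists k2 k3, [/\ coprime k2 N, coprime k3 N & exists2 o, o = l \/ o = m &
    [/\ cfk k2 o ^+ 2 != cfk 1 o ^+ 2,
      cfk k3 o ^+ 2 != cfk 1 o ^+ 2 &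
      cfk k3 o ^+ 2 != cfk k2 o ^+ 2]]) ->
   exists s1 s2 s3, [/\ real_place (abfield (cf R l) (cf R m)) s1,
     real_place (abfield (cf R l) (cf R m)) s2, real_place (abfield (cf R l) (cf R m)) s3 &
     [/\ s1 <> s2, s1 <> s3 & s2 <> s3]].
  move=> [k2 [k3 [c2 c3 [w om [d12 d13 d23]]]]].
  have [s2 [P2 s2l s2m s2lm]] := gam_place l0 m0 c2.
  have [s3 [P3 s3l s3m s3lm]] := gam_place l0 m0 c3.
  exists s1, s2, s3; split=> //.
  case: om d12 d13 d23 => -> /eqP d12 /eqP d13 /eqP d23.
    by split=> E; [apply: d12 | apply: d13 | apply: d23]; rewrite -?s1l -?s2l -?s3l E.
  by split=> E; [apply: d12 | apply: d13 | apply: d23]; rewrite -?s1m -?s2m -?s3m E.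
have small o : le_oo (Some 2%N) o -> o \notin small_orders -> exists2 i, o = Some i &
    (1 < i)%N /\ i \notin [:: 2; 3; 4; 5; 6; 8; 10; 12]%N.
  case: o => [i|]; last by move=> _ /negP; case.
  move=> i2 /negP ni; exists i; first by [].
  split; first by [].
  apply/negP => Hi; apply: ni; rewrite /small_orders inE /=.
  exact: (map_f Some Hi).
have [Sl|/(small _ l2) [i lE [i1 ni]]] := boolP (l \in small_orders); last first.
  constructor 3; apply: bigP; have [k2 [k3 [c2 c3 D]]] := big _ i1 ni.
  by exists k2, k3; split=> //; exists l; [left | rewrite lE].
have [Sm|/(small _ m2) [i mE [i1 ni]]] := boolP (m \in small_orders); last first.
  constructor 3; apply: bigP; have [k2 [k3 [c2 c3 D]]] := big _ i1 ni.
  by exists k2, k3; split=> //; exists m; [right | rewrite mE].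
case/or3P: (small_table Sl Sm lm ne) => [H|H|/and4P[l_2 m_2]]; [by constructor 1 | by constructor 2 |].
move=> /hasP[k _ /andP[ck sg]] /hasP[k' _ /andP[ck' mv]]; constructor 3.
have [s2 [P2 s2l s2m s2lm]] := gam_place l0 m0 ck.
have [s3 [P3 s3l s3m s3lm]] := gam_place l0 m0 ck'.
rewrite !cfk1 in s1l s1m s1lm.
have {sg} [E1 E2 E3] : [/\ cfk k l * cfk k m = - (cf R l * cf R m),
    cfk k l ^+ 2 = cf R l ^+ 2 & cfk k m ^+ 2 = cf R m ^+ 2].
  case/orP: sg => /andP[/(sgn_ofP l2) -> /(sgn_ofP m2) ->];
    by rewrite expr1 expr0; split; ring.
have lm0 : cf R l * cf R m != 0 by rewrite mulf_neq0 // cf_neq0.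
exists s1, s2, s3; split=> //; split=> E.
- move: s2lm; rewrite -E s1lm E1 => /eqP; rewrite -subr_eq0 opprK -mulr2n.
  by rewrite mulrn_eq0 /= (negPf lm0).
- case/orP: mv => [/(movesP l2)|/(movesP m2)] /eqP; apply.
    by rewrite -s3l -E s1l.
  by rewrite -s3m -E s1m.
- case/orP: mv => [/(movesP l2)|/(movesP m2)] /eqP; apply.
    by rewrite -s3l -E s2l.
  by rewrite -s3m -E s2m.
Qed.

End CyclotomicPlaces.

(** * Values of 2 cos (pi / k) and the fields of the nine classes *)

Section ExplicitFields.
Variable R : realType.
Implicit Types (K : set R) (x y a b : R).
Local Notation sq n := (Num.sqrt n%:R : R).
Local Notation c k := (cf R (Some k%N)).

Lemma cf_ge0 k : le_oo (Some 2%N) k -> 0 <= cf R k.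
Proof.
case: k => [k|]; last by rewrite cf_oo.
by move=> /cf_lt2 => /(_ R) /andP[].
Qed.

Lemma cf_double k : (2 <= k)%N -> c (2 * k) ^+ 2 = 2 + c k.
Proof.
move=> k2; rewrite /cf /=; have k0 : k%:R != 0 :> R by rewrite pnatr_eq0 -lt0n ltnW.
have -> : pi / k%:R = 2 * (pi / (2 * k)%N%:R) :> R by rewrite natrM; field.
by rewrite cos_double; ring.
Qed.

Lemma cf_triple (th : R) : 2 * cos (3 * th) = (2 * cos th) ^+ 3 - 3 * (2 * cos th).
Proof.
have -> : 3 * th = 2 * th + th by ring.
rewrite cosD cos_double; have -> : sin (2 * th) = 2 * sin th * cos th.
  have -> : 2 * th = th + th by ring.
  by rewrite sinD; ring.
have -> : 2 * sin th * cos th * sin th = 2 * sin th ^+ 2 * cos th by ring.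
by rewrite sin2cos2; ring.
Qed.

Lemma sq_uniq x y : 0 <= x -> 0 <= y -> x ^+ 2 = y ^+ 2 -> x = y.
Proof. by move=> x0 y0 /eqP; rewrite eqrXn2 // => /eqP. Qed.

Lemma sqE n : sq n ^+ 2 = n%:R.
Proof. by rewrite sqr_sqrtr. Qed.

Lemma cf2 : c 2 = 0.
Proof. by rewrite /cf /= cos_pihalf mulr0. Qed.

Lemma cf3 : c 3 = 1.
Proof.
have c0 : 0 <= c 3 by exact: cf_ge0.
have : (c 3 - 1) ^+ 2 * (c 3 + 2) = 0.
  have := cf_triple (pi / 3); rewrite (_ : 3 * (pi / 3) = pi); last by field.
  by rewrite cospi -/(c 3) => E; apply/eqP; move: E; rewrite /cf /= => E; apply/eqP; nra.
move/eqP; rewrite mulf_eq0 sqrf_eq0 subr_eq0 => /orP[/eqP //|/eqP E].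
by exfalso; lra.
Qed.

Lemma cf4 : c 4 = sq 2.
Proof.
apply: sq_uniq; rewrite ?sqrtr_ge0 ?cf_ge0 // sqE.
by rewrite (@cf_double 2) // cf2 addr0.
Qed.

Lemma cf6 : c 6 = sq 3.
Proof.
apply: sq_uniq; rewrite ?sqrtr_ge0 ?cf_ge0 // sqE.
by rewrite (@cf_double 3) // cf3; ring.
Qed.

(** From cos (3 pi / 5) = - cos (2 pi / 5); the other factor c + 2 of the resulting cubic is
    positive. *)
Lemma cf5_eq : c 5 ^+ 2 = c 5 + 1.
Proof.
have c0 : 0 <= c 5 by exact: cf_ge0.
have E2 : 2 * cos (2 * (pi / 5)) = c 5 ^+ 2 - 2.
  by rewrite cos_double /cf /=; ring.
have E3 := cf_triple (pi / 5).
have E : cos (3 * (pi / 5)) = - cos (2 * (pi / 5)) :> R.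
  have -> : 3 * (pi / 5) = - (2 * (pi / 5)) + pi :> R by field.
  by rewrite cosDpi cosN.
have E' : 2 * cos (3 * (pi / 5)) = c 5 ^+ 3 - 3 * c 5 by rewrite E3.
have : (c 5 + 2) * (c 5 ^+ 2 - c 5 - 1) = 0.
  have -> : (c 5 + 2) * (c 5 ^+ 2 - c 5 - 1) =
     (c 5 ^+ 3 - 3 * c 5) + (c 5 ^+ 2 - 2) by ring.
  by rewrite -E' -E2 E; ring.
move/eqP; rewrite mulf_eq0 => /orP[/eqP H|/eqP H]; last by lra.
by exfalso; lra.
Qed.

Lemma cf5 : c 5 = (1 + sq 5) / 2.
Proof.
have c0 : 0 <= c 5 by exact: cf_ge0.
have E : (2 * c 5 - 1) ^+ 2 = sq 5 ^+ 2.
  by rewrite sqE; have := cf5_eq; nra.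
have : 2 * c 5 - 1 = sq 5.
  apply: sq_uniq => //; rewrite ?sqrtr_ge0 //.
  by have := cf5_eq; nra.
by lra.
Qed.

Lemma cfsq8 : c 8 ^+ 2 = 2 + sq 2.
Proof. by rewrite (@cf_double 4) // cf4. Qed.

Lemma cfsq10 : c 10 ^+ 2 = (5 + sq 5) / 2.
Proof. by rewrite (@cf_double 5) // cf5; field. Qed.

Lemma cfsq12 : c 12 ^+ 2 = 2 + sq 3.
Proof. by rewrite (@cf_double 6) // cf6. Qed.

Lemma cfsq5 : c 5 ^+ 2 = (3 + sq 5) / 2.
Proof. by rewrite cf5_eq cf5; field. Qed.

Lemma cf4_12 : c 4 * c 12 = 1 + sq 3.
Proof.
apply: sq_uniq; [by rewrite mulr_ge0 // cf_ge0 | by rewrite addr_ge0 // sqrtr_ge0 |].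
have s3 := sqE 3.
by rewrite exprMn cfsq12 cf4 sqE; move: s3; nra.
Qed.

Lemma cf4_6 : c 4 * c 6 = sq 6.
Proof.
apply: sq_uniq; [by rewrite mulr_ge0 // cf_ge0 | exact: sqrtr_ge0 |].
by rewrite exprMn cf4 cf6 !sqE; ring.
Qed.

(** The list consists of 2, 3, 5, 6 and the products of two of them; the products serve to separate
    the four quadratic fields. *)
Lemma nonsquare d : d \in [:: 2; 3; 5; 6; 10; 12; 15; 18; 30]%N ->
  forall k : nat, (k * k != d)%N.
Proof.
move=> Hd k; apply/eqP => E; subst d.
have k6 : (k < 6)%N.
  have : (k * k <= 30)%N by move: Hd; rewrite !inE; lia.
  by nia.
by move: k k6 Hd; do 6!case=> //.
Qed.

Lemma abfield_eq a b d : Q_sqrt d (a ^+ 2) -> Q_sqrt d (b ^+ 2) -> Q_sqrt d (a * b) ->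
  abfield a b (sq d) -> abfield a b = Q_sqrt d.
Proof.
move=> Ha Hb Hab Hd; apply: generated_field_eq.
  by move=> x [] ->.
by move=> x ->.
Qed.

Ltac field_facts :=
  rewrite ?cf4_12 ?cf4_6 ?cf2 ?cf3 ?cf_oo ?cfsq8 ?cfsq10 ?cfsq12 ?cfsq5 ?cf4 ?cf6 ?cf5;
  by field.

Lemma nine_classes_field d cl s : (d, cl) \in nine_classes -> s \in cl ->
  exists l m, [/\ s = (l, m, None), d \in [:: 2; 3; 5; 6]%N,
    s \in sixteen_signatures & abfield (cf R l) (cf R m) = Q_sqrt d].
Proof.
have HQ e : subfield (@Q_sqrt R e) by exact: subfield_generated.
have Hs e : @Q_sqrt R e (sq e) by apply: generated_field_in.
have HK x y := abfield_sub x y.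
have fin e l m : e \in [:: 2; 3; 5; 6]%N -> (l, m, None) \in sixteen_signatures ->
   abfield (cf R l) (cf R m) = Q_sqrt e ->
   exists l' m', [/\ (l, m, None) = (l', m', None) :> signature,
     e \in [:: 2; 3; 5; 6]%N,
     (l, m, None) \in sixteen_signatures & abfield (cf R l') (cf R m') = Q_sqrt e].
  by move=> ? ? ?; exists l, m.
have KA := abfield_aa; have KB := abfield_bb; have KC := abfield_ab.
have N x y n : abfield x y n%:R by exact: subfield_nat.
have Nq e n : @Q_sqrt R e n%:R by exact: subfield_nat.
have Dq e := subfieldD (HQ e); have Mq e := subfieldM (HQ e).
have Vq e := subfieldV_div (HQ e).
have Z e : @Q_sqrt R e 0 by exact: subfield0.
have O e : @Q_sqrt R e 1 by exact: subfield1.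
have p4 : 2 ^+ 2 = 4%:R :> R by ring.
(* sqrt d is recovered as p b^2 + q a b / 2 - n with small natural numbers p, q, n, which are tried
   in turn at the end. *)
have L x y z (p q n : nat) : z = p%:R * y ^+ 2 + q%:R * (x * y) / 2 - n%:R -> abfield x y z.
  move=> ->; have H := HK x y.
  apply: (subfieldB H) => //; apply: (subfieldD H); first exact: (subfieldM H).
  by apply: (subfieldV_div H) => //; apply: (subfieldM H).
move=> H1 H2; rewrite !inE in H1.
repeat match goal with H : is_true (_ || _) |- _ => move/orP: H => [H|H] end;
move/eqP: H1 => [? ?]; subst d cl; rewrite !inE in H2;
repeat match goal with H : is_true (_ || _) |- _ => move/orP: H => [H|H] end;
move/eqP: H2 => ?; subst s; apply: fin => //; apply: abfield_eq;
  try match goal with |- Q_sqrt _ _ =>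
    rewrite ?cf2 ?cf3 ?cf_oo ?mul0r ?mul1r ?expr1n ?expr0n /= ?cf4_12 ?cf4_6 -?expr2
      ?cfsq8 ?cfsq10 ?cfsq12 ?cfsq5 ?cf4 ?cf6 ?cf5 ?sqE ?p4; by auto 6
  end.
all: first [ apply: (L _ _ _ 1 0 2)%N; field_facts | apply: (L _ _ _ 0 1 0)%N; field_facts
    | apply: (L _ _ _ 0 2 0)%N; field_facts | apply: (L _ _ _ 0 2 1)%N; field_facts
    | apply: (L _ _ _ 2 0 5)%N; field_facts | apply: (L _ _ _ 2 0 3)%N; field_facts
    | apply: (L _ _ _ 0 4 1)%N; field_facts ].
Qed.

Lemma rational_pairs_field l m : (l, m) \in rational_pairs ->
  abfield (cf R l) (cf R m) `<=` @rationals R.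
Proof.
move=> H; have HQ := rationals_subfield R.
have N n : @rationals R n%:R by exact: subfield_nat.
have M := subfieldM HQ.
have Z : @rationals R 0 by exact: subfield0.
have O : @rationals R 1 by exact: subfield1.
have p4 : 2 ^+ 2 = 4%:R :> R by ring.
have s4 : c 4 ^+ 2 = 2 by rewrite cf4 sqE.
have s6 : c 6 ^+ 2 = 3 by rewrite cf6 sqE.
apply: generated_field_min => //; rewrite !inE in H.
repeat match goal with H : is_true (_ || _) |- _ => move/orP: H => [H|H] end;
move/eqP: H => [? ?]; subst l m => x [] ->;
  rewrite ?cf2 ?cf3 ?cf_oo ?mul0r ?mul1r ?expr1n ?expr0n /= -?expr2 ?s4 ?s6 ?p4; by auto.
Qed.

(** Outside the sixteen the field is Q, which has one place and is not of degree 2, or it has three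
    real places, too many for a quadratic field. *)
Lemma noncompact_classification l m (G : set 'M[R]_2) :
  hyperbolic_signature (l, m, None) -> triangle_group (l, m, None) G ->
  ((l, m, None) \in sixteen_signatures <-> arithmetic_dimension G 2) /\
  ((l, m, None) \in sixteen_signatures <-> degree_over_Q (invariant_trace_field G) 2).
Proof.
move=> [l2 lm _ sum1] TG.
have ne : (l, m) != (Some 2, Some 2)%N.
  apply/eqP => -[El Em]; move: sum1; rewrite El Em /=.
  by rewrite addr0 (_ : 2^-1 + 2^-1 = 1 :> rat) // -mulr2n -[_ *+ 2]mulr_natl mulfV.
have m2 : le_oo (Some 2%N) m.
  by move: l2 lm; case: (l) => [l'|]; case: (m) => [m'|] //=; exact: leq_trans.
have mne : m != Some 2%N.
  apply/eqP => Em; move: lm ne l2; rewrite Em; case: (l) => [l'|] //= l'2 ne l2.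
  by move/eqP: ne; apply; congr (Some _, _); apply/eqP; rewrite eqn_leq l'2.
have b0 := cf_neq0 R m2 mne.
have t0 : cf R l + cf R m != 0.
  have a0 := cf_ge0 l2; have bb : 0 < cf R m by rewrite lt_neqAle eq_sym b0 cf_ge0.
  by rewrite gt_eqF //; lra.
have [C [dC CG]] := triangle_group_gam TG.
have dG g : G g -> detpm1 g.
  by move=> Gg; have : conjugate C G (C * g * C^-1) by [exists g];
    rewrite CG => /gam_det; rewrite det_conj ?detpm1_unit // => E; left.
have [FE AD] := arith_dim_gam 2 b0 t0 dC dG CG.
set K := abfield (cf R l) (cf R m) in FE AD.
have HK : subfield K by exact: subfield_generated.
rewrite FE AD.
have deg_case : (l, m, None) \in sixteen_signatures ->
    exists2 d, (forall k : nat, (k * k != d)%N) & K = Q_sqrt d.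
  move=> H; have : has (fun p => (l, m, None) \in p.2) nine_classes.
    rewrite !inE in H.
    by repeat match goal with H : is_true (_ || _) |- _ => move/orP: H => [H|H] end;
      move/eqP: H => [-> ->].
  case/hasP => -[d cl] /= Hd Hs; have [l' [m' [E d4 _ KE]]] := nine_classes_field Hd Hs.
  exists d; last by rewrite /K; case: E => -> ->.
  by apply: nonsquare; move: d4; rewrite !inE; do ?[case/orP]; move=> /eqP ->.
split; split=> H.
- by have [d nsq ->] := deg_case H; exact: Q_sqrt_two_places.
- have [//|rp|[s1 [s2 [s3 [P1 P2 P3 [n12 n13 n23]]]]]] := three_places R l2 lm ne.
    have [s [s' [ss E]]] := card_eq_I2 H; case: ss.
    have in1 f : [set s; s'] f -> real_place K f by rewrite -E.
    have Ps : real_place K s by apply: in1; left.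
    have Ps' : real_place K s' by apply: in1; right.
    exact: rational_one_place HK (rational_pairs_field rp) Ps Ps'.
  exfalso; have [s [s' [ss E]]] := card_eq_I2 H.
  have in2 f : real_place K f -> f = s \/ f = s'.
    by move=> Pf; have : [set f | real_place K f] f by []; rewrite E.
  by case: (in2 _ P1) (in2 _ P2) (in2 _ P3) => [?|?] [?|?] [?|?]; subst.
- by have [d nsq ->] := deg_case H; exact: Q_sqrt_degree.
- have [//|rp|[s1 [s2 [s3 [P1 P2 P3 [n12 n13 n23]]]]]] := three_places R l2 lm ne.
    by case: (degree2_not_rational HK (rational_pairs_field rp)).
  by case: (degree2_places HK H P1 P2 P3).
Qed.

End ExplicitFields.

(** * Action on the half plane and cocompactness *)

Section HalfPlane.
Variable R : realType.
Implicit Types (g h C M : 'M[R]_2) (z w : R * R) (x y : R).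

(* The positive definite symmetric matrix of determinant 1 of a point z of the
   half plane; g acts on it by S |-> g S g^T. *)
Definition Hm z : 'M[R]_2 :=
  mx2 ((z.1 ^+ 2 + z.2 ^+ 2) / z.2) (z.1 / z.2) (z.1 / z.2) z.2^-1.

Lemma Hm_inj z w : 0 < z.2 -> 0 < w.2 -> Hm z = Hm w -> z = w.
Proof.
case: z w => [x y] [x' y'] /= y0 y0'; rewrite /Hm /= => H.
have [_ E _ /invr_inj yy] := mx2_inj H.
congr pair => //; move: E; rewrite yy => /(mulIf _); apply.
by rewrite invr_eq0 gt_eqF.
Qed.

Lemma isom_Hm g z : detpm1 g -> 0 < z.2 ->
  0 < (isom g z).2 /\ Hm (isom g z) = g * Hm z * g^T.
Proof.
elim/mx2_ind: g => a b c d Dg; case: z => x y /= y0.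
have D2 : (a * d - b * c) ^+ 2 = 1.
  by case: Dg; rewrite det_mx2 => ->; rewrite ?sqrrN expr1n.
have D1 : `|a * d - b * c| = 1 by case: Dg; rewrite det_mx2 => ->; rewrite ?normrN1 ?normr1.
rewrite /isom det_mx2 !mx2E D1 mul1r.
set den := (c * x + d) ^+ 2 + (c * y) ^+ 2.
have den0 : 0 < den.
  rewrite lt_neqAle addr_ge0 ?sqr_ge0 // andbT eq_sym /den paddr_eq0 ?sqr_ge0 //.
  rewrite !sqrf_eq0 mulf_eq0 (gt_eqF y0) orbF; apply/negP => /andP[/eqP E /eqP c0].
  move: E D2; rewrite c0 mul0r add0r => ->; rewrite !mulr0 subr0 expr0n => /eqP.
  by rewrite eq_sym oner_eq0.
have den0' : den != 0 by rewrite gt_eqF.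
have y0' : y != 0 by rewrite gt_eqF.
split; first by rewrite /= divr_gt0.
rewrite /Hm /= trmx2 !mulmx2; set num := a * c * _ + _ + _.
have E : num ^+ 2 + y ^+ 2 = den * ((a * x + b) ^+ 2 + (a * y) ^+ 2).
  have -> : y ^+ 2 = (a * d - b * c) ^+ 2 * y ^+ 2 by rewrite D2 mul1r.
  by rewrite /num /den; ring.
congr mx2.
- have -> : ((num / den) ^+ 2 + (y / den) ^+ 2) / (y / den) =
     (num ^+ 2 + y ^+ 2) / (den * y) by field; rewrite den0' y0'.
  by rewrite E; field; rewrite den0' y0'.
- have -> : num / den / (y / den) = num / y by field; rewrite den0' y0'.
  by rewrite /num; field.
- have -> : num / den / (y / den) = num / y by field; rewrite den0' y0'.
  by rewrite /num; field.
- by rewrite invf_div /den; field.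
Qed.

Lemma isom_comp g h z : detpm1 g -> detpm1 h -> 0 < z.2 ->
  isom (g * h) z = isom g (isom h z).
Proof.
move=> dg dh z0; have [h0 hE] := isom_Hm dh z0.
have [gh0 ghE] := isom_Hm (detpm1M dg dh) z0; have [ghh0 ghhE] := isom_Hm dg h0.
apply: Hm_inj => //; rewrite ghE ghhE hE.
by rewrite !mulrA -[(g * h)^T]/(g *m h)^T trmx_mul !mulmxE !mulrA.
Qed.

Lemma isom_1 z : 0 < z.2 -> isom 1 z = z.
Proof.
move=> z0; have d1 : @detpm1 R 1 by left; rewrite det1.
have [h0 hE] := isom_Hm d1 z0.
by apply: Hm_inj => //; rewrite hE mul1r trmx1 mulr1.
Qed.

(** The trace of [Hm z], that is, twice the hyperbolic cosine of the distance from i; a bound on it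
    confines z to a compact set. *)
Definition hsize z := (z.1 ^+ 2 + z.2 ^+ 2 + 1) / z.2.

Lemma hsize_bounds z : 0 < z.2 ->
  [/\ z.2 <= hsize z, z.2^-1 <= hsize z, `|z.1 / z.2| <= hsize z & (z.1 ^+ 2 + z.2 ^+ 2) / z.2 <= hsize z].
Proof.
case: z => x y /= y0; rewrite /hsize /=.
have yi0 : 0 < y^-1 by rewrite invr_gt0.
split.
- by rewrite ler_pdivlMr //; nra.
- by rewrite -{1}[y^-1]mul1r ler_pM2r //; nra.
- rewrite normrM (gtr0_norm yi0) ler_pM2r //.
  by case: (ger0P x) => ?; nra.
- by rewrite ler_pM2r //; nra.
Qed.

Lemma hsize_tr z : 0 < z.2 -> hsize z = \tr (Hm z).
Proof.
by case: z => x y /= y0; rewrite /hsize /Hm tr_mx2 /=; field; rewrite gt_eqF.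
Qed.

Lemma hsize_isom g : exists S, 0 < S /\ forall z, 0 < z.2 -> detpm1 g ->
  hsize (isom g z) <= S * hsize z.
Proof.
elim/mx2_ind: g => a b c d.
exists (a ^+ 2 + c ^+ 2 + 2 * `|a * b + c * d| + (b ^+ 2 + d ^+ 2) + 1); split.
  have := normr_ge0 (a * b + c * d); nra.
move=> z z0 dg; have [g0 gE] := isom_Hm dg z0.
rewrite hsize_tr // gE trmx2 /Hm !mulmx2 tr_mx2.
have [E1 E2 E3 E4] := hsize_bounds z0.
move: E1 E2 E3 E4; set X := (_ + _) / _; set Y := z.1 / z.2; set Z := z.2^-1.
set h := hsize z => E1 E2 E3 E4.
have Z0 : 0 <= Z by rewrite invr_ge0 ltW.
have h0 : 0 <= h by apply: le_trans E2.
have X1 : (a ^+ 2 + c ^+ 2) * X <= (a ^+ 2 + c ^+ 2) * h.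
  by rewrite ler_wpM2l // addr_ge0 ?sqr_ge0.
have X2 : (b ^+ 2 + d ^+ 2) * Z <= (b ^+ 2 + d ^+ 2) * h.
  by rewrite ler_wpM2l // addr_ge0 ?sqr_ge0.
have X3 : (a * b + c * d) * Y <= `|a * b + c * d| * h.
  by apply: le_trans (ler_norm _) _; rewrite normrM ler_wpM2l.
nra.
Qed.

Lemma compact_hsize (K : set (R * R)) : compact K -> K `<=` @upper_half_plane R ->
  exists B, forall z, K z -> hsize z <= B.
Proof.
move=> cK KH.
have c1 : compact (hsize @` K).
  apply: continuous_compact => //; apply: continuous_in_subspaceT => z /set_mem Kz.
  have z0 := KH _ Kz.
  apply: cvgM; last first.
    apply: cvgV; first by rewrite gt_eqF.
    exact: cvg_snd.
  apply: cvgD; last exact: cvg_cst.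
  by apply: cvgD; apply: (@continuous_comp _ _ _ _ (fun x : R => x ^+ 2));
    [exact: cvg_fst | exact: exprn_continuous | exact: cvg_snd | exact: exprn_continuous].
have [B [_ HB]] := compact_bounded c1.
exists (B + 1) => z Kz; apply: le_trans (ler_norm _) _.
by apply: HB; [rewrite ltrDl | exists z].
Qed.

(** A point (0, Y) with Y large stays far away: the first column of a group element has an entry of
    absolute value at least 1, so that the image has size at least Y. *)
Lemma gam_not_cocompact (l m : option nat) (G : set 'M[R]_2) C :
  le_oo (Some 2%N) l -> le_oo (Some 2%N) m ->
  detpm1 C -> conjugate C G = gam (cf R l) (cf R m) -> ~ cocompact G.
Proof.
move=> l2 m2 dC CG [K [cK KH cov]].
have [B HB] := compact_hsize cK KH.
have [S [S0 HS]] := hsize_isom C.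
have UC := detpm1_unit dC.
pose Y := `|S * B| + 1.
have Y0 : 0 < Y by rewrite ltr_wpDl.
pose z := isom C^-1 (0, Y).
have [z0 zE] := @isom_Hm C^-1 (0, Y) (detpm1V dC) Y0.
have [g Gg Kgz] := cov z z0.
have : gam (cf R l) (cf R m) (C * g * C^-1) by rewrite -CG; exists g.
set k := C * g * C^-1 => Gk.
have dk : detpm1 k by left; exact: gam_det Gk.
have dg : detpm1 g.
  by move: dk; rewrite /detpm1 /k det_conj.
have [gz0 gzE] := isom_Hm dg z0.
have : hsize (isom C (isom g z)) <= S * B.
  by apply: le_trans (HS _ gz0 dC) _; rewrite ler_pM2l // HB.
have -> : isom C (isom g z) = isom k (0, Y).
  by rewrite /z -!isom_comp //; auto using detpm1V, detpm1M.
have [k0 kE] := @isom_Hm k (0, Y) dk Y0.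
rewrite hsize_tr // kE.
suff : Y <= \tr (k * Hm (0, Y) * k^T).
  rewrite /Y => H1 H2; have := ler_norm (S * B); lra.
have nl2 := gam_cf_lower_left l2 m2 Gk.
have nl1 := gam_cf_lower_left l2 m2 (gen2_X Gk).
move: nl1 nl2 (gam_det Gk); move: k {Gk dk k0 kE} => k; elim/mx2_ind: k => p q r s.
rewrite /Hm /= trmx2 !mulmx2 !mx2E tr_mx2 det_mx2 => nl1 nl2 D.
have -> : (0 ^+ 2 + Y ^+ 2) / Y = Y by field; rewrite gt_eqF.
rewrite !mul0r !mulr0 !addr0 !add0r; have Yi : 0 < Y^-1 by rewrite invr_gt0.
have E1 : 0 <= q * Y^-1 * q by rewrite mulrAC -expr2 mulr_ge0 ?sqr_ge0 // ltW.
have E2 : 0 <= s * Y^-1 * s by rewrite mulrAC -expr2 mulr_ge0 ?sqr_ge0 // ltW.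
have big e : 1 <= `|e| -> Y <= e * Y * e.
  move=> e1; rewrite mulrAC -expr2 -real_normK ?num_real //.
  by apply: ler_peMl; [exact: ltW | exact: exprn_ege1].
have pos e : 0 <= e * Y * e by rewrite mulrAC -expr2 mulr_ge0 ?sqr_ge0 // ltW.
have [r0|/big] := nl2; last by have := pos p; lra.
have : 1 <= `|p|.
  case: nl1 => [E|]; last by rewrite mul0r addr0 mulN1r normrN.
  exfalso; move: D E; rewrite r0 mulr0 subr0 mul0r addr0 mulN1r => D /eqP.
  by rewrite oppr_eq0 => /eqP p0; move: D; rewrite p0 mul0r => /eqP; rewrite eq_sym oner_eq0.
by move=> /big; have := pos r; lra.
Qed.

Section Compact.
Variables P Q V : R * R.
Local Notation p := (Some P : option (R * R)).
Local Notation q := (Some Q : option (R * R)).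
Local Notation v := (Some V : option (R * R)).
Hypotheses (P0 : 0 < P.2) (Q0 : 0 < Q.2) (V0 : 0 < V.2).
Hypothesis tri : triangle p q v.

(* The hyperbolic cosine of the distance. *)
Definition chd z w := ((z.1 - w.1) ^+ 2 + z.2 ^+ 2 + w.2 ^+ 2) / (2 * z.2 * w.2).

Lemma chd_gt0 z w : 0 < z.2 -> 0 < w.2 -> 0 < chd z w.
Proof.
move=> z0 w0; rewrite divr_gt0 ?mulr_gt0 //.
by have := sqr_ge0 (z.1 - w.1); have := exprn_gt0 2 z0; have := exprn_gt0 2 w0; lra.
Qed.

Lemma chd_Hm z w : 0 < z.2 -> 0 < w.2 -> chd z w =
  (Hm z 0 0 * Hm w 1 1 + Hm z 1 1 * Hm w 0 0 - 2 * Hm z 0 1 * Hm w 0 1) / 2.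
Proof.
move=> z0 w0; rewrite /Hm !mx2E /chd; field.
by rewrite !gt_eqF.
Qed.

(* Up to a factor, the hyperbolic sine of the signed distance to the wall through s and s'. *)
Definition wall (s s' : option (R * R)) z :=
  ev (ga s s') (gb s s') (gc s s') (Some z) / (Num.sqrt (gD s s') * z.2).

(** In the hyperboloid model [chd] is the bilinear form, and a reflection adds to a vector a
    multiple of the normal of the wall. *)
Lemma chd_reflect s s' z w : 0 < gD s s' -> 0 < z.2 -> 0 < w.2 ->
  chd (isom (rm s s') z) w = chd z w + wall s s' z * wall s s' w / 2.
Proof.
move=> D z0 w0.
have dM : detpm1 (rm s s') by right; exact: det_rm.
have [g0 gE] := isom_Hm dM z0.
rewrite !chd_Hm // gE /rm /gm /wall /ev /h0 /h1 /h2 /Hm.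
have s0 : Num.sqrt (gD s s') != 0 by rewrite gt_eqF // sqrtr_gt0.
have sD : ga s s' ^+ 2 + gb s s' * gc s s' = Num.sqrt (gD s s') ^+ 2.
  by rewrite sqr_sqrtr // ltW.
move: (ga s s') (gb s s') (gc s s') (Num.sqrt _) s0 sD => a b c t t0 tD.
case: z z0 {g0 gE} => x y /= y0; case: w w0 => x' y' /= y0'.
rewrite scalemx2 trmx2 !mulmx2 !mx2E.
have [y1 y1'] : y != 0 /\ y' != 0 by rewrite !gt_eqF.
apply/eqP; rewrite -subr_eq0; apply/eqP.
transitivity ((a ^+ 2 + b * c - t ^+ 2) / t ^+ 2 * chd (x, y) (x', y')).
  by rewrite /chd /=; field; rewrite t0 y1 y1'.
by rewrite tD subrr !mul0r.
Qed.

Lemma wall_on s s' : wall s s' = wall s s' -> forall z, s = Some z \/ s' = Some z ->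
  wall s s' z = 0.
Proof.
by move=> _ z [E|E]; rewrite /wall -E ?ev_gl ?ev_gr mul0r.
Qed.

Let Dpq : 0 < gD p q.
Proof. by have [? _ _] := triangle_neq tri; case: tri => *; apply: gD_gt0. Qed.
Let Dqv : 0 < gD q v.
Proof. by have [_ ? _] := triangle_neq tri; case: tri => *; apply: gD_gt0. Qed.
Let Dvp : 0 < gD v p.
Proof. by have [_ _ ?] := triangle_neq tri; case: tri => *; apply: gD_gt0. Qed.

Lemma wall_neq0 (s s' : option (R * R)) z : 0 < gD s s' -> 0 < z.2 ->
  h3 s s' (Some z) != 0 -> wall s s' z != 0.
Proof.
move=> D z0 T; rewrite /wall mulf_neq0 // invr_eq0 mulf_neq0 ?(gt_eqF z0) //.
by rewrite gt_eqF // sqrtr_gt0.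
Qed.

(** Barycentric coordinates in the hyperboloid model, where the three vertices form a basis;
    [bary_sum] is the expansion of z. *)
Definition bary1 z := wall q v z / wall q v P.
Definition bary2 z := wall v p z / wall v p Q.
Definition bary3 z := wall p q z / wall p q V.

Let N1 : wall q v P != 0.
Proof. by apply: wall_neq0 => //; rewrite h3C; exact: triangle_h3. Qed.
Let N2 : wall v p Q != 0.
Proof. by apply: wall_neq0 => //; rewrite 2!h3C; exact: triangle_h3. Qed.
Let N3 : wall p q V != 0.
Proof. by apply: wall_neq0 => //; exact: triangle_h3. Qed.

Definition chd3 z := chd z P + chd z Q + chd z V.

Lemma step1 z : 0 < z.2 -> chd3 (isom (rm q v) z) = chd3 z + bary1 z * (wall q v P ^+ 2 / 2).
Proof.
move=> z0; rewrite /chd3 !chd_reflect // (@wall_on q v erefl Q) ?(@wall_on q v erefl V); auto.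
by rewrite /bary1; field.
Qed.

Lemma step2 z : 0 < z.2 -> chd3 (isom (rm v p) z) = chd3 z + bary2 z * (wall v p Q ^+ 2 / 2).
Proof.
move=> z0; rewrite /chd3 !chd_reflect // (@wall_on v p erefl P) ?(@wall_on v p erefl V); auto.
by rewrite /bary2; field.
Qed.

Lemma step3 z : 0 < z.2 -> chd3 (isom (rm p q) z) = chd3 z + bary3 z * (wall p q V ^+ 2 / 2).
Proof.
move=> z0; rewrite /chd3 !chd_reflect // (@wall_on p q erefl P) ?(@wall_on p q erefl Q); auto.
by rewrite /bary3; field.
Qed.

(** The tolerance - 1 instead of 0 makes every reflection decrease [chd3] by a fixed amount and
    still bounds z. *)
Definition good z := [/\ - 1 < bary1 z, - 1 < bary2 z & - 1 < bary3 z].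

(* Reflecting a point that is far on the wrong side of a wall in this wall
   decreases chd3 by a fixed amount, so finitely many reflections suffice. *)
Lemma reach_good (W : set 'M[R]_2) : W 1 -> (forall g h, W g -> W h -> W (g * h)) ->
  (forall g, W g -> detpm1 g) -> W (rm p q) -> W (rm q v) -> W (rm v p) ->
  forall z, 0 < z.2 -> exists2 g, W g & good (isom g z).
Proof.
move=> W1 WM Wd Wpq Wqv Wvp.
have sq0 x : x != 0 -> 0 < x ^+ 2 / 2 by move=> x0; rewrite divr_gt0 // exprn_even_gt0.
pose k1 := wall q v P ^+ 2 / 2; pose k2 := wall v p Q ^+ 2 / 2; pose k3 := wall p q V ^+ 2 / 2.
have [K1 K2 K3] : [/\ 0 < k1, 0 < k2 & 0 < k3] by split; apply: sq0.
pose k := Num.min k1 (Num.min k2 k3).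
have k0 : 0 < k by rewrite !lt_min K1 K2 K3.
have [kk1 kk2 kk3] : [/\ k <= k1, k <= k2 & k <= k3] by rewrite !ge_min !lexx !orbT.
suff H (n : nat) : forall z, 0 < z.2 -> chd3 z <= n%:R * k -> exists2 g, W g & good (isom g z).
  move=> z z0; apply: (H (Num.truncn (chd3 z / k)).+1 _ z0).
  rewrite -ler_pdivrMr // ltW //.
  by apply: truncnS_gt.
elim: n => [|n IH] z z0 Hz.
  exfalso; have := chd_gt0 z0 P0; have := chd_gt0 z0 Q0; have := chd_gt0 z0 V0.
  by move: Hz; rewrite mul0r /chd3; lra.
have go M : W M -> chd3 (isom M z) <= chd3 z - k -> exists2 g, W g & good (isom g z).
  move=> WMm le; have [M0 _] := isom_Hm (Wd _ WMm) z0.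
  have [g Wg Hg] : exists2 g, W g & good (isom g (isom M z)).
    by apply: IH => //; apply: le_trans le _; move: Hz; rewrite -natr1 mulrDl mul1r; lra.
  by exists (g * M); [exact: WM | rewrite isom_comp //; exact: Wd].
have [b1|b1] := ltP (- 1) (bary1 z); last first.
  by apply: (go _ Wqv); rewrite step1 // -/k1; nra.
have [b2|b2] := ltP (- 1) (bary2 z); last first.
  by apply: (go _ Wvp); rewrite step2 // -/k2; nra.
have [b3|b3] := ltP (- 1) (bary3 z); last first.
  by apply: (go _ Wpq); rewrite step3 // -/k3; nra.
by exists 1 => //; rewrite isom_1.
Qed.

Lemma bary_sum z : 0 < z.2 ->
  [/\ h0 (Some z) / z.2 = bary1 z * (h0 p / P.2) + bary2 z * (h0 q / Q.2) + bary3 z * (h0 v / V.2),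
      z.1 / z.2 = bary1 z * (P.1 / P.2) + bary2 z * (Q.1 / Q.2) + bary3 z * (V.1 / V.2) &
      z.2^-1 = bary1 z * P.2^-1 + bary2 z * Q.2^-1 + bary3 z * V.2^-1].
Proof.
move=> z0.
have T := triangle_h3 tri.
have rat s s' w : 0 < gD s s' -> 0 < w.2 -> h3 s s' (Some w) != 0 ->
   wall s s' z / wall s s' w = h3 s s' (Some z) / h3 s s' (Some w) * (w.2 / z.2).
  move=> D w0 Tw; rewrite /wall -/(h3 s s' (Some z)) -/(h3 s s' (Some w)).
  have s0 : Num.sqrt (gD s s') != 0 by rewrite gt_eqF // sqrtr_gt0.
  by field; rewrite Tw s0 !gt_eqF.
have T1 : h3 q v p != 0 by rewrite h3C.
have T2 : h3 v p q != 0 by rewrite 2!h3C.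
have E2 : h3 v p q = h3 p q v by rewrite 2!h3C.
rewrite /bary1 /bary2 /bary3 !rat // E2 (h3C p q v).
have [n1 n2 n3 n4] : [/\ z.2 != 0, P.2 != 0, Q.2 != 0 & V.2 != 0] by rewrite !gt_eqF.
have comb d (c1 c2 c3 d1 d2 d3 : R) : h3 p q v * d = c1 * d1 + c2 * d2 + c3 * d3 ->
    d / z.2 = c1 / h3 p q v * (P.2 / z.2) * (d1 / P.2) +
      c2 / h3 p q v * (Q.2 / z.2) * (d2 / Q.2) + c3 / h3 p q v * (V.2 / z.2) * (d3 / V.2).
  move: (h3 p q v) T => t T E; have -> : d = (c1 * d1 + c2 * d2 + c3 * d3) / t.
    by rewrite -E; field.
  by move: P.2 Q.2 V.2 z.2 n1 n2 n3 n4 => *; field; do ?[apply/andP; split].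
split.
- by apply: comb; rewrite /h3 /ev /ga /gb /gc; ring.
- apply: comb; rewrite -[z.1]/(h1 (Some z)) -[P.1]/(h1 p) -[Q.1]/(h1 q) -[V.1]/(h1 v).
  by rewrite /h3 /ev /ga /gb /gc; ring.
- have := comb 1 (h3 q v (Some z)) (h3 v p (Some z)) (h3 p q (Some z)) 1 1 1.
  rewrite !mulr1 !mul1r; apply.
  by rewrite /h3 /ev /ga /gb /gc /h2; ring.
Qed.

(** The vector of z has norm 1, which is a quadratic equation with positive coefficients for the
    barycentric coordinates. All of them exceed - 1, so the largest one is bounded. *)
Lemma good_hsize : exists B, forall z, 0 < z.2 -> good z -> hsize z <= B.
Proof.
pose A := chd P Q; pose Bb := chd Q V; pose C := chd V P.
have [A0 B0 C0] : [/\ 0 < A, 0 < Bb & 0 < C] by split; apply: chd_gt0.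
pose W := 2 * (A + Bb + C) + 1.
exists (W * (hsize P + hsize Q + hsize V)) => z z0 [b1 b2 b3].
have := bary_sum z0; move: b1 b2 b3.
move: (bary1 z) (bary2 z) (bary3 z) => al be ga b1 b2 b3 [E0 E1 E2].
have n z' : 0 < z'.2 -> z'.2 != 0 :> R by move=> /gt_eqF ->.
have cE w w' : 0 < w.2 -> 0 < w'.2 -> chd w w' = (h0 (Some w) / w.2 * w'.2^-1 +
    w.2^-1 * (h0 (Some w') / w'.2) - 2 * (w.1 / w.2) * (w'.1 / w'.2)) / 2.
  by move=> w0 w'0; rewrite /chd /h0; field; rewrite !n.
have dE w : 0 < w.2 -> h0 (Some w) / w.2 * w.2^-1 - (w.1 / w.2) ^+ 2 = 1.
  by move=> w0; rewrite /h0; field; exact: n.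
have S : al ^+ 2 + be ^+ 2 + ga ^+ 2 + 2 * (al * be) * A + 2 * (be * ga) * Bb +
    2 * (ga * al) * C = 1.
  transitivity (h0 (Some z) / z.2 * z.2^-1 - (z.1 / z.2) ^+ 2); last exact: dE.
  rewrite E0 E1 E2 /A /Bb /C !cE //.
  move: (dE _ P0) (dE _ Q0) (dE _ V0).
  move: P.2^-1 Q.2^-1 V.2^-1 (h0 p / P.2) (h0 q / Q.2) (h0 v / V.2) (P.1 / P.2) (Q.1 / Q.2) (V.1 / V.2).
  move=> x2 y2 w2 x0 y0 w0 x1 y1 w1 X Y W'.
  have -> : al ^+ 2 = al ^+ 2 * (x0 * x2 - x1 ^+ 2) by rewrite X mulr1.
  have -> : be ^+ 2 = be ^+ 2 * (y0 * y2 - y1 ^+ 2) by rewrite Y mulr1.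
  have -> : ga ^+ 2 = ga ^+ 2 * (w0 * w2 - w1 ^+ 2) by rewrite W' mulr1.
  by field.
(* x is the largest coordinate. When x > 1, each mixed product is at least - x, so that x^2 <= 1 + 2
   x (Ax + Bx + Cx). *)
have bound (x y w Ax Bx Cx : R) : - 1 < x -> - 1 < y -> - 1 < w -> 0 < Ax -> 0 < Bx -> 0 < Cx ->
    y <= x -> w <= x -> x ^+ 2 + y ^+ 2 + w ^+ 2 + 2 * (x * y) * Ax + 2 * (y * w) * Bx +
    2 * (w * x) * Cx = 1 -> x <= 2 * (Ax + Bx + Cx) + 1.
  move=> x1 y1 w1 a0 b0 c0 yx wx E; rewrite leNgt; apply/negP => H.
  have x2 : 1 < x by lra.
  have P1 : - x <= x * y by nra.
  have P2 : - x <= w * x by nra.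
  have P3 : - x <= y * w.
    have [y0|y0] := leP 0 y; have [w0|w0] := leP 0 w.
    - by have := mulr_ge0 y0 w0; lra.
    - nra.
    - nra.
    - by have := mulr_le0 (ltW y0) (ltW w0); lra.
  have Q1 : - x * Ax <= x * y * Ax by rewrite ler_pM2r.
  have Q2 : - x * Cx <= w * x * Cx by rewrite ler_pM2r.
  have Q3 : - x * Bx <= y * w * Bx by rewrite ler_pM2r.
  have : x * (2 * (Ax + Bx + Cx) + 1) < x * x by rewrite ltr_pM2l // (lt_trans ltr01).
  by have := sqr_ge0 y; have := sqr_ge0 w; nra.
have [al1 be1 ga1] : [/\ al <= W, be <= W & ga <= W].
  have alP : be <= al -> ga <= al -> al <= W.
    by move=> H1 H2; apply: (bound al be ga A Bb C).
  have beP : ga <= be -> al <= be -> be <= W.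
    move=> H1 H2; rewrite (_ : W = 2 * (Bb + C + A) + 1); last by rewrite /W; ring.
    by apply: (bound be ga al Bb C A) => //; rewrite -[RHS]S; ring.
  have gaP : al <= ga -> be <= ga -> ga <= W.
    move=> H1 H2; rewrite (_ : W = 2 * (C + A + Bb) + 1); last by rewrite /W; ring.
    by apply: (bound ga al be C A Bb) => //; rewrite -[RHS]S; ring.
  have [ab|/ltW ab] := leP be al; have [bg|/ltW bg] := leP ga be.
  - have alW := alP ab (le_trans bg ab).
    by split; [|apply: le_trans alW | apply: le_trans (le_trans bg ab) alW].
  - have [ag|/ltW ag] := leP ga al.
      have alW := alP ab ag.
      by split; [|apply: le_trans alW | apply: le_trans alW].
    have gaW := gaP ag bg.
    by split; [apply: le_trans gaW | apply: le_trans gaW |].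
  - have beW := beP bg ab.
    by split; [apply: le_trans beW | | apply: le_trans beW].
  - have gaW := gaP (le_trans ab bg) bg.
    by split; [apply: le_trans (le_trans ab bg) gaW | apply: le_trans gaW |].
have hE w : hsize w = h0 (Some w) / w.2 + w.2^-1 by rewrite /hsize /h0 mulrDl mul1r.
have hp w : 0 < w.2 -> 0 <= hsize w.
  by move=> w0; have [+ _ _ _] := hsize_bounds w0; apply: le_trans; exact: ltW.
have -> : hsize z = al * hsize P + be * hsize Q + ga * hsize V.
  by rewrite !hE E0 E2; ring.
have := hp _ P0; have := hp _ Q0; have := hp _ V0 => V1 Q1 P1.
by rewrite !mulrDr !lerD // ler_wpM2r.
Qed.

(** An element of determinant - 1 is corrected by one more reflection, which multiplies the bound by
    at most S. *)
Lemma compact_reflection_group (W : set 'M[R]_2) : psl_subgroup W ->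
  W (rm p q) -> W (rm q v) -> W (rm v p) -> cocompact (W `&` [set g | \det g = 1]).
Proof.
move=> [[W1 _] Wd WM _] Wpq Wqv Wvp.
have [B HB] := good_hsize.
have [S [S0 HS]] := hsize_isom (rm p q).
pose L := `|B| + `|S * B| + 1.
have L1 : 1 <= L by have := normr_ge0 B; have := normr_ge0 (S * B); rewrite /L; lra.
have BL : B <= L by have := ler_norm B; have := normr_ge0 (S * B); rewrite /L; lra.
have SBL : S * B <= L by have := ler_norm (S * B); have := normr_ge0 B; rewrite /L; lra.
pose K := [set z : R * R | `[- L, L]%classic z.1 /\ `[L^-1, L]%classic z.2].
have L0 : 0 < L by lra.
have inK z : 0 < z.2 -> hsize z <= L -> K z.
  move=> z0 zL; have [H1 H2 H3 H4] := hsize_bounds z0.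
  have y1 : z.2 <= L by lra.
  have y2 : L^-1 <= z.2.
    by rewrite -[z.2]invrK lef_pV2 ?posrE ?invr_gt0 //; lra.
  split; rewrite /= in_itv /=; last by rewrite y2 y1.
  rewrite -ler_norml -(ler_pXn2r (ltn0Sn 1)) ?nnegrE ?normr_ge0 ?(ltW L0) //.
  rewrite real_normK ?num_real //.
  have : (z.1 ^+ 2 + z.2 ^+ 2) / z.2 <= L by lra.
  rewrite ler_pdivrMr // => H5.
  have := sqr_ge0 z.2; have : L * z.2 <= L * L by rewrite ler_pM2l.
  rewrite [L ^+ 2]expr2; lra.
exists K; split.
- have -> : K = `[- L, L]%classic `*` `[L^-1, L]%classic by [].
  by apply: compact_setX; exact: segment_compact.
- move=> z [_] /=; rewrite in_itv /= => /andP[z1 _]; apply: lt_le_trans z1.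
  by rewrite invr_gt0.
- move=> z z0; have [g Wg Hg] := reach_good W1 WM Wd Wpq Wqv Wvp z0.
  have dg := Wd _ Wg; have [g0 _] := isom_Hm dg z0.
  have HgB := HB _ g0 Hg.
  case: (dg) => d1.
    by exists g; [split | apply: inK => //; lra].
  have dM : detpm1 (rm p q) by exact: Wd.
  exists (rm p q * g).
    split; first exact: WM.
    by rewrite /= detM2 d1 (det_rm Dpq) mulrNN mulr1.
  rewrite isom_comp //; have [M0 _] := isom_Hm dM g0; apply: inK => //.
  apply: le_trans (HS _ g0 dM) _; apply: le_trans SBL.
  by rewrite ler_pM2l.
Qed.

End Compact.

Lemma vertex_interior (p q v : option (R * R)) (theta : R) : closed_point p -> vertex_angle p q v = theta ->
  theta != 0 -> exists2 z, p = Some z & 0 < z.2.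
Proof.
case: p => [z|] _ /=; last by move=> <-; rewrite eqxx.
by case: ifP => [z0 _ _|_ <-]; [exists z | rewrite eqxx].
Qed.

Lemma compact_triangle_group l m n (G : set 'M[R]_2) :
  hyperbolic_signature (l, m, Some n) -> triangle_group (l, m, Some n) G -> cocompact G.
Proof.
case: m => [m|]; last by case: l => [l|] [].
case: l => [l|]; last by case.
move=> [l2 lm mn _] [p [q [r [tri Ap Aq Ar GE]]]].
have pi0 := pi_gt0 R.
have ang k : (2 <= k)%N -> angle_oo R (Some k) != 0.
  by move=> k2; rewrite /= gt_eqF // divr_gt0 // ltr0n ltnW.
have m2 : (2 <= m)%N by apply: leq_trans lm.
have n2 : (2 <= n)%N by apply: leq_trans mn.
have [cp cq cr _] := tri.
have [P pE P0] := vertex_interior cp Ap (ang _ l2).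
have [Q qE Q0] := vertex_interior cq Aq (ang _ m2).
have [V rE V0] := vertex_interior cr Ar (ang _ n2).
subst p q r; have [pq qr rp] := triangle_neq tri.
have D1 := gD_gt0 cp cq pq; have D2 := gD_gt0 cq cr qr; have D3 := gD_gt0 cr cp rp.
rewrite GE !reflectionsE //; apply: (compact_reflection_group P0 Q0 V0 tri).
- apply: generated_psl => g [[|]|] [] ->; right; rewrite ?detN2; exact: det_rm.
- by apply: generated_sub; left; left; left.
- by apply: generated_sub; left; right; left.
- by apply: generated_sub; right; left.
Qed.

End HalfPlane.

(** * Finite index and commensurability *)

Section Commensurability.
Variable R : realType.
Implicit Types (g h C D : 'M[R]_2) (G H L : set 'M[R]_2) (a b : R).

(** Finite index without sets of cosets: two elements of the same colour lie in the same left coset.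
    Colourings are easily restricted, transported and combined. *)
Definition coloring H G (n : nat) (c : 'M[R]_2 -> nat) :=
  (forall g, G g -> (c g < n)%N) /\
  (forall g g', G g -> G g' -> c g = c g' -> H (g^-1 * g')).

Definition fin_index H G := H `<=` G /\ exists n c, coloring H G n c.

Lemma psl_unit G g : psl_subgroup G -> G g -> g \is a GRing.unit.
Proof. by case=> _ Gd _ _ Gg; apply: detpm1_unit; exact: Gd. Qed.

Lemma finite_indexP H G : psl_subgroup H -> psl_subgroup G ->
  finite_index H G <-> fin_index H G.
Proof.
move=> PH PG; have [[H1 _] _ HM HV] := PH.
pose cs g := [set g * h | h in H].
have csE g g' : G g -> H (g^-1 * g') -> cs g = cs g'.
  move=> Gg Hgg; have Ug := psl_unit PG Gg; have Ugg := psl_unit PH Hgg.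
  apply/seteqP; split=> _ [h Hh <-].
    exists ((g^-1 * g')^-1 * h); first by apply: HM => //; apply: HV.
    have Ug' : g' = g * (g^-1 * g') by rewrite mulrA divrr ?mul1r.
    by rewrite {1}Ug' mulrA -[g * _ * _]mulrA divrr // mulr1.
  by exists (g^-1 * g' * h); [exact: HM | rewrite !mulrA divrr ?mul1r].
split=> -[HG fin]; split=> //.
  have [n /card_set_bijP [f [fS finj _]]] := fin.
  exists n, (fun g => f (cs g)); split=> [g Gg|g g' Gg Gg' E].
    by apply: (fS (cs g)); exists g.
  have csgg : cs g = cs g' by apply: finj => //; apply: mem_set; [exists g | exists g'].
  have : cs g' g' by exists 1; rewrite ?mulr1.
  by rewrite -csgg => -[h Hh <-]; rewrite mulKr ?(psl_unit PG Gg).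
have [n [c [cn cH]]] := fin.
pose rep i := xget 1 [set g | G g /\ c g = i].
apply: (@sub_finite_set _ _ ((fun i => cs (rep i)) @` `I_n)); last first.
  by apply: finite_image; exact: finite_II.
move=> _ [g Gg <-]; exists (c g); first exact: cn.
rewrite /rep; case: xgetP => [g' _ [Gg' cg']|]; last by move=> /(_ g) []; split.
exact: (csE _ _ Gg' (cH _ _ Gg' Gg cg')).
Qed.

Lemma fin_index_refl G : psl_subgroup G -> fin_index G G.
Proof.
move=> [_ _ GM GV]; split=> //; exists 1%N, (fun=> 0%N); split=> // g g' Gg Gg' _.
by apply: GM => //; exact: GV.
Qed.

Lemma fin_indexI H G L : psl_subgroup L -> fin_index H G -> fin_index (H `&` L) (G `&` L).
Proof.
move=> [_ _ LM LV] [HG [n [c [cn cH]]]]; split; first by move=> g [/HG].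
exists n, c; split; first by move=> g [/cn].
move=> g g' [Gg Lg] [Gg' Lg'] E; split; first exact: cH.
by apply: LM => //; exact: LV.
Qed.

Lemma fin_index_sup H L G : fin_index H G -> H `<=` L -> L `<=` G -> fin_index L G.
Proof.
move=> [_ [n [c [cn cH]]]] HL LG; split=> //; exists n, c; split=> // g g' Gg Gg' E.
by apply: HL; exact: cH.
Qed.

Lemma fin_index_trans H G L : psl_subgroup L -> fin_index H G -> fin_index G L -> fin_index H L.
Proof.
move=> PL [HG [n [c [cn cH]]]] [GL [m [d [dm dG]]]].
split; first by move=> g /HG/GL.
pose rep i := xget 1 [set g | L g /\ d g = i].
have repP g : L g -> L (rep (d g)) /\ d (rep (d g)) = d g.
  move=> Lg; rewrite /rep; case: xgetP => [g' _ //|]; by move=> /(_ g) [].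
(* A pair of colours coded as one number: that of g in L, and that in G of g divided by the chosen
   representative of its first colour. *)
exists (m * n)%N, (fun g => (d g * n + c ((rep (d g))^-1 * g)%R)%N); split.
  move=> g Lg; have [Lr dr] := repP _ Lg.
  have cl := cn _ (dG _ _ Lr Lg dr).
  have dl := dm _ Lg.
  by apply: (@leq_trans ((d g).+1 * n)); [rewrite mulSn addnC ltn_add2r | rewrite leq_mul2r dl orbT].
move=> g g' Lg Lg' E; have [Lr dr] := repP _ Lg; have [Lr' dr'] := repP _ Lg'.
have cl := cn _ (dG _ _ Lr Lg dr); have cl' := cn _ (dG _ _ Lr' Lg' dr').
have dd : d g = d g'.
  by have := congr1 (fun k => k %/ n)%N E; rewrite !divnMDl ?(leq_ltn_trans _ cl) // !divn_small // !addn0.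
have cc : c ((rep (d g))^-1 * g) = c ((rep (d g))^-1 * g').
  by move: E; rewrite dd => /addnI.
have := cH _ _ (dG _ _ Lr Lg dr) (dG _ _ Lr Lg' _) cc; rewrite dd.
move=> /(_ dr'); rewrite -dd.
have Ur := psl_unit PL Lr; have Ug := psl_unit PL Lg.
by rewrite invrM ?unitrV // invrK -mulrA (mulrA (rep _)) divrr // mul1r.
Qed.

Lemma conjV_K C G : C \is a GRing.unit -> conjugate C^-1 (conjugate C G) = G.
Proof.
move=> UC; apply/seteqP; split=> k.
  by case=> _ [h Th <-] <-; rewrite invrK !mulrA mulVr // mul1r -mulrA mulVr // mulr1.
move=> Tk; exists (C * k * C^-1); first by exists k.
by rewrite invrK !mulrA mulVr // mul1r -mulrA mulVr // mulr1.
Qed.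

Lemma conj_conj C D G : C \is a GRing.unit -> D \is a GRing.unit ->
  conjugate D (conjugate C G) = conjugate (D * C) G.
Proof.
move=> UC UD; apply/seteqP; split=> k.
  by case=> _ [h Th <-] <-; exists h => //; rewrite invrM // !mulrA.
by case=> h Th <-; exists (C * h * C^-1); [exists h | rewrite invrM // !mulrA].
Qed.

Lemma conjI C G H : C \is a GRing.unit ->
  conjugate C (G `&` H) = conjugate C G `&` conjugate C H.
Proof.
move=> UC; apply/seteqP; split=> k.
  by case=> h [Gh Hh] <-; split; exists h.
case=> -[h Gh <-] [h' Hh' E]; exists h => //; split=> //.
have -> // : h = h'.
by apply: (mulrI UC); apply: (mulIr (etrans (unitrV C) UC)).
Qed.

Lemma conjV C g : C \is a GRing.unit -> g \is a GRing.unit ->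
  (C * g * C^-1)^-1 = C * g^-1 * C^-1.
Proof.
move=> UC Ug; apply: mulmx2_inv; rewrite -!mulrA (mulrA C^-1) mulVr // mul1r.
by rewrite (mulrA g) divrr // mul1r divrr.
Qed.

Lemma conjV_mul C g g' : C \is a GRing.unit -> g \is a GRing.unit ->
  (C * g * C^-1)^-1 * (C * g' * C^-1) = C * (g^-1 * g') * C^-1.
Proof.
by move=> UC Ug; rewrite conjV // conjM.
Qed.

Lemma fin_index_conj C H G : C \is a GRing.unit -> psl_subgroup G ->
  fin_index H G -> fin_index (conjugate C H) (conjugate C G).
Proof.
move=> UC PG [HG [n [c [cn cH]]]]; split; first by move=> _ [h /HG Gh <-]; exists h.
have CK h : C^-1 * (C * h * C^-1) * C = h.
  by rewrite !mulrA mulVr // mul1r -mulrA mulVr // mulr1.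
exists n, (fun g => c (C^-1 * g * C)); split; first by move=> _ [h Gh <-]; rewrite CK; exact: cn.
move=> _ _ [h Gh <-] [h' Gh' <-]; rewrite !CK => E.
rewrite conjV_mul ?(psl_unit PG Gh) //.
by exists (h^-1 * h') => //; exact: cH.
Qed.

Lemma psl_conj C G : C \is a GRing.unit -> psl_subgroup G -> psl_subgroup (conjugate C G).
Proof.
move=> UC PG; have [[G1 GN] Gd GM GV] := PG; split.
- split; first by exists 1; rewrite // mulr1 divrr.
  by exists (- 1); rewrite // mulrN mulNr mulr1 divrr.
- by move=> _ [h Gh <-]; rewrite det_conj //; exact: Gd.
- by move=> _ _ [h Gh <-] [h' Gh' <-]; exists (h * h'); rewrite ?conjM //; exact: GM.
- move=> _ [h Gh <-]; exists h^-1; first exact: GV.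
  by rewrite conjV // (psl_unit PG Gh).
Qed.

Lemma psl_I G H : psl_subgroup G -> psl_subgroup H -> psl_subgroup (G `&` H).
Proof.
move=> [[G1 GN] Gd GM GV] [[H1 HN] Hd HM HV]; split=> //.
- by move=> g [/Gd].
- by move=> g h [? ?] [? ?]; split; [exact: GM | exact: HM].
- by move=> g [? ?]; split; [exact: GV | exact: HV].
Qed.

Lemma commensurableP G H : psl_subgroup G -> psl_subgroup H ->
  commensurable G H <-> exists C, [/\ detpm1 C,
    fin_index (conjugate C G `&` H) (conjugate C G) & fin_index (conjugate C G `&` H) H].
Proof.
move=> PG PH; split=> -[C [dC F1 F2]]; exists C; have UC := detpm1_unit dC;
  have PC := psl_conj UC PG; split=> //.
- by apply/finite_indexP => //; exact: psl_I.
- by apply/finite_indexP => //; exact: psl_I.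
- by apply/finite_indexP => //; exact: psl_I.
- by apply/finite_indexP => //; exact: psl_I.
Qed.

Lemma commensurable_sym G H : psl_subgroup G -> psl_subgroup H ->
  commensurable G H -> commensurable H G.
Proof.
move=> PG PH /(commensurableP PG PH) [C [dC F1 F2]]; apply/commensurableP => //.
have UC := detpm1_unit dC; have UV : C^-1 \is a GRing.unit by rewrite unitrV.
exists C^-1; rewrite setIC; split; first exact: detpm1V.
  have := fin_index_conj UV PH F2.
  by rewrite conjI // conjV_K.
have := fin_index_conj UV (psl_conj UC PG) F1.
by rewrite conjI // conjV_K.
Qed.

(** After conjugation the triple intersection of the three groups already has finite index in the
    two outer ones. *)
Lemma commensurable_trans G H L : psl_subgroup G -> psl_subgroup H -> psl_subgroup L ->
  commensurable G H -> commensurable H L -> commensurable G L.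
Proof.
move=> PG PH PL /(commensurableP PG PH) [C [dC F1 F2]] /(commensurableP PH PL) [D [dD E1 E2]].
have [UC UD] := (detpm1_unit dC, detpm1_unit dD).
apply/commensurableP => //; exists (D * C); rewrite -conj_conj //.
set A := conjugate D (conjugate C G); set B := conjugate D H in E1 E2 *.
have PA : psl_subgroup A by apply: psl_conj => //; exact: psl_conj.
have PB : psl_subgroup B by exact: psl_conj.
have AB1 : fin_index (A `&` B) A.
  by have := fin_index_conj UD (psl_conj UC PG) F1; rewrite conjI.
have AB2 : fin_index (A `&` B) B.
  by have := fin_index_conj UD PH F2; rewrite conjI.
split; first exact: detpm1M.
- have H1 := fin_indexI PA E1; have H2 : fin_index (B `&` A `&` L) (B `&` A).
    by rewrite (_ : B `&` A `&` L = B `&` L `&` A) // setIAC.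
  have H3 : fin_index (B `&` A `&` L) A.
    by apply: fin_index_trans H2 _ => //; rewrite setIC.
  by apply: fin_index_sup H3 _ _; move=> g [] // [].
- have H1 := fin_indexI PL AB2; have H2 : fin_index (A `&` B `&` L) L.
    by apply: fin_index_trans H1 _.
  by apply: fin_index_sup H2 _ _; move=> g [] // [].
Qed.

Lemma commensurable_conj C G H : psl_subgroup G -> detpm1 C -> conjugate C G = H ->
  commensurable G H.
Proof.
move=> PG dC <-; have UC := detpm1_unit dC; have PC := psl_conj UC PG.
by apply/commensurableP => //; exists C; rewrite setIid; split=> //; exact: fin_index_refl.
Qed.

Lemma gam_psl a b : psl_subgroup (gam a b : set 'M[R]_2).
Proof.
split.
- by split; [|apply: gen2_N]; apply: gen2_1.
- by move=> g /gam_det ->; left.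
- by move=> g h; exact: gen2M.
- by move=> g Gg; rewrite adj2_inv ?(gam_det Gg) //; exact: gen2_adj.
Qed.

Lemma commensurable_sub H G : psl_subgroup G -> psl_subgroup H -> fin_index H G ->
  commensurable H G.
Proof.
move=> PG PH HG; apply/commensurableP => //; exists 1.
have -> : conjugate 1 H = H.
  apply/seteqP; split=> g; first by case=> h Hh <-; rewrite invr1 mulr1 mul1r.
  by move=> Hg; exists g; rewrite // invr1 mulr1 mul1r.
have -> : H `&` G = H by apply/setIidPl; case: HG.
by split=> //; [left; rewrite det1 | exact: fin_index_refl].
Qed.

Lemma index2 H G s : psl_subgroup H -> H `<=` G -> s \is a GRing.unit ->
  (forall g, G g -> H g \/ H (s * g)) -> fin_index H G.
Proof.
move=> PH HG Us cov; have [_ _ HM HV] := PH; split=> //.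
exists 2%N, (fun g => if `[< H g >] then 0%N else 1%N); split; first by move=> g _; case: ifP.
move=> g g' Gg Gg'; case: asboolP => Hg; case: asboolP => Hg' // _.
  by apply: HM => //; exact: HV.
have [//|Sg] := cov g Gg; have [//|Sg'] := cov g' Gg'.
have Usg := psl_unit PH Sg.
have Ug : g \is a GRing.unit by rewrite -(unitrMr g Us).
have -> : g^-1 * g' = (s * g)^-1 * (s * g').
  by rewrite invrM // -mulrA mulKr.
by apply: HM => //; exact: HV.
Qed.

Local Notation s := (xm (0 : R)).

Lemma xm0_sq : s * s = - 1.
Proof. by rewrite mulmx2 onemx2 oppmx2; congr mx2; ring. Qed.

Lemma adj_xm0 : adj2 s = - s.
Proof. by rewrite adj2E oppmx2; congr mx2; ring. Qed.

Lemma xm0_unit : s \is a GRing.unit.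
Proof. by rewrite mx2_unit det_xm oner_neq0. Qed.

Lemma xm0_cancel g h : s * (g * h) = - (s * g * s) * (s * h).
Proof.
by rewrite mulNr -!mulrA [s * (s * h)]mulrA xm0_sq mulN1r !mulrN opprK.
Qed.

(* Delta(m, m, oo) has index 2 in Delta(2, m, oo). *)
Lemma index2_mm b : commensurable (gam b b : set 'M[R]_2) (gam 0 b).
Proof.
apply: commensurable_sub; [exact: gam_psl | exact: gam_psl |].
have E1 : - (s * ym b * s) = xm b.
  by rewrite !mulmx2 oppmx2; congr mx2; ring.
have E2 : - (s * adj2 (ym b) * s) = adj2 (xm b).
  by rewrite !adj2E !mulmx2 oppmx2; congr mx2; ring.
apply: (@index2 _ _ s); [exact: gam_psl | | exact: xm0_unit |].
- move=> g; apply: gen2_sub; last exact: gen2Y.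
  rewrite -E1; apply: gen2_N; apply: gen2M; last exact: gen2X.
  by apply: gen2M; [exact: gen2X | exact: gen2Y].
- move=> g; elim=> [|k _ IH|k _ IH|k _ IH|k _ IH|k _ IH].
  + by left; exact: gen2_1.
  + by case: IH => IH; [left | right; rewrite mulrN]; exact: gen2_N.
  + case: IH => IH; last by left.
    by right; rewrite mulrA xm0_sq mulN1r; exact: gen2_N.
  + rewrite adj_xm0; case: IH => IH; last by left; rewrite mulNr; exact: gen2_N.
    by right; rewrite mulNr mulrN mulrA xm0_sq mulN1r opprK.
  + case: IH => IH; [left | right]; first exact: gen2_Y.
    by rewrite xm0_cancel E1; exact: gen2_X.
  + case: IH => IH; [left | right]; first exact: gen2_Yi.
    by rewrite xm0_cancel E2; exact: gen2_Xi.
Qed.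

Lemma gen2_conj C (X Y : 'M[R]_2) : C \is a GRing.unit -> \det X = 1 -> \det Y = 1 ->
  conjugate C (gen2 X Y) = gen2 (C * X * C^-1) (C * Y * C^-1).
Proof.
have sub D X' Y' g : D \is a GRing.unit -> \det X' = 1 -> \det Y' = 1 -> gen2 X' Y' g ->
    gen2 (D * X' * D^-1) (D * Y' * D^-1) (D * g * D^-1).
  move=> UD dX dY; have adjJ Z : \det Z = 1 -> D * adj2 Z * D^-1 = adj2 (D * Z * D^-1).
    move=> dZ; rewrite -!adj2_inv ?det_conj //.
    have UZ : Z \is a GRing.unit by rewrite mx2_unit dZ oner_neq0.
    by rewrite conjV.
  elim=> [|k _ IH|k _ IH|k _ IH|k _ IH|k _ IH].
  - by rewrite mulr1 divrr //; exact: gen2_1.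
  - by rewrite mulrN mulNr; exact: gen2_N.
  - by rewrite conjM //; exact: gen2_X.
  - by rewrite conjM // adjJ //; exact: gen2_Xi.
  - by rewrite conjM //; exact: gen2_Y.
  - by rewrite conjM // adjJ //; exact: gen2_Yi.
move=> UC dX dY; apply/seteqP; split; first by move=> _ [g Gg <-]; exact: sub.
have CK h : C^-1 * (C * h * C^-1) * C = h.
  by rewrite !mulrA mulVr // mul1r -mulrA mulVr // mulr1.
move=> g Gg; exists (C^-1 * g * C); last first.
  by rewrite !mulrA divrr // mul1r -mulrA divrr // mulr1.
have UV : C^-1 \is a GRing.unit by rewrite unitrV.
have := sub _ _ _ _ UV (etrans (det_conj X UC) dX) (etrans (det_conj Y UC) dY) Gg.
by rewrite invrK !CK.
Qed.

(* Delta(k, oo, oo) has index 2 in Delta(2, 2 k, oo), since 2 cos (pi / k) = b^2 - 2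
   for b = 2 cos (pi / 2 k). *)
Lemma index2_koo b : 0 < b ->
  commensurable (gam (b ^+ 2 - 2) 2 : set 'M[R]_2) (gam 0 b).
Proof.
move=> b0; pose T := tm b; pose L : 'M[R]_2 := mx2 1 0 (- b) 1.
(* The subgroup of index 2 in [gam 0 b]: conjugation by the involution s sends T to L, so s
   normalises it. *)
pose H : set 'M[R]_2 := gen2 T L.
have dT : \det T = 1 by rewrite det_mx2; ring.
have dL : \det L = 1 by rewrite det_mx2; ring.
have PH : psl_subgroup H.
  split.
  - by split; [|apply: gen2_N]; apply: gen2_1.
  - by move=> g /(gen2_det dT dL) ->; left.
  - by move=> g h; exact: gen2M.
  - by move=> g Gg; rewrite adj2_inv ?(gen2_det dT dL Gg) //; exact: gen2_adj.
set c := Num.sqrt b; have c2 : c ^+ 2 = b by rewrite sqr_sqrtr // ltW.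
have c0 : c != 0 by rewrite gt_eqF // sqrtr_gt0.
(* C is z |-> b z + 1; it conjugates T to the translation by b^2 and L to [ym 2]. *)
pose C : 'M[R]_2 := mx2 c c^-1 0 c^-1.
have dC : detpm1 C by left; rewrite det_mx2; field.
have UC := detpm1_unit dC.
have Cinv : C^-1 = mx2 c^-1 (- c^-1) 0 c.
  by apply: mulmx2_inv; rewrite mulmx2 onemx2; congr mx2; field.
have CT : C * T * C^-1 = tm (b ^+ 2 - 2 + 2).
  by rewrite Cinv !mulmx2 -c2; congr mx2; field.
have CL : C * L * C^-1 = ym 2.
  by rewrite Cinv !mulmx2 -c2; congr mx2; field.
have CH : conjugate C H = gam (b ^+ 2 - 2) 2.
  rewrite gen2_conj // CT CL; apply/seteqP; split=> g; apply: gen2_sub.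
  - exact: gam_tm.
  - exact: gen2Y.
  - have -> : xm (b ^+ 2 - 2) = - (adj2 (tm (b ^+ 2 - 2 + 2)) * adj2 (ym 2)).
      by rewrite -mulNr -xym -mulrA mul_adj2 ?det_ym // mulr1.
    by apply: gen2_N; apply: gen2M; apply: gen2_adj; [exact: gen2X | exact: gen2Y].
  - exact: gen2Y.
apply: (commensurable_trans _ PH); [exact: gam_psl | exact: gam_psl | |].
  by apply: commensurable_sym; [exact: PH | exact: gam_psl | exact: commensurable_conj dC CH].
have E1 : - (s * T * s) = L by rewrite !mulmx2 oppmx2; congr mx2; ring.
have E2 : - (s * adj2 T * s) = adj2 L by rewrite !adj2E !mulmx2 oppmx2; congr mx2; ring.
have yE : ym b = s * adj2 T by rewrite adj2E mulmx2; congr mx2; ring.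
have yiE : adj2 (ym b) = - (T * s) by rewrite adj2E mulmx2 oppmx2; congr mx2; ring.
have HT : gam 0 b T by have := @gam_tm _ (0 : R) b; rewrite add0r.
apply: commensurable_sub; [exact: gam_psl | exact: PH |].
apply: (@index2 _ _ s); [exact: PH | | exact: xm0_unit |].
- move=> g; apply: gen2_sub; first exact: HT.
  rewrite -E1; apply: gen2_N; apply: gen2M; last exact: gen2X.
  by apply: gen2M; [exact: gen2X | exact: HT].
- move=> g; elim=> [|k _ IH|k _ IH|k _ IH|k _ IH|k _ IH].
  + by left; exact: gen2_1.
  + by case: IH => IH; [left | right; rewrite mulrN]; exact: gen2_N.
  + case: IH => IH; last by left.
    by right; rewrite mulrA xm0_sq mulN1r; exact: gen2_N.
  + rewrite adj_xm0; case: IH => IH; last by left; rewrite mulNr; exact: gen2_N.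
    by right; rewrite mulNr mulrN mulrA xm0_sq mulN1r opprK.
  + rewrite yE -mulrA; case: IH => IH.
      by right; rewrite !mulrA xm0_sq mulN1r mulNr; apply: gen2_N; exact: gen2_Xi.
    by left; rewrite xm0_cancel E2; exact: gen2_Yi.
  + rewrite yiE mulNr -mulrA; case: IH => IH.
      right; rewrite mulrN xm0_cancel E1; apply: gen2_N; apply: gen2_Y.
      by rewrite mulrA xm0_sq mulN1r; exact: gen2_N.
    by left; apply: gen2_N; exact: gen2_X.
Qed.

End Commensurability.

(** * Cusps carried by a commensurator *)

Section CuspMatching.
Variables (R : realType) (a1 b1 a2 b2 : R) (C : 'M[R]_2).
Local Notation G1 := (gam a1 b1 : set 'M[R]_2).
Local Notation G2 := (gam a2 b2 : set 'M[R]_2).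
Local Notation t1 := (a1 + b1).
Local Notation t2 := (a2 + b2).
Hypotheses (t1_neq0 : t1 != 0) (t2_neq0 : t2 != 0) (dC : detpm1 C).
Hypothesis parabolic2 : forall g, G2 g -> \tr g ^+ 2 = 4 -> Tconj a2 b2 g.
Hypothesis fin1 : fin_index (conjugate C G1 `&` G2) (conjugate C G1).

Lemma gam_pow_tm n : G1 (tm (t1 *+ n)).
Proof. by rewrite -tmX; apply/gen2_X_ind/gam_tm. Qed.

(** Among the powers 0, ..., n of the translation conjugated by C g, two have the same colour, and
    their quotient lies in the second group. *)
Lemma common_parabolic g : G1 g ->
  exists n, (0 < n)%N /\ G2 (C * g * tm (t1 *+ n) * (C * g)^-1).
Proof.
move=> Gg; have [_ [n [c [cn cH]]]] := fin1.
have UC := detpm1_unit dC.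
have Ug : g \is a GRing.unit by rewrite mx2_unit (gam_det Gg) oner_neq0.
have UP : C * g \is a GRing.unit by rewrite unitrMr.
pose f k := C * g * tm (t1 *+ k) * (C * g)^-1.
have Gf k : conjugate C G1 (f k).
  exists (g * tm (t1 *+ k) * g^-1); last by rewrite /f invrM // !mulrA.
  apply: gen2M; first by apply: gen2M => //; exact: gam_pow_tm.
  by rewrite adj2_inv ?(gam_det Gg) //; exact: gen2_adj.
have [i [j [ij E]]] : exists i j : nat, (i < j)%N /\ c (f i) = c (f j).
  pose col (i : 'I_n.+1) : 'I_n := Ordinal (cn _ (Gf i)).
  have /injectivePn[i [j ij E]] : ~~ injectiveb col.
    by apply/injectiveP => /leq_card; rewrite !card_ord ltnn.
  have E' : c (f i) = c (f j) by move/(congr1 val): E.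
  by case: (ltngtP i j) => lt; [exists i, j | exists j, i | case/eqP: ij; exact: val_inj].
exists (j - i)%N; split; first by rewrite subn_gt0.
have [_] := cH _ _ (Gf i) (Gf j) E; rewrite /f conjV_mul //; last first.
  by rewrite mx2_unit det_mx2 mul1r mulr0 subr0 oner_neq0.
suff -> : (tm (t1 *+ i))^-1 * tm (t1 *+ j) = tm (t1 *+ (j - i)) by [].
rewrite adj2_inv ?adj2_tm; last by rewrite det_mx2 mul1r mulr0 subr0.
by rewrite tmM mulrnBr ?(ltnW ij) // [- _ + _]addrC.
Qed.

Lemma carried_cusp g : G1 g -> exists d lam mu nu (q : rat),
  [/\ G2 d, adj2 d * C * g = mx2 lam mu 0 nu, (lam * nu) ^+ 2 = 1, q != 0 &
      lam ^+ 2 * t1 = ratr q * t2].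
Proof.
move=> Gg; have [n [n0 G2h]] := common_parabolic Gg.
have Ug : g \is a GRing.unit by rewrite mx2_unit (gam_det Gg) oner_neq0.
have UC := detpm1_unit dC.
have UP : C * g \is a GRing.unit by rewrite unitrMr.
pose s := t1 *+ n; rewrite -/s in G2h.
set h := C * g * _ * _ in G2h.
have trh : \tr h ^+ 2 = 4 by rewrite /h tr_conj // tr_mx2; ring.
have [d [Gd [k hE]]] := parabolic2 G2h trh; have dd := gam_det Gd.
pose M := adj2 d * C * g.
have s0 : s != 0 by rewrite /s mulrn_eq0 negb_or -lt0n n0.
have ME : M * tm s = adj2 d * h * (C * g).
  by rewrite /h /M -!mulrA mulVr // mulr1.
have ME' : pm (M * tm s) (tm (t2 *~ k) * M).
  have E X : adj2 d * (d * X * adj2 d) * (C * g) = X * M.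
    by rewrite /M !mulrA adj2_mul // mul1r.
  by rewrite ME; case: hE => ->; [left | right]; rewrite ?mulrN ?mulNr E.
have dM : \det M ^+ 2 = 1.
  rewrite !detM2 (gam_det Gg) (gam_det (gen2_adj Gd)) mul1r mulr1.
  by case: dC => ->; ring.
exists d; rewrite -/M; move: M dM ME' {ME} => M.
elim/mx2_ind: M => lam mu x nu; rewrite det_mx2 => D [] E.
  move: E; rewrite !mulmx2 => E; have [] := mx2_inj E.
  rewrite !(mulr0, mulr1, mul0r, mul1r, add0r, addr0) => E1 E2 E3 E4.
  have x0 : x = 0.
    apply/eqP; have /eqP : x * s = 0 by apply: (addIr nu); rewrite E4 add0r.
    by rewrite mulf_eq0 (negPf s0) orbF.
  move: D E2 {E1 E3 E4}; rewrite x0 mulr0 subr0 => D E2.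
  have l0 : lam != 0 by apply/eqP => l0; move: D; rewrite l0 !mul0r expr0n => /eqP; rewrite eq_sym oner_eq0.
  have {}E2 : lam * s = t2 *~ k * nu by lra.
  have [e [e1 eD]] : exists e : rat, e ^+ 2 = 1 /\ lam * nu = ratr e.
    have /eqP := D; rewrite sqrf_eq1 => /orP[] /eqP ->; [exists 1 | exists (- 1)].
      by rewrite rmorph1 expr1n.
    by rewrite rmorphN rmorph1 sqrrN expr1n.
  have n0' : n%:R != 0 :> R by rewrite pnatr_eq0 -lt0n.
  have H : lam ^+ 2 * t1 = ratr (k%:~R * e / n%:R) * t2.
    apply: (mulIf n0'); rewrite rmorphM fmorphV rmorph_nat rmorphM rmorph_int /=.
    have -> : lam ^+ 2 * t1 * n%:R = lam * (lam * s) by rewrite /s -mulr_natr; ring.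
    rewrite E2 -eD -mulrzl; field; done.
  exists lam, mu, nu, (k%:~R * e / n%:R); split=> //.
  apply/eqP => q0; move: H; rewrite q0 rmorph0 mul0r => /eqP.
  by rewrite mulf_eq0 expf_eq0 /= (negPf l0) (negPf t1_neq0).
(* The minus sign is impossible, as the first column of M would vanish. *)
move: E; rewrite !mulmx2 oppmx2 => E; have [] := mx2_inj E.
rewrite !(mulr0, mulr1, mul0r, mul1r, add0r, addr0) => E1 E2 E3 E4.
have x0 : x = 0 by lra.
have l0 : lam = 0 by move: E1; rewrite x0; lra.
by move: D; rewrite x0 l0 mul0r mulr0 subrr expr0n => /eqP; rewrite eq_sym oner_eq0.
Qed.

(* The cusps of a group are the quotients g 0 0 / g 1 0, so the commensurator C
   acts on cusps as z |-> k z + mu once it has been made to fix oo. *)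
Lemma cusp_match : exists (k mu : R) (q0 : rat), [/\ k * t1 = ratr q0 * t2, q0 != 0 &
  forall g, G1 g -> exists d (q : rat), [/\ G2 d, q != 0,
    t1 ^+ 2 * g 1 0 ^+ 2 = ratr q * (t2 ^+ 2 * d 1 0 ^+ 2) &
    g 1 0 != 0 -> d 1 0 != 0 /\ d 0 0 / d 1 0 = k * (g 0 0 / g 1 0) + mu]].
Proof.
have [d0 [l0 [m0 [n0 [q0 [Gd0 E0 ln0 q00 lq0]]]]]] := carried_cusp (gen2_1 _ _).
have n0_neq0 : n0 != 0 by apply/eqP => z; move: ln0; rewrite z mulr0 expr0n => /eqP; rewrite eq_sym oner_eq0.
have l0_neq0 : l0 != 0 by apply/eqP => z; move: ln0; rewrite z mul0r expr0n => /eqP; rewrite eq_sym oner_eq0.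
have [e [e1 eD]] : exists e : rat, e ^+ 2 = 1 /\ l0 * n0 = ratr e.
  have /eqP := ln0; rewrite sqrf_eq1 => /orP[] /eqP ->; [exists 1 | exists (- 1)].
    by rewrite rmorph1 expr1n.
  by rewrite rmorphN rmorph1 sqrrN expr1n.
have e0 : e != 0 by apply/eqP => z; move: e1; rewrite z expr0n => /eqP; rewrite eq_sym oner_eq0.
exists (l0 / n0), (m0 / n0), (q0 * e); split; last 2 first.
- by rewrite mulf_neq0.
- move=> g Gg; have [d [l [m [n [q [Gd E ln qn lq]]]]]] := carried_cusp Gg.
  (* C is eliminated between the triangular forms belonging to g and to 1; the first column of this
     equation yields both assertions. *)
  have DE : (adj2 d0 * d) * mx2 l m 0 n = mx2 l0 m0 0 n0 * g.
    by rewrite -E -E0 mulr1 !mulrA -[adj2 d0 * d * adj2 d]mulrA mul_adj2 ?(gam_det Gd) // mulr1.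
  exists (adj2 d0 * d), (q0 * q); split; [by apply: gen2M => //; exact: gen2_adj | by rewrite mulf_neq0 | |].
  + move: DE; move: (adj2 d0 * d) => D; elim/mx2_ind: D => p u r v.
    elim/mx2_ind: g {Gg E} => g1 g2 g3 g4; rewrite !mulmx2 !mx2E.
    move=> E; have [E1 _ E3 _] := mx2_inj E.
    have rl : r * l = n0 * g3 by lra.
    have -> : ratr (q0 * q) * (t2 ^+ 2 * r ^+ 2) = (ratr q0 * t2) * (ratr q * t2) * r ^+ 2.
      by rewrite rmorphM /=; ring.
    rewrite -lq0 -lq.
    have -> : l0 ^+ 2 * t1 * (l ^+ 2 * t1) * r ^+ 2 = l0 ^+ 2 * t1 ^+ 2 * (r * l) ^+ 2 by ring.
    by rewrite rl; transitivity ((l0 * n0) ^+ 2 * (t1 ^+ 2 * g3 ^+ 2)); [rewrite ln0 mul1r | ring].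
  + move: DE; move: (adj2 d0 * d) => D; elim/mx2_ind: D => p u r v.
    elim/mx2_ind: g {Gg E} => g1 g2 g3 g4; rewrite !mulmx2 !mx2E.
    move=> E g30; have [E1 _ E3 _] := mx2_inj E.
    have rl : r * l = n0 * g3 by lra.
    have r0 : r != 0.
      by apply/eqP => r0; move: rl; rewrite r0 mul0r => /esym/eqP; rewrite mulf_eq0 (negPf g30) (negPf n0_neq0).
    have l_neq0 : l != 0.
      by apply/eqP => z; move: rl; rewrite z mulr0 => /esym/eqP; rewrite mulf_eq0 (negPf g30) (negPf n0_neq0).
    split=> //; apply: (mulIf l_neq0).
    have -> : p / r * l = p * l / r by ring.
    have -> : p * l = l0 * g1 + m0 * g3 by lra.
    have -> : g3 = r * l / n0 by rewrite rl; field.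
    by field; rewrite r0 l_neq0 n0_neq0.
- have -> : l0 / n0 * t1 = l0 ^+ 2 * t1 * (l0 * n0) / (l0 * n0) ^+ 2 by field; rewrite l0_neq0 n0_neq0.
  by rewrite ln0 divr1 lq0 eD rmorphM /=; ring.
Qed.

End CuspMatching.

(** * Parity of the entries over a ring *)

Section GradedEntries.
Variables (A : comNzRingType) (K : A -> Prop) (a b kap : A).
Hypotheses (K1 : K 1) (KB : forall x y, K x -> K y -> K (x - y))
  (KM : forall x y, K x -> K y -> K (x * y)) (Kbb : K (b ^+ 2)) (Kkap : K kap)
  (aE : a = b * kap).

(** The parity of [typ1] and [typ2], in a form that makes sense when b is not invertible, as may
    happen in [R * R]. *)
Definition grade (e : bool) x := if e then exists2 y, K y & x = b * y else K x.

Lemma gradeB e x y : grade e x -> grade e y -> grade e (x - y).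
Proof.
case: e => /= [[x' Kx ->] [y' Ky ->]|]; last exact: KB.
by exists (x' - y'); [exact: KB | ring].
Qed.

Lemma grade0 e : grade e 0.
Proof.
have K0 : K 0 by rewrite -(subrr 1); exact: KB.
by case: e => //=; exists 0; rewrite ?mulr0.
Qed.

Lemma gradeN e x : grade e x -> grade e (- x).
Proof. by move=> Hx; rewrite -sub0r; apply: gradeB => //; exact: grade0. Qed.

Lemma gradeD e x y : grade e x -> grade e y -> grade e (x + y).
Proof. by move=> Hx Hy; rewrite -[y]opprK; apply: gradeB => //; exact: gradeN. Qed.

Lemma gradeM e f x y : grade e x -> grade f y -> grade (e (+) f) (x * y).
Proof.
case: e; case: f => /=.
- move=> [x' Kx ->] [y' Ky ->].
  have -> : b * x' * (b * y') = b ^+ 2 * (x' * y') by ring.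
  by apply: KM => //; exact: KM.
- by move=> [x' Kx ->] Ky; exists (x' * y); [exact: KM | ring].
- by move=> Kx [y' Ky ->]; exists (x * y'); [exact: KM | ring].
- exact: KM.
Qed.

Lemma gam_graded g : gam a b g -> exists e,
  [/\ grade e (g 0 0), grade (~~ e) (g 0 1), grade (~~ e) (g 1 0) & grade e (g 1 1)].
Proof.
have step z : (exists z1 z2 z3 z4, z = mx2 z1 z2 z3 z4 /\
    [/\ grade true z1, K z2, K z3 & grade true z4]) -> forall g : 'M[A]_2, (exists e,
  [/\ grade e (g 0 0), grade (~~ e) (g 0 1), grade (~~ e) (g 1 0) & grade e (g 1 1)]) ->
  exists e, [/\ grade e ((z * g) 0 0), grade (~~ e) ((z * g) 0 1),
    grade (~~ e) ((z * g) 1 0) & grade e ((z * g) 1 1)].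
  move=> [z1 [z2 [z3 [z4 [-> [Z1 Z2 Z3 Z4]]]]]] k; elim/mx2_ind: k => g1 g2 g3 g4.
  rewrite !mx2E => -[e [h1 h2 h3 h4]].
  have F x y f : K x -> grade f y -> grade f (x * y) by move=> Kx; exact: (@gradeM false).
  exists (~~ e); rewrite mulmx2 !mx2E negbK; split; apply: gradeD.
  - exact: (gradeM Z1 h1).
  - exact: F.
  - by have := gradeM Z1 h2; rewrite /= negbK.
  - exact: F.
  - exact: F.
  - by have := gradeM Z4 h3; rewrite /= negbK.
  - exact: F.
  - exact: (gradeM Z4 h4).
have K0 : K 0 := grade0 false.
have KN1 : K (- 1) := @gradeN false _ K1.
have B0 : grade true 0 := grade0 true.
have Bb : grade true b by exists 1; rewrite ?mulr1.
have Ba : grade true a by exists kap.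
elim=> [|k _ [e [h1 h2 h3 h4]]|k _ IH|k _ IH|k _ IH|k _ IH].
- by exists false; rewrite onemx2 !mx2E; split=> //; exact: grade0.
- by exists e; rewrite !mxE; split; exact: gradeN.
- by apply: step IH; exists a, 1, (- 1), 0.
- apply: step IH; exists 0, (- 1), 1, a; split=> //.
  by rewrite adj2E opprK.
- by apply: step IH; exists 0, 1, (- 1), b.
- apply: step IH; exists b, (- 1), 1, 0; split=> //.
  by rewrite adj2E opprK.
Qed.

Lemma gam_lower_left_sq g : gam a b g -> K (g 1 0 ^+ 2).
Proof.
move=> /gam_graded [e [_ _ H _]].
by have := gradeM H H; rewrite addbb.
Qed.

End GradedEntries.

(** * Entries together with their Galois conjugates *)

Section ConjugatePairs.
Variable R : realType.
Implicit Types (x y z : R * R) (d : nat).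
Local Notation s d := (Num.sqrt d%:R : R).

(* The images of Q(sqrt d) in R x R under its two embeddings. *)
Definition conj_field d z :=
  exists u v : rat, z = (ratr u + ratr v * s d, ratr u - ratr v * s d).

Lemma conj_fieldB d x y : conj_field d x -> conj_field d y -> conj_field d (x - y).
Proof.
move=> [u [v ->]] [u' [v' ->]]; exists (u - u'), (v - v'); rewrite !rmorphB /=.
by congr (_, _); rewrite /=; ring.
Qed.

Lemma conj_fieldM d x y : conj_field d x -> conj_field d y -> conj_field d (x * y).
Proof.
have ss := sqE R d; rewrite expr2 in ss.
move=> [u [v ->]] [u' [v' ->]]; exists (u * u' + v * v' * d%:R), (u * v' + v * u').
rewrite !(rmorphD, rmorphM) /= rmorph_nat; move: (Num.sqrt _) ss => w <-.
by congr (_, _); rewrite /=; ring.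
Qed.

Lemma conj_field_rat d (q : rat) : conj_field d (ratr q, ratr q).
Proof. by exists q, 0; rewrite rmorph0 !mul0r addr0 subr0. Qed.

Lemma conj_field1 d : conj_field d 1.
Proof. by have := conj_field_rat d 1; rewrite rmorph1. Qed.

Lemma conj_fieldD d x y : conj_field d x -> conj_field d y -> conj_field d (x + y).
Proof.
move=> [u [v ->]] [u' [v' ->]]; exists (u + u'), (v + v'); rewrite !rmorphD /=.
by congr (_, _); rewrite /=; ring.
Qed.

Lemma conj_field_inj d x y : (forall k, (k * k != d)%N) ->
  conj_field d x -> conj_field d y -> x.1 = y.1 -> x = y.
Proof.
by move=> nsq [u [v ->]] [u' [v' ->]] /= /(qs_inj nsq) [-> ->].
Qed.

(** Closed under sums and products and containing 0 and 1, so that it can serve as the set S of the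
    normal form. *)
Definition dominated z := `|z.2| <= z.1.
Definition strictly_dominated z := `|z.2| < z.1.

Lemma dominatedD x y : dominated x -> dominated y -> dominated (x + y).
Proof.
by rewrite /dominated /= => Hx Hy; apply: le_trans (ler_normD _ _) _; exact: lerD.
Qed.

Lemma dominatedM x y : dominated x -> dominated y -> dominated (x * y).
Proof. by rewrite /dominated /= normrM => Hx Hy; apply: ler_pM. Qed.

Lemma dominated0 : dominated 0.
Proof. by rewrite /dominated /= normr0. Qed.

Lemma dominated1 : dominated 1.
Proof. by rewrite /dominated /= normr1. Qed.

Lemma strictlyW x : strictly_dominated x -> dominated x.
Proof. exact: ltW. Qed.

Lemma strictlyDl x y : strictly_dominated x -> dominated y -> strictly_dominated (x + y).
Proof.
rewrite /dominated /strictly_dominated /= => Hx Hy.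
by apply: le_lt_trans (ler_normD _ _) _; exact: ltr_leD.
Qed.

Lemma strictlyDr x y : dominated x -> strictly_dominated y -> strictly_dominated (x + y).
Proof. by move=> Hx Hy; rewrite addrC; exact: strictlyDl. Qed.

Lemma strictlyMl x y : strictly_dominated x -> dominated y -> 0 < y.1 ->
  strictly_dominated (x * y).
Proof.
rewrite /dominated /strictly_dominated /= normrM => Hx Hy y0.
apply: (@le_lt_trans _ _ (`|x.2| * y.1)); first exact: ler_wpM2l.
by rewrite ltr_pM2r.
Qed.

Lemma strictlyMr x y : dominated x -> strictly_dominated y -> 0 < x.1 ->
  strictly_dominated (x * y).
Proof. by move=> Hx Hy x0; rewrite mulrC; exact: strictlyMl. Qed.

Lemma strictly_gt0 x : strictly_dominated x -> 0 < x.1.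
Proof. exact: le_lt_trans. Qed.

(* These conditions make the lower left entries satisfy |r'| <= |r|, where r' is
   the corresponding entry in the Galois conjugate gam a' b' of gam a b. *)
Record conjugate_data d l m (a b a' b' : R) : Prop := ConjugateData {
  cd_nsq : forall k, (k * k != d)%N;
  cd_a : order_seq dominated (a, a') l;
  cd_b : order_seq dominated (b, b') m;
  cd_bb : conj_field d ((b, b') ^+ 2);
  cd_ab : exists2 kap, conj_field d kap & (a, a') = (b, b') * kap }.

Lemma conjugate_power_sets d l m a b a' b' : conjugate_data d l m a b a' b' ->
  power_sets (a, a') (b, b') dominated (powers (xm (a, a')) l) (powers (ym (b, b')) m).
Proof.
case=> _ Ha Hb _ _; apply: order_power_sets => //.
- exact: dominated0.
- exact: dominated1.
- exact: dominatedD.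
- exact: dominatedM.
Qed.

(** The same word read in the generators over pairs; the second components form the corresponding
    element of the conjugate group. *)
Lemma gam_lift (a b a' b' : R) g : gam a b g ->
  exists2 h : 'M[R * R]_2, gam (a, a') (b, b') h & g = map_mx fst h.
Proof.
have E1 : map_mx fst (xm (a, a')) = xm a by apply: mx2_eq; rewrite !mxE.
have E2 : map_mx fst (ym (b, b')) = ym b by apply: mx2_eq; rewrite !mxE.
have fadj (h : 'M[R * R]_2) : adj2 (map_mx fst h) = map_mx fst (adj2 h).
  by elim/mx2_ind: h => *; apply: mx2_eq; rewrite !mxE.
elim=> [|k _ [h Gh ->]|k _ [h Gh ->]|k _ [h Gh ->]|k _ [h Gh ->]|k _ [h Gh ->]].
- by exists 1; [exact: gen2_1 | rewrite map_mx1].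
- by exists (- h); [exact: gen2_N | rewrite map_mxN].
- by exists (xm (a, a') * h); [exact: gen2_X | rewrite map_mxM -E1].
- by exists (adj2 (xm (a, a')) * h); [exact: gen2_Xi | rewrite map_mxM -E1 fadj].
- by exists (ym (b, b') * h); [exact: gen2_Y | rewrite map_mxM -E2].
- by exists (adj2 (ym (b, b')) * h); [exact: gen2_Yi | rewrite map_mxM -E2 fadj].
Qed.

Definition cusp_matching (a1 b1 a2 b2 : R) :=
  exists (k mu : R) (q0 : rat), [/\ k * (a1 + b1) = ratr q0 * (a2 + b2), q0 != 0 &
  forall g, gam a1 b1 g -> exists h (q : rat), [/\ gam a2 b2 h, q != 0,
    (a1 + b1) ^+ 2 * g 1 0 ^+ 2 = ratr q * ((a2 + b2) ^+ 2 * h 1 0 ^+ 2) &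
    g 1 0 != 0 -> h 1 0 != 0 /\ h 0 0 / h 1 0 = k * (g 0 0 / g 1 0) + mu]].

Lemma commensurable_cusp_matching (a1 b1 a2 b2 : R) : a1 + b1 != 0 -> a2 + b2 != 0 ->
  (forall g, gam a2 b2 g -> \tr g ^+ 2 = 4 -> Tconj a2 b2 g) ->
  commensurable (gam a1 b1 : set 'M[R]_2) (gam a2 b2) -> cusp_matching a1 b1 a2 b2.
Proof.
move=> t1 t2 par /(commensurableP (gam_psl _ _) (gam_psl _ _)) [C [dC F1 _]].
exact: cusp_match par F1.
Qed.

Lemma cusp_matching_field (a1 b1 a2 b2 : R) : b2 != 0 -> cusp_matching a1 b1 a2 b2 ->
  abfield a2 b2 ((a1 + b1) ^+ 2).
Proof.
move=> b20 [k [mu [q0 [_ _ /(_ _ (gen2Y _ _)) [h [q [Gh _ + _]]]]]]].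
rewrite mx2E sqrrN expr1n mulr1 => ->.
have HK := abfield_sub a2 b2; have Kbb := @abfield_bb R a2 b2; have Kab := @abfield_ab R a2 b2.
apply: (subfieldM HK); first exact: subfield_rat.
apply: (subfieldM HK).
  have -> : (a2 + b2) ^+ 2 = a2 ^+ 2 + 2 * (a2 * b2) + b2 ^+ 2 by ring.
  apply: (subfieldD HK) => //; apply: (subfieldD HK); first exact: abfield_aa.
  by apply: (subfieldM HK) => //; exact: subfield_nat.
have [[_ _ T _]|[_ _ T _]] := gam_typ HK b20 Kbb Kab Gh.
  by rewrite expr2; exact: (K_b2 HK b20 Kbb T T).
by rewrite expr2; exact: (subfieldM HK T T).
Qed.

(** Both sides of t1^2 r1^2 = q t2^2 r2^2 lie in Q (sqrt d), so the conjugate equation holds too,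
    and the rational q is eliminated between the two. The hypothesis on g says that r1 = +-1. *)
Lemma matching_conj d l m (a1 b1 a b a' b' T1' : R) :
  conjugate_data d l m a b a' b' -> a1 + b1 != 0 ->
  conj_field d ((a1 + b1) ^+ 2, T1') -> cusp_matching a1 b1 a b ->
  exists (k mu : R) (q0 : rat), [/\ k * (a1 + b1) = ratr q0 * (a + b), q0 != 0 &
  forall g, gam a1 b1 g -> g 1 0 ^+ 2 = 1 -> exists h,
    [/\ gam (a, a') (b, b') h, (h 1 0).1 != 0 /\ `|(h 1 0).2| <= `|(h 1 0).1|,
      T1' * ((a + b) ^+ 2 * (h 1 0).1 ^+ 2) =
         (a1 + b1) ^+ 2 * ((a' + b') ^+ 2 * (h 1 0).2 ^+ 2) &
      (h 0 0).1 / (h 1 0).1 = k * (g 0 0 / g 1 0) + mu]].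
Proof.
move=> CD t1 KT1 [k [mu [q0 [kq q00 H]]]]; exists k, mu, q0; split=> // g Gg g10.
have [f [q [Gf qn E ratio]]] := H g Gg.
have g10' : g 1 0 != 0 by apply/eqP => z; move: g10; rewrite z expr0n => /eqP; rewrite eq_sym oner_eq0.
have [f0 fE] := ratio g10'; rewrite g10 mulr1 in E.
have [h Gh fh] := gam_lift a' b' Gf.
have f10 : f 1 0 = (h 1 0).1 by rewrite fh mxE.
have f00 : f 0 0 = (h 0 0).1 by rewrite fh mxE.
rewrite f10 in E f0; rewrite f10 f00 in fE.
exists h; split=> //.
  split=> //; have [] := gam_lower_left (conjugate_power_sets CD) Gh; rewrite /dominated /=.
    by move=> le; apply: le_trans le (ler_norm _).
  by rewrite normrN => le; apply: le_trans le _; rewrite -normrN; exact: ler_norm.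
have [kap Kk abE] := cd_ab CD.
have Khh : conj_field d (h 1 0 ^+ 2).
  apply: (gam_lower_left_sq (conj_field1 d) _ _ (cd_bb CD) Kk abE Gh).
    by move=> x y; exact: conj_fieldB.
  by move=> x y; exact: conj_fieldM.
have Kt : conj_field d ((a + b, a' + b') ^+ 2).
  have -> : (a + b, a' + b') ^+ 2 = (b, b') ^+ 2 * ((kap + 1) * (kap + 1)).
    have -> : (a + b, a' + b') = (a, a') + (b, b') by [].
    by rewrite abE; ring.
  have K1k : conj_field d (kap + 1) by apply: conj_fieldD => //; exact: conj_field1.
  by apply: conj_fieldM; [exact: cd_bb CD | exact: conj_fieldM].
have K2 := conj_fieldM (conj_field_rat d q) (conj_fieldM Kt Khh).
have /(congr1 snd) := conj_field_inj (cd_nsq CD) KT1 K2 E.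
rewrite /= => ->; rewrite E /= !expr2; ring.
Qed.

Lemma conj_ratio_bound d l m (a1 b1 a b a' b' T1' : R) :
  conjugate_data d l m a b a' b' -> a1 + b1 != 0 ->
  conj_field d ((a1 + b1) ^+ 2, T1') -> cusp_matching a1 b1 a b ->
  T1' * (a + b) ^+ 2 <= (a1 + b1) ^+ 2 * (a' + b') ^+ 2.
Proof.
move=> CD t1 KT /(matching_conj CD t1 KT) [k [mu [q0 [_ _ /(_ _ (gen2Y _ _))]]]].
rewrite mx2E sqrrN expr1n => /(_ erefl) [h [_ [h0 le] E _]].
have h2 : 0 < (h 1 0).1 ^+ 2 by rewrite exprn_even_gt0 //= h0.
rewrite -(ler_pM2r h2) -mulrA E -[leRHS]mulrA.
apply: ler_wpM2l; first exact: sqr_ge0.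
apply: ler_wpM2l; first exact: sqr_ge0.
by rewrite -[leLHS](real_normK (num_real _)) -[leRHS](real_normK (num_real _)) lerXn2r ?nnegrE.
Qed.

End ConjugatePairs.

(** * Cusps whose denominator has a conjugate of the same absolute value *)

Section EqualityCusps.
Variable R : realType.
Variables (a b : R * R) (l m : nat).
Implicit Types (w z : (R * R) * (R * R)) (x y : R * R).
Local Notation dom := (@dominated R).
Local Notation sdom := (@strictly_dominated R).
Hypotheses (m4 : (4 <= m)%N) (Ob : order_seq dom b m).
Hypothesis sdom_b : forall k, (1 < k < m.-1)%N -> sdom (sq b k).
Hypothesis a_cases : (a = 0 /\ l = 2) \/ [/\ a * a = 2, dom a, 0 < a.1 & l = 4].
Local Notation t := (a.1 + b.1).

(* The cusps, modulo t, of the powers of x applied to oo: here a.1 is 0 or sqrt 2,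
   so that a.1 / 2 = 1 / a.1 in the second case. *)
Definition equality_cusp (r : R) :=
  exists (n : int) (j : nat), (j <= 2)%N /\ r = n%:~R * t - j%:R * (a.1 / 2).

Lemma equality_cuspD r : equality_cusp r -> equality_cusp (t + r).
Proof.
move=> [n [j [j2 ->]]]; exists (n + 1), j; split=> //.
by rewrite rmorphD /= rmorph1; ring.
Qed.

Lemma equality_cuspN r : equality_cusp r -> equality_cusp (b.1 - r).
Proof.
move=> [n [j [j2 ->]]]; exists (1 - n), (2 - j)%N; split; first exact: leq_subr.
by rewrite rmorphB /= rmorph1 natrB //; field.
Qed.

Lemma equality_cusp_nat (n j : nat) : (j <= 2)%N -> equality_cusp (n%:R * t - j%:R * (a.1 / 2)).
Proof. by move=> j2; exists n%:Z, j. Qed.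

Lemma equality_cusp_b : equality_cusp b.1.
Proof. by have := @equality_cusp_nat 1 2 isT; congr equality_cusp; field. Qed.

Lemma equality_cusp_t : equality_cusp t.
Proof. by have := @equality_cusp_nat 1 0 isT; congr equality_cusp; field. Qed.

Lemma equality_cusp_ba : a * a = 2 -> 0 < a.1 -> equality_cusp (b.1 + a.1^-1).
Proof.
move=> /(congr1 fst) /= aa a0; have := @equality_cusp_nat 1 1 isT.
have -> : a.1^-1 = a.1 / 2 by rewrite -[2]/(1 + 1) -[X in _ = _ / X]aa; field; rewrite gt_eqF.
by congr equality_cusp; field.
Qed.

Local Notation e1 := ((1, 0) : (R * R) * (R * R)).
Local Notation e2 := ((0, 1) : (R * R) * (R * R)).
Local Notation quo x y := ((x : R * R).1 / (y : R * R).1).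

Definition positive x := dom x /\ 0 < x.1.

Lemma strictly_positive x : sdom x -> positive x.
Proof. by move=> Sx; split; [exact: strictlyW | exact: strictly_gt0 Sx]. Qed.

Lemma positive1 : positive 1.
Proof. by split; [exact: dominated1 | exact: ltr01]. Qed.

(** A column of a group element up to sign. An entry that is not strictly dominated must be the
    denominator of a known cusp. Both quotients are followed, because a power of x may exchange the
    entries. *)
Definition generic_vector w :=
  [/\ positive w.1, positive w.2, sdom w.1 \/ sdom w.2,
      sdom w.2 \/ equality_cusp (quo w.1 w.2) &
      sdom w.1 \/ equality_cusp (quo w.2 w.1)].
Definition good_vector w := [\/ w = e1, w = e2 | generic_vector w].

(** The first and the last nontrivial power of y turn the quotients into b + z1 / z2 and b + z2 /
    z1; hence the summand [b.1]. *)
Definition generic_image z :=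
  [/\ positive z.1, positive z.2,
      sdom z.1 \/ equality_cusp (b.1 + quo z.2 z.1) &
      sdom z.2 \/ equality_cusp (b.1 + quo z.1 z.2)].
(* The vectors (z1, z2) such that (z1, - z2) is the image of a good_vector under a
   power of x. *)
Definition good_image z := [\/ z = e1, z = e2 | generic_image z].

(** The action of a power of x on columns, with the signs removed, and likewise [yact] for y; see
    [app_powers_x] and [app_powers_y]. *)
Definition xact (k : nat) w : (R * R) * (R * R) :=
  (sq a k.+1 * w.1 + sq a k * w.2, sq a k * w.1 + sq a k.-1 * w.2).
Definition yact (k : nat) z : (R * R) * (R * R) :=
  (sq b k.-1 * z.1 + sq b k * z.2, sq b k * z.1 + sq b k.+1 * z.2).

Lemma generic_sdom w : generic_vector w -> sdom (w.1 + w.2) /\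
  (dom a -> 0 < a.1 -> sdom (a * w.1 + w.2) /\ sdom (w.1 + a * w.2)).
Proof.
move=> [[D1 p1] [D2 p2] S _ _]; split; first by case: S => S; [exact: strictlyDl | exact: strictlyDr].
move=> Da a0; case: S => S; split.
- by apply: strictlyDl => //; exact: strictlyMr.
- by apply: strictlyDl => //; exact: dominatedM.
- by apply: strictlyDr => //; exact: dominatedM.
- by apply: strictlyDr => //; exact: strictlyMr.
Qed.

(** The powers k = 1 and k = l - 1 keep an entry, and with it the condition on its cusp; for a^2 = 2
    the middle power makes both entries of a generic vector strictly dominated. *)
Lemma xact_good k w : (0 < k < l)%N -> good_vector w -> good_image (xact k w).
Proof.
case: a_cases => [[a0 ->]|[aa Da a0 ->]].
  case: k => [|[|k]] // _; rewrite /xact a0 /= !(mul0r, mul1r, add0r, addr0, subr0).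
  case: w => w1 w2 [[-> ->]|[-> ->]|]; [by constructor 2 | by constructor 1 |].
  move=> [/= P1 P2 _ S2 S1]; constructor 3; split=> //=.
    by case: S2 => [|/equality_cuspD C]; [by left | right; move: C; rewrite a0 add0r].
  by case: S1 => [|/equality_cuspD C]; [by left | right; move: C; rewrite a0 add0r].
have Pa : positive a by [].
have s3 : a * a - 1 = 1 by rewrite aa; ring.
have s4 : a * 1 - a = 0 by ring.
have P1 := positive1.
have Ca := equality_cusp_ba aa a0; have Ct := equality_cusp_t; have Cb := equality_cusp_b.
have Ct' : equality_cusp (b.1 + a.1) by rewrite addrC.
case: k => [|[|[|[|k]]]] // _; rewrite /xact /= !(mulr1, subr0, mulr0) ?s3 ?s4 !(mul0r, mul1r, add0r, addr0);
  case: w => w1 w2 [[-> ->]|[-> ->]|G] /=; rewrite ?(mulr1, mulr0, mul0r, mul1r, add0r, addr0).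
- by constructor 3; split=> //=; right; rewrite ?mul1r ?divr1.
- by constructor 1.
- have [_ /(_ Da a0) [Sz _]] := generic_sdom G; have [/= Q1 Q2 _ _ S1] := G.
  constructor 3; split=> //=; [exact: strictly_positive | by left |].
  case: S1 => [|/equality_cuspD C]; [by left | right]; move: C; congr equality_cusp.
  by field; rewrite gt_eqF //; case: Q1.
- by constructor 3; split=> //=; right; rewrite ?mul1r ?divr1.
- by constructor 3; split=> //=; right; rewrite ?mul1r ?divr1.
- have [_ /(_ Da a0) [Sz Sz']] := generic_sdom G.
  by constructor 3; split=> //=; [exact: strictly_positive | exact: strictly_positive | left | left].
- by constructor 2.
- by constructor 3; split=> //=; right; rewrite ?mul1r ?divr1.
- have [_ /(_ Da a0) [_ Sz]] := generic_sdom G; have [/= Q1 Q2 _ S2 _] := G.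
  constructor 3; split=> //=; [exact: strictly_positive | | by left].
  case: S2 => [|/equality_cuspD C]; [by left | right]; move: C; congr equality_cusp.
  by field; rewrite gt_eqF //; case: Q2.
Qed.

Lemma sq_b_dom k : (k <= m)%N -> dom (sq b k).
Proof.
have [_ L _ H] := Ob; rewrite leq_eqVlt => /orP[/eqP ->|/H //].
by rewrite L; exact: dominated0.
Qed.

Lemma sq_b_last : sq b m.-2 = b.
Proof.
have [_ L L' _] := Ob; case: m m4 L L' => [|[|[|n]]] // _ L L'.
by move: L; rewrite sqSS L' mulr1 => /eqP; rewrite subr_eq0 => /eqP <-.
Qed.

Lemma sdom_b1 : sdom b.
Proof. by rewrite -sq_b_last; apply: sdom_b; case: m m4 => [|[|[|[|n]]]] //=; rewrite ltnSn. Qed.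

Lemma base_good k : (k < m)%N -> good_vector (sq b k, sq b k.+1).
Proof.
have [_ L L' _] := Ob; have Sb := sdom_b1; have Pb := strictly_positive Sb.
have Cb := equality_cusp_b; have P1 := positive1.
case: k => [|[|k]] km; first by constructor 2.
  by rewrite /= mulr1 subr0; constructor 3; split=> //=; [right | left | right; rewrite divr1].
have [e|ne] := eqVneq k.+3 m; first by constructor 1; rewrite e L (_ : k.+2 = m.-1) ?L' // -e.
have [e'|ne'] := eqVneq k.+3 m.-1.
  rewrite e' L' (_ : k.+2 = m.-2) ?sq_b_last -?e' //; constructor 3; split=> //=; [by left | by right; rewrite divr1 | by left].
have S1 : sdom (sq b k.+2) by apply: sdom_b; move: ne ne' km; case: (m) => //= n; lia.
have S2 : sdom (sq b k.+3) by apply: sdom_b; move: ne ne' km; case: (m) => //= n; lia.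
by constructor 3; split; [exact: strictly_positive | exact: strictly_positive | left | left | left].
Qed.

(** On a generic image only k = 1 and k = m - 1 keep an entry; for the powers between them [sdom_b]
    makes both entries strictly dominated. *)
Lemma yact_good k z : (0 < k < m)%N -> good_image z -> good_vector (yact k z).
Proof.
have [_ L L' _] := Ob; have Sb := sdom_b1; have Pb := strictly_positive Sb.
case: k => [//|k] /= km; rewrite /yact; case: z => z1 z2 [[-> ->]|[-> ->]|/= [P1 P2 S1 S2]] /=.
- by rewrite !(mulr1, mulr0, addr0); apply: base_good; rewrite ltnW.
- by rewrite !(mulr1, mulr0, add0r); exact: (@base_good k.+1 km).
have [D1 D2] := (P1.1, P2.1).
case: k km => [|k] km.
  rewrite /= !(mul1r, mul0r, add0r, mulr1, subr0).
  have S : sdom (z1 + b * z2) by apply: strictlyDr => //; apply: strictlyMl => //; case: P2.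
  constructor 3; split=> //=; [exact: strictly_positive | by right | by left |].
  case: S2 => [|C]; [by left | right]; move: C; congr equality_cusp.
  by field; rewrite gt_eqF //; case: P2.
have [e|ne] := eqVneq k.+3 m.
  have E1 : sq b k.+2 = 1 by rewrite (_ : k.+2 = m.-1) // -e.
  have E2 : sq b k.+1 = b by have := sq_b_last; rewrite -e.
  change (good_vector (sq b k.+1 * z1 + sq b k.+2 * z2, sq b k.+2 * z1 + sq b k.+3 * z2)).
  rewrite e L E1 E2 !(mul1r, mul0r, addr0).
  have S : sdom (b * z1 + z2) by apply: strictlyDl => //; apply: strictlyMl => //; case: P1.
  constructor 3; split=> //=; [exact: strictly_positive | by left | | by left].
  case: S1 => [|C]; [by left | right]; move: C; congr equality_cusp.
  by field; rewrite gt_eqF //; case: P1.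
have S : sdom (sq b k.+2) by apply: sdom_b; move: ne km; case: (m) => //= n; lia.
have A1 : sdom (sq b k.+1 * z1 + sq b k.+2 * z2).
  apply: strictlyDr; last by apply: strictlyMl => //; case: P2.
  by apply: dominatedM => //; apply: sq_b_dom; do 2!apply: ltnW.
have A2 : sdom (sq b k.+2 * z1 + sq b k.+3 * z2).
  apply: strictlyDl; first by apply: strictlyMl => //; case: P1.
  by apply: dominatedM => //; exact: sq_b_dom.
by constructor 3; split; [exact: strictly_positive | exact: strictly_positive | left | left | left].
Qed.

Local Notation PX := (powers (xm a) l).
Local Notation PY := (powers (ym b) m).

Definition appv (g : 'M[R * R]_2) w : (R * R) * (R * R) :=
  (g 0 0 * w.1 + g 0 1 * w.2, g 1 0 * w.1 + g 1 1 * w.2).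

Lemma appM g h w : appv (g * h) w = appv g (appv h w).
Proof.
elim/mx2_ind: g => *; elim/mx2_ind: h => *; rewrite mulmx2 /appv !mx2E /=.
by congr (_, _); ring.
Qed.

Lemma appN g w : appv (- g) w = (- (appv g w).1, - (appv g w).2).
Proof. by rewrite /appv !mxE /=; congr (_, _); ring. Qed.

Lemma app_powers_x k w : (0 < k)%N ->
  appv (xm a ^+ k) w = ((xact k w).1, - (xact k w).2).
Proof. by case: k => // k _; rewrite xmX /appv /xact !mx2E sqSS; congr (_, _) => /=; ring. Qed.

Lemma app_powers_y k z : (0 < k)%N ->
  appv (ym b ^+ k) (z.1, - z.2) = (- (yact k z).1, - (yact k z).2).
Proof. by case: k => // k _; rewrite ymX /appv /yact !mx2E sqSS; congr (_, _) => /=; ring. Qed.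

Lemma mon_good n M w : mon PX PY n M -> good_vector w -> good_vector (appv M w).
Proof.
move=> HM Gw; elim: HM => [|k u v {}M [i iP ->] [j jP ->] _ IH].
  by rewrite /appv onemx2 !mx2E !(mul1r, mul0r, addr0, add0r); case: (w) Gw.
have [i0 j0] : (0 < i)%N /\ (0 < j)%N by case/andP: iP; case/andP: jP.
rewrite appM appN appM app_powers_x // app_powers_y //= !opprK.
exact: (yact_good jP (xact_good iP IH)).
Qed.

(** Apart from the prefix u, the first column of the normal form is a good vector up to sign;
    equality of the absolute values excludes that the denominator is strictly dominated. *)
Lemma gam_equality_cusp g : power_sets a b dom PX PY -> gam a b g ->
  (g 1 0).1 != 0 -> `|(g 1 0).2| = `|(g 1 0).1| -> equality_cusp (quo (g 0 0) (g 1 0)).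
Proof.
move=> ps /(NF_gam ps) [u [n [M [v [Pu HM Pv gE]]]]] g0 gn.
have app_e1 (h : 'M[R * R]_2) : appv h e1 = (h 0 0, h 1 0).
  by rewrite /appv /= !(mulr1, mulr0, addr0).
have [w Gw wE] : exists2 w, good_vector w & appv (M * v) e1 = w \/ appv (M * v) e1 = (- w.1, - w.2).
  case: Pv => [->|[k kP ->]].
    exists (appv M e1); last by left; rewrite mulr1.
    by apply: mon_good HM _; constructor 1.
  have k0 : (0 < k)%N by case/andP: kP.
  exists (appv M (yact k e1)); first by apply: mon_good HM _; apply: yact_good => //; constructor 1.
  right; rewrite appM; have := app_powers_y e1 k0; rewrite [LHS]/= oppr0 => ->.
  by rewrite /appv /=; congr (_, _); ring.
have [z Hz zE] : exists2 z, (z.1 = g 0 0 /\ z.2 = g 1 0) \/ (z.1 = - g 0 0 /\ z.2 = - g 1 0) &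
    z = appv u w.
  exists (appv u w) => //; have E : appv (u * M * v) e1 = appv u (appv (M * v) e1).
    by rewrite -appM mulrA.
  have E' : appv (u * M * v) e1 = appv u w \/ appv (u * M * v) e1 = (- (appv u w).1, - (appv u w).2).
    rewrite E; case: wE => ->; [by left | right].
    by rewrite /appv /=; congr (_, _); ring.
  have neg (h : 'M[R * R]_2) i j : (- h) i j = - h i j by rewrite mxE.
  move: E'; rewrite app_e1.
  by case: gE => -> -[] E'; have F1 : (u * M * v) 0 0 = _ := congr1 fst E';
    have F2 : (u * M * v) 1 0 = _ := congr1 snd E';
    [left | right | right | left]; rewrite ?neg F1 F2 /= ?opprK.
have zr : quo (g 0 0) (g 1 0) = quo z.1 z.2.
  by case: Hz => -[-> ->] //=; rewrite invrN mulrNN.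
have zn : z.2.1 != 0 /\ `|z.2.2| = `|z.2.1|.
  by case: Hz => -[_ ->] //=; rewrite !normrN oppr_eq0.
have [z0 nS] := zn; rewrite {}zr; move: z0 nS; rewrite {Hz zn} zE {z zE}.
case: Pu => [->|[k kP ->]].
  rewrite /appv onemx2 !mx2E !(mul1r, mul0r, addr0, add0r) /=.
  case: w Gw {wE} => w1 w2 [[-> ->]|[-> ->]|] /=; first by rewrite eqxx.
    by rewrite mul0r => _ _; have := @equality_cusp_nat 0 0 isT; congr equality_cusp; field.
  move=> [_ [_ w20] _ [S|C] _] _ // E.
  by move: S; rewrite /strictly_dominated E gtr0_norm // ltxx.
have k0 : (0 < k)%N by case/andP: kP.
rewrite app_powers_x //; move: (xact k w) (xact_good kP Gw) => [z1 z2] [[-> ->]|[-> ->]|] /=; first by rewrite oppr0 eqxx.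
  by rewrite mul0r => _ _; have := @equality_cusp_nat 0 0 isT; congr equality_cusp; field.
move=> [_ [_ /= z20] _ S2] _ nS.
have C : equality_cusp (b.1 + z1.1 / z2.1).
  case: S2 => // S; move: S; rewrite /strictly_dominated -normrN nS normrN.
  by rewrite gtr0_norm // ltxx.
have := equality_cuspN C; congr equality_cusp; rewrite invrN; ring.
Qed.

End EqualityCusps.

(** * Conjugate data of the target groups *)

Section PairSequences.
Variable A : comNzRingType.
Implicit Types c s : A.

(** The values sin (k pi / 12) / sin (pi / 12), with c = 2 cos (pi / 12) and s = sqrt 3; over pairs
    this covers the conjugate values at the same time. *)
Lemma sq_twelve c s : c * c = 2 + s -> s * s = 3 ->
  [seq sq c k | k <- iota 0 13] =
  [:: 0; 1; c; 1 + s; c * s; 2 + s; c + c; 2 + s; c * s; 1 + s; c; 1; 0].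
Proof.
move=> cc ss.
have E3 : c * c - 1 = 1 + s by rewrite cc; ring.
have E4 : c * (1 + s) - c = c * s by ring.
have E5 : c * (c * s) - (1 + s) = 2 + s.
  by rewrite mulrA cc; transitivity (s * s + s - 1); [ring | rewrite ss; ring].
have E6 : c * (2 + s) - c * s = c + c by ring.
have E7 : c * (c + c) - (2 + s) = 2 + s by rewrite mulrDr cc; ring.
have E8 : c * (2 + s) - (c + c) = c * s by ring.
have E9 : c * (c * s) - (2 + s) = 1 + s.
  by rewrite mulrA cc; transitivity (s * s + s - 2); [ring | rewrite ss; ring].
have E10 : c * (1 + s) - c * s = c by ring.
have E11 : c * c - (1 + s) = 1 by rewrite cc; ring.
by rewrite /= !(mulr1, subr0) !(E3, E4, E5, E6, E7, E8, E9, E10, E11) mulr1 subrr.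
Qed.

End PairSequences.

Section ConjugateData.
Variable R : realType.
Implicit Types (c s : R * R).
Local Notation dom := (@dominated R).
Local Notation sdom := (@strictly_dominated R).
Local Notation rt n := (Num.sqrt n%:R : R).
Local Notation c k := (cf R (Some k%N)).

Lemma order_seq2 : order_seq dom 0 2.
Proof.
have D0 := dominated0 R; have D1 := dominated1 R.
split; rewrite //= ?mul0r ?subr0 //.
by move=> [|[|k]].
Qed.

Lemma order_seq3 : order_seq dom 1 3.
Proof.
have D0 := dominated0 R; have D1 := dominated1 R.
split; rewrite //= ?(mul1r, subr0, subrr) //.
by move=> [|[|[|k]]] //=; rewrite mulr1 subr0.
Qed.

Lemma order_seq4 c : dom c -> c * c = 2 -> order_seq dom c 4.
Proof.
move=> Dc cc; have D0 := dominated0 R; have D1 := dominated1 R.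
have E3 : c * (c * 1 - 0) - 1 = 1 by rewrite mulr1 subr0 cc; ring.
split; rewrite //= ?E3 //; first by ring.
by move=> [|[|[|[|k]]]] //= _; rewrite ?E3 // mulr1 subr0.
Qed.

Lemma order_seq5 c : dom c -> c * c = c + 1 -> order_seq dom c 5.
Proof.
move=> Dc cc; have D0 := dominated0 R; have D1 := dominated1 R.
have E3 : c * (c * 1 - 0) - 1 = c by rewrite mulr1 subr0 cc; ring.
have E4 : c * c - (c * 1 - 0) = 1 by rewrite cc; ring.
split; rewrite //= ?E3 ?E4 //; first by ring.
by move=> [|[|[|[|[|k]]]]] //= _; rewrite ?E3 ?E4 // mulr1 subr0.
Qed.

Lemma order_seq12 c s : sdom c -> dom s -> 0 < s.1 -> sdom (1 + s) -> sdom (2 + s) ->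
  c * c = 2 + s -> s * s = 3 ->
  order_seq dom c 12 /\ forall k, (1 < k < 11)%N -> sdom (sq c k).
Proof.
move=> Sc Ds s0 S1 S2 cc ss; have D0 := dominated0 R; have D1 := dominated1 R.
have E k : (k < 13)%N -> sq c k = nth 0 [:: 0; 1; c; 1 + s; c * s; 2 + s; c + c; 2 + s;
    c * s; 1 + s; c; 1; 0] k.
  by move=> k13; rewrite -(sq_twelve cc ss) (nth_map 0%N) ?size_iota // nth_iota.
have Scs : sdom (c * s) by exact: strictlyMl.
have S2c : sdom (c + c) by apply: strictlyDl => //; exact: strictlyW.
have Str k : (1 < k < 11)%N -> sdom (sq c k).
  by move=> k11; rewrite E; [move: k k11; do 11!case=> // | lia].
split=> //; split=> //; [exact: (E 12%N) | exact: (E 11%N) |].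
move=> k k12; have [k11|] := boolP (1 < k < 11)%N; first by apply: strictlyW; exact: Str.
rewrite E; last by lia.
by move: k k12; do 12!case=> //.
Qed.

Lemma rt_gt0 n : (0 < n)%N -> 0 < rt n.
Proof. by move=> n0; rewrite sqrtr_gt0 ltr0n. Qed.

Lemma pair_order_seq12 (b b' : R) : 0 < b -> 0 <= b' -> b ^+ 2 = 2 + rt 3 ->
  b' ^+ 2 = 2 - rt 3 ->
  order_seq dom (b, b') 12 /\ forall k, (1 < k < 11)%N -> sdom (sq (b, b') k).
Proof.
move=> b0 b'0 bb bb'; have s0 := @rt_gt0 3 isT; have ss := sqE R 3.
apply: (@order_seq12 _ (rt 3, - rt 3)).
- rewrite /strictly_dominated /= ger0_norm //.
  by rewrite -(ltr_pXn2r (_ : 0 < 2)%N) ?nnegrE // ?(ltW b0) // bb bb'; lra.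
- by rewrite /dominated /= normrN ger0_norm // ltW.
- by [].
- by rewrite /strictly_dominated /= ltr_norml; apply/andP; split; lra.
- by rewrite /strictly_dominated /= ltr_norml; apply/andP; split; lra.
- by rewrite -[LHS]/(b * b, b' * b') -!expr2 bb bb'.
- rewrite -[LHS]/(rt 3 * rt 3, - rt 3 * - rt 3) mulrNN -expr2 ss.
  by congr (_, _); ring.
Qed.

Lemma conjugate_data_3_4 : conjugate_data 2 3 4 (c 3) (c 4) 1 (- rt 2).
Proof.
have s0 := @rt_gt0 2 isT; have ss := sqE R 2.
rewrite cf3 cf4; split.
- by apply: nonsquare.
- exact: order_seq3.
- apply: order_seq4; first by rewrite /dominated /= normrN ger0_norm // ltW.
  rewrite -[LHS]/(rt 2 * rt 2, - rt 2 * - rt 2) mulrNN -expr2 ss.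
  by congr (_, _); ring.
- exists 2, 0; rewrite rmorph0 !mul0r addr0 subr0 rmorph_nat.
  by rewrite expr2 -[LHS]/(rt 2 * rt 2, - rt 2 * - rt 2) mulrNN -expr2 ss.
- exists (rt 2 / 2, - rt 2 / 2).
    by exists 0, 2^-1; rewrite rmorph0 fmorphV rmorph_nat; congr (_, _); field.
  rewrite -[RHS]/(rt 2 * (rt 2 / 2), - rt 2 * (- rt 2 / 2)).
  have E : rt 2 * (rt 2 / 2) = 1 by rewrite mulrA -expr2 ss divff // pnatr_eq0.
  by congr (_, _); rewrite ?E //; transitivity (rt 2 * (rt 2 / 2)); [rewrite E | field].
Qed.

Lemma golden_pair : let b := (c 5, (1 - rt 5) / 2) in [/\ b * b = b + 1, dom b &
  conj_field 5 b].
Proof.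
have s0 := @rt_gt0 5 isT; have ss := sqE R 5; rewrite cf5; split.
- rewrite -[LHS]/((1 + rt 5) / 2 * ((1 + rt 5) / 2), (1 - rt 5) / 2 * ((1 - rt 5) / 2)).
  by rewrite -[RHS]/((1 + rt 5) / 2 + 1, (1 - rt 5) / 2 + 1); congr (_, _); lra.
- by rewrite /dominated /= ler_norml; apply/andP; split; lra.
- by exists 2^-1, 2^-1; rewrite fmorphV rmorph_nat; congr (_, _); field.
Qed.

Lemma conjugate_data_2_5 : conjugate_data 5 2 5 (c 2) (c 5) 0 ((1 - rt 5) / 2).
Proof.
have [bb Db Kb] := golden_pair; rewrite cf2; split.
- by apply: nonsquare.
- exact: order_seq2.
- exact: order_seq5.
- by rewrite expr2; exact: conj_fieldM.
- exists 0; last by rewrite mulr0.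
  by have := conj_field_rat R 5 0; rewrite rmorph0.
Qed.

Lemma conjugate_data_3_5 : conjugate_data 5 3 5 (c 3) (c 5) 1 ((1 - rt 5) / 2).
Proof.
have [bb Db Kb] := golden_pair; rewrite cf3; split.
- by apply: nonsquare.
- exact: order_seq3.
- exact: order_seq5.
- by rewrite expr2; exact: conj_fieldM.
- exists ((c 5, (1 - rt 5) / 2) - 1).
    by apply: conj_fieldB => //; exact: conj_field1.
  by rewrite mulrBr bb mulr1 addrC addKr.
Qed.

Local Notation b12' := (Num.sqrt (2 - rt 3) : R).

Lemma rt3_lt2 : rt 3 < 2.
Proof. by have s0 := @rt_gt0 3 isT; have := sqE R 3; nra. Qed.

Lemma b12'_sq : b12' ^+ 2 = 2 - rt 3.
Proof. by rewrite sqr_sqrtr // subr_ge0 ltW // rt3_lt2. Qed.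

Lemma seq12 : order_seq dom (c 12, b12') 12 /\
  forall k, (1 < k < 11)%N -> sdom (sq (c 12, b12') k).
Proof.
apply: pair_order_seq12; rewrite ?cfsq12 ?b12'_sq ?sqrtr_ge0 //.
by rewrite lt_neqAle eq_sym cf_neq0 // cf_ge0.
Qed.

Lemma conj_field_bb12 : conj_field 3 ((c 12, b12') ^+ 2).
Proof.
exists 2, 1; rewrite rmorph1 rmorph_nat mul1r expr2.
by rewrite -[LHS]/(c 12 * c 12, b12' * b12') -!expr2 cfsq12 b12'_sq.
Qed.

Lemma conjugate_data_2_12 : conjugate_data 3 2 12 (c 2) (c 12) 0 b12'.
Proof.
rewrite cf2; split.
- by apply: nonsquare.
- exact: order_seq2.
- by have [] := seq12.
- exact: conj_field_bb12.
- exists 0; last by rewrite mulr0.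
  by have := conj_field_rat R 3 0; rewrite rmorph0.
Qed.

Lemma rt2_b12' : rt 2 * b12' = rt 3 - 1.
Proof.
have s0 := @rt_gt0 3 isT; have ss := sqE R 3.
apply: sq_uniq; [by rewrite mulr_ge0 ?sqrtr_ge0 | by nra |].
by rewrite exprMn sqE b12'_sq; move: ss; nra.
Qed.

Lemma pair_rt2 : (c 4, - rt 2) * (c 4, - rt 2) = 2 /\ dom (c 4, - rt 2).
Proof.
have s0 := @rt_gt0 2 isT; have ss := sqE R 2; rewrite cf4; split.
  rewrite -[LHS]/(rt 2 * rt 2, - rt 2 * - rt 2) mulrNN -expr2 ss.
  by congr (_, _); ring.
by rewrite /dominated /= normrN ger0_norm // ltW.
Qed.

(** The conjugate of a b = 1 + sqrt 3 is 1 - sqrt 3 = - sqrt 2 b', so that the choice b' > 0 forces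
    a' = - sqrt 2. *)
Lemma conjugate_data_4_12 : conjugate_data 3 4 12 (c 4) (c 12) (- rt 2) b12'.
Proof.
have s0 := @rt_gt0 2 isT; have ss := sqE R 2; have s3 := sqE R 3.
have [cc Dc] := pair_rt2; split.
- by apply: nonsquare.
- exact: order_seq4.
- by have [] := seq12.
- exact: conj_field_bb12.
(* The quotient a / b = sqrt 3 - 1 and its conjugate. *)
- exists (rt 3 - 1, - rt 3 - 1).
    by exists (- 1), 1; rewrite rmorphN rmorph1; congr (_, _); ring.
  rewrite -[RHS]/(c 12 * (rt 3 - 1), b12' * (- rt 3 - 1)).
  have r0 : rt 2 != 0 by rewrite gt_eqF.
  have := cf4_12 R; have := rt2_b12'; rewrite cf4 => E' E.
  congr (_, _); apply: (mulfI r0).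
    by rewrite mulrA E -expr2 ss; transitivity (rt 3 ^+ 2 - 1); [rewrite s3; ring | ring].
  rewrite mulrA E' mulrN -expr2 ss.
  by transitivity (1 - rt 3 ^+ 2); [rewrite s3; ring | ring].
Qed.

End ConjugateData.

(** * Representatives of the classes and separation of the fields *)

Section Representatives.
Variable R : realType.
Local Notation rt n := (Num.sqrt n%:R : R).
Local Notation c k := (cf R (Some k%N)).
Local Notation b12' := (Num.sqrt (2 - Num.sqrt 3%:R) : R).

(** Squaring v sqrt d1 - v' sqrt d2 = u' - u gives a rational relation for sqrt (d1 d2), which is
    irrational. *)
Lemma sqrt_independent d1 d2 (z : R) (u v : rat) : (forall k, (k * k != d1)%N) ->
  (forall k, (k * k != d2)%N) -> (forall k, (k * k != d1 * d2)%N) ->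
  z = ratr u + ratr v * rt d1 -> v != 0 -> ~ Q_sqrt d2 z.
Proof.
move=> n1 n2 n12 zE v0 /(Q_sqrtP n2) [u' [v' E]].
have s1 := sqE R d1; have s2 := sqE R d2.
have s12 : rt (d1 * d2) = rt d1 * rt d2 by rewrite natrM sqrtrM.
have [v'0|v'0] := eqVneq v' 0.
  have [] := @qs_zero R d1 n1 (u - u') v; last by move=> _ v00; rewrite v00 eqxx in v0.
  by rewrite rmorphB /=; move: E; rewrite zE v'0 rmorph0 mul0r; lra.
have [] := @qs_zero R _ n12 ((u' - u) ^+ 2 - v ^+ 2 * d1%:R - v' ^+ 2 * d2%:R) (2 * v * v').
  rewrite s12 !(rmorphB, rmorphM, rmorphXn) /= !rmorph_nat.
  move: E s1 s2; rewrite zE; move: (rt d1) (rt d2) => w1 w2 E <- <-.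
  have -> : ratr u' - ratr u = ratr v * w1 - ratr v' * w2 :> R by lra.
  ring.
by move=> _ /eqP; rewrite !mulf_eq0 (negPf v0) (negPf v'0).
Qed.

(** The heads of the nine classes, in the same order. *)
Definition reps : seq (nat * nat) :=
  [:: (2, 8); (3, 4); (2, 12); (4, 12); (3, 6); (2, 10); (2, 5); (3, 5); (4, 6)]%N.

Definition rep_field (s : nat * nat) : nat :=
  if s \in [:: (2, 8); (3, 4)]%N then 2 else if s \in [:: (2, 10); (2, 5); (3, 5)]%N then 5
  else if s == (4, 6)%N then 6 else 3.

Local Notation t s := (c s.1 + c s.2).

Lemma rep_abfield s : s \in reps -> abfield (c s.1) (c s.2) = Q_sqrt (rep_field s).
Proof.
move=> Hs; suff /hasP [[d cl] /= Hcl /andP[/eqP <- Hs']] :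
    has (fun p => (p.1 == rep_field s) && ((Some s.1, Some s.2, None) \in p.2)) nine_classes.
  by have [l' [m' [[<- <-] _ _ ->]]] := nine_classes_field R Hcl Hs'.
by move: Hs; rewrite !inE; do ?[case/orP]; move/eqP=> ->.
Qed.

Lemma rep_t_sq s : s \in reps -> exists u v : rat, v != 0 /\
  t s ^+ 2 = ratr u + ratr v * rt (rep_field s).
Proof.
have sD (x y : R) : (x + y) ^+ 2 = x ^+ 2 + 2 * (x * y) + y ^+ 2 by ring.
have fin (s' : nat * nat) (u v : rat) : v != 0 ->
    t s' ^+ 2 = ratr u + ratr v * rt (rep_field s') ->
  exists u v : rat, v != 0 /\ t s' ^+ 2 = ratr u + ratr v * rt (rep_field s').
  by exists u, v.
have s2 := sqE R 2; have s3 := sqE R 3; have s5 := sqE R 5.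
rewrite !inE; do ?[case/orP]; move/eqP=> ->.
- by apply: (fin _ 2 1) => //=; rewrite cf2 add0r cfsq8 rmorph1 rmorph_nat mul1r.
- apply: (fin _ 3 2) => //=; rewrite cf3 cf4 !rmorph_nat sD s2; ring.
- by apply: (fin _ 2 1) => //=; rewrite cf2 add0r cfsq12 rmorph1 rmorph_nat mul1r.
- apply: (fin _ 6%:R 3) => //=; rewrite sD cf4_12 cfsq12 cf4 !rmorph_nat s2; ring.
- apply: (fin _ 4 2) => //=; rewrite cf3 cf6 !rmorph_nat sD s3; ring.
- apply: (fin _ (5 / 2) (1 / 2)) => //=; rewrite cf2 add0r cfsq10 !(fmorph_div, rmorph1, rmorph_nat) /=.
  by field.
- apply: (fin _ (3 / 2) (1 / 2)) => //=; rewrite cf2 add0r cfsq5 !(fmorph_div, rmorph1, rmorph_nat) /=.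
  by field.
- apply: (fin _ (7 / 2) (3 / 2)) => //=; rewrite cf3 sD cfsq5 cf5 !(fmorph_div, rmorph_nat) /=.
  by field.
- apply: (fin _ 5 2) => //=; rewrite sD cf4_6 cf4 cf6 s2 s3 !rmorph_nat; ring.
Qed.

Lemma rep_bounds s : s \in reps ->
  [/\ (2 <= s.1)%N, (2 <= s.2)%N, (2 < s.1)%N || (2 < s.2)%N, t s != 0 & c s.2 != 0].
Proof.
move=> Hs; have [l2 m2] : (2 <= s.1)%N /\ (2 < s.2)%N.
  by move: Hs; rewrite !inE; do ?[case/orP]; move/eqP=> ->.
have a0 := @cf_ge0 R (Some s.1) l2; have b0 : 0 < c s.2.
  by rewrite lt_neqAle eq_sym cf_neq0 ?cf_ge0 //= ?(ltnW m2) // ; apply/eqP => -[E]; rewrite E in m2.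
by split; rewrite ?m2 ?orbT ?(ltnW m2) // gt_eqF // ltr_wpDl.
Qed.

Lemma rep_matching s s' : s \in reps -> s' \in reps ->
  commensurable (gam (c s.1) (c s.2) : set 'M[R]_2) (gam (c s'.1) (c s'.2)) ->
  cusp_matching (c s.1) (c s.2) (c s'.1) (c s'.2).
Proof.
move=> /rep_bounds [l2 m2 lm t0 _] /rep_bounds [l2' m2' lm' t0' _].
by apply: commensurable_cusp_matching => // g; exact: gam_cf_parabolic.
Qed.

(** When the two ratios agree, the bound on the entries is attained, so the cusps 0 and - a1 both go
    to equality cusps; the affine map multiplies their difference a1 by k. *)
Lemma equality_matching l m (a1 b1 a b a' b' T1' : R) :
  conjugate_data 3 l m a b a' b' -> (4 <= m)%N ->
  (forall k, (1 < k < m.-1)%N -> strictly_dominated (sq (b, b') k)) ->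
  ((a, a') = 0 /\ l = 2) \/
    [/\ (a, a') * (a, a') = 2, dominated (a, a'), 0 < a & l = 4] ->
  a1 + b1 != 0 -> a' + b' != 0 -> conj_field 3 ((a1 + b1) ^+ 2, T1') ->
  T1' * (a + b) ^+ 2 = (a1 + b1) ^+ 2 * (a' + b') ^+ 2 ->
  cusp_matching a1 b1 a b ->
  exists (q : rat) (n i : int), [/\ q != 0, `|i| <= 2 &
    ratr q * (a + b) * a1 = (a1 + b1) * (n%:~R * (a + b) - i%:~R * (a / 2))].
Proof.
move=> CD m4 Sb Ca t1 t' KT TE /(matching_conj CD t1 KT) [k [mu [q [kq q0 H]]]].
have ps := conjugate_power_sets CD; have [_ _ Ob _ _] := CD.
have main g : gam a1 b1 g -> g 1 0 ^+ 2 = 1 ->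
    equality_cusp (a, a') (b, b') (k * (g 0 0 / g 1 0) + mu).
  move=> Gg /(H g Gg) [h [Gh [h0 _] E <-]].
  apply: (gam_equality_cusp m4 Ob Sb Ca ps Gh h0).
  have E' : (a1 + b1) ^+ 2 * (a' + b') ^+ 2 * (h 1 0).1 ^+ 2 =
      (a1 + b1) ^+ 2 * (a' + b') ^+ 2 * (h 1 0).2 ^+ 2 by rewrite -TE -mulrA E mulrA TE.
  have nz : (a1 + b1) ^+ 2 * (a' + b') ^+ 2 != 0.
    by rewrite mulf_neq0 // expf_neq0.
  have /eqP := mulfI nz E'; rewrite eqf_sqr => /orP[] /eqP ->; by rewrite ?normrN.
(* The cusp of [ym b1] is 0 and that of [xm a1] is - a1. *)
have [|n1 [j1 [j1_2]]] := main _ (gen2Y _ _); first by rewrite mx2E sqrrN expr1n.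
rewrite !mx2E mul0r mulr0 add0r /= => E1.
have [|n2 [j2 [j2_2]]] := main _ (gen2X _ _); first by rewrite mx2E sqrrN expr1n.
rewrite !mx2E invrN1 mulrN1 /= => E2.
exists q, (n1 - n2), (j1%:Z - j2%:Z); split=> //; first by lia.
have -> : ratr q * (a + b) * a1 = (a1 + b1) * (k * a1) by rewrite -kq; ring.
congr (_ * _); rewrite !rmorphB /=.
have -> : k * a1 = mu - (k * - a1 + mu) by ring.
by rewrite E2 E1 -!pmulrn; ring.
Qed.

Lemma fields_not_commensurable s s' : s \in reps -> s' \in reps ->
  rep_field s != rep_field s' ->
  ~ commensurable (gam (c s.1) (c s.2) : set 'M[R]_2) (gam (c s'.1) (c s'.2)).
Proof.
move=> Hs Hs' ne /(rep_matching Hs Hs') M; have [_ _ _ _ b0] := rep_bounds Hs'.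
have := cusp_matching_field b0 M; rewrite rep_abfield //.
have [u [v [v0 E]]] := rep_t_sq Hs.
have in4 r : rep_field r \in [:: 2; 3; 5; 6]%N by rewrite /rep_field; do 3?[case: ifP].
have := in4 s; have := in4 s'; move: ne E; move: (rep_field s) (rep_field s') => d d' ne E Hd' Hd.
apply: sqrt_independent E v0; apply: nonsquare.
- by move: Hd; rewrite !inE; do ?[case/orP]; move=> /eqP ->.
- by move: Hd'; rewrite !inE; do ?[case/orP]; move=> /eqP ->.
- by move: Hd Hd' ne; rewrite !inE; do ?[case/orP]; move=> /eqP ->; do ?[case/orP]; move=> /eqP ->.
Qed.

End Representatives.

(** * Classes with the same field *)

Section SameField.
Variable R : realType.
Local Notation rt n := (Num.sqrt n%:R : R).
Local Notation c k := (cf R (Some k%N)).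
Local Notation b12' := (Num.sqrt (2 - Num.sqrt 3%:R) : R).
Local Notation comm s s' := (commensurable (gam (c s.1) (c s.2) : set 'M[R]_2) (gam (c s'.1) (c s'.2))).
Local Notation t s := (c s.1 + c s.2).

Let sD (x y : R) : (x + y) ^+ 2 = x ^+ 2 + 2 * (x * y) + y ^+ 2.
Proof. ring. Qed.

Lemma t_2_8 : (c 2 + c 8) ^+ 2 = 2 + rt 2.
Proof. by rewrite cf2 add0r cfsq8. Qed.

Lemma t_2_10 : (c 2 + c 10) ^+ 2 = (5 + rt 5) / 2.
Proof. by rewrite cf2 add0r cfsq10. Qed.

Lemma t_2_5 : (c 2 + c 5) ^+ 2 = (3 + rt 5) / 2.
Proof. by rewrite cf2 add0r cfsq5. Qed.

Lemma t_2_12 : (c 2 + c 12) ^+ 2 = 2 + rt 3.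
Proof. by rewrite cf2 add0r cfsq12. Qed.

Lemma t_4_12 : (c 4 + c 12) ^+ 2 = 6 + 3 * rt 3.
Proof. by rewrite sD cf4_12 cfsq12 cf4 sqE; ring. Qed.

Lemma t_3_6 : (c 3 + c 6) ^+ 2 = 4 + 2 * rt 3.
Proof. by rewrite cf3 cf6 sD sqE; ring. Qed.

(** (t' / t)^2 is about 0.17 for (2, 8) and 0.03 for (3, 4), against [conj_ratio_bound]. *)
Lemma nc_2_8__3_4 : ~ comm (2, 8)%N (3, 4)%N.
Proof.
move=> /(rep_matching (s := (2, 8)%N) (s' := (3, 4)%N) isT isT) M.
have [_ _ _ t0 _] := @rep_bounds R (2, 8)%N isT.
have K : conj_field 2 ((c 2 + c 8) ^+ 2, 2 - rt 2).
  by exists 2, 1; rewrite t_2_8 rmorph1 rmorph_nat mul1r.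
have := conj_ratio_bound (conjugate_data_3_4 R) t0 K M.
rewrite t_2_8 cf3 cf4; have s0 := @rt_gt0 R 2 isT; have s2 := sqE R 2.
have s3 : rt 2 ^+ 3 = 2 * rt 2 by rewrite exprS s2 mulrC.
lra.
Qed.

Lemma conj_field_2_10 : conj_field 5 ((c 2 + c 10) ^+ 2, (5 - rt 5) / 2).
Proof.
exists (5 / 2), (1 / 2); rewrite t_2_10 !(fmorph_div, rmorph1, rmorph_nat) /=.
by congr (_, _); field.
Qed.

(** (t' / t)^2 is about 0.38 for (2, 10), 0.15 for (2, 5) and 0.02 for (3, 5), which fixes the
    direction here and in the next two lemmas. *)
Lemma nc_2_10__2_5 : ~ comm (2, 10)%N (2, 5)%N.
Proof.
move=> /(rep_matching (s := (2, 10)%N) (s' := (2, 5)%N) isT isT) M.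
have [_ _ _ t0 _] := @rep_bounds R (2, 10)%N isT.
have := conj_ratio_bound (conjugate_data_2_5 R) t0 conj_field_2_10 M.
rewrite t_2_10 t_2_5; have s0 := @rt_gt0 R 5 isT; have s2 := sqE R 5.
have s3 : rt 5 ^+ 3 = 5 * rt 5 by rewrite exprS s2 mulrC.
lra.
Qed.

Lemma nc_2_10__3_5 : ~ comm (2, 10)%N (3, 5)%N.
Proof.
move=> /(rep_matching (s := (2, 10)%N) (s' := (3, 5)%N) isT isT) M.
have [_ _ _ t0 _] := @rep_bounds R (2, 10)%N isT.
have := conj_ratio_bound (conjugate_data_3_5 R) t0 conj_field_2_10 M.
rewrite t_2_10 cf3 cf5; have s0 := @rt_gt0 R 5 isT; have s2 := sqE R 5.
have s3 : rt 5 ^+ 3 = 5 * rt 5 by rewrite exprS s2 mulrC.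
lra.
Qed.

Lemma nc_2_5__3_5 : ~ comm (2, 5)%N (3, 5)%N.
Proof.
move=> /(rep_matching (s := (2, 5)%N) (s' := (3, 5)%N) isT isT) M.
have [_ _ _ t0 _] := @rep_bounds R (2, 5)%N isT.
have K : conj_field 5 ((c 2 + c 5) ^+ 2, (3 - rt 5) / 2).
  exists (3 / 2), (1 / 2); rewrite t_2_5 !(fmorph_div, rmorph1, rmorph_nat) /=.
  by congr (_, _); field.
have := conj_ratio_bound (conjugate_data_3_5 R) t0 K M.
rewrite t_2_5 cf3 cf5; have s0 := @rt_gt0 R 5 isT; have s2 := sqE R 5.
have s3 : rt 5 ^+ 3 = 5 * rt 5 by rewrite exprS s2 mulrC.
lra.
Qed.

Lemma conj_field_4_12 : conj_field 3 ((c 4 + c 12) ^+ 2, 6 - 3 * rt 3).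
Proof. by exists 6, 3; rewrite t_4_12 !rmorph_nat. Qed.

Lemma conj_field_3_6 : conj_field 3 ((c 3 + c 6) ^+ 2, 4 - 2 * rt 3).
Proof. by exists 4, 2; rewrite t_3_6 !rmorph_nat. Qed.

Lemma b12'_gt0 : 0 < b12'.
Proof. by rewrite sqrtr_gt0 subr_gt0 rt3_lt2. Qed.

(** As a = 0 for (2, 12), the equality cusps are the integral multiples of t, which leaves a single
    integer n. *)
Lemma equality_2_12 a1 b1 T1' : a1 + b1 != 0 -> conj_field 3 ((a1 + b1) ^+ 2, T1') ->
  T1' * (2 + rt 3) = (a1 + b1) ^+ 2 * (2 - rt 3) -> cusp_matching a1 b1 (c 2) (c 12) ->
  exists (q : rat) (n : int), q != 0 /\ ratr q * a1 = n%:~R * (a1 + b1).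
Proof.
move=> t0 K E M; have [_ Sb] := seq12 R.
have [_ _ _ t2 _] := @rep_bounds R (2, 12)%N isT.
have [|||q [n [i [q0 _ H]]]] := equality_matching (conjugate_data_2_12 R) isT Sb _ t0 _ K _ M.
- by left; split=> //; rewrite cf2.
- by rewrite add0r gt_eqF // b12'_gt0.
- by rewrite t_2_12 add0r b12'_sq.
exists q, n; split=> //; apply: (mulfI t2); move: H; rewrite cf2 /=; lra.
Qed.

Lemma sqrt3_lin (u v : rat) : ratr u + ratr v * rt 3 = 0 -> u = 0 /\ v = 0.
Proof. by apply: qs_zero; apply: nonsquare. Qed.

Lemma nc_4_12__2_12 : ~ comm (4, 12)%N (2, 12)%N.
Proof.
move=> /(rep_matching (s := (4, 12)%N) (s' := (2, 12)%N) isT isT) M.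
have [_ _ _ t0 _] := @rep_bounds R (4, 12)%N isT; have s3 := sqE R 3.
have [|q [n [q0 E]]] := equality_2_12 t0 conj_field_4_12 _ M.
  by rewrite t_4_12; lra.
have [] := @sqrt3_lin (2 * q - 3 * n%:~R) (- n%:~R).
  rewrite !(rmorphB, rmorphN, rmorphM) /= !rmorph_nat rmorph_int.
  (* Multiplication by sqrt 2 brings the equation into Q (sqrt 3), because a b = 1 + sqrt 3. *)
  have := congr1 (fun x => c 4 * x) E.
  have -> : c 4 * (n%:~R * (c 4 + c 12)) = n%:~R * (c 4 ^+ 2 + c 4 * c 12) by ring.
  have -> : c 4 * (ratr q * c 4) = ratr q * c 4 ^+ 2 by ring.
  rewrite cf4_12 cf4 sqE; lra.
move=> E1 /eqP; rewrite oppr_eq0 => /eqP E2; move: E1; rewrite E2 mulr0 subr0 => /eqP.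
by rewrite mulf_eq0 (negPf q0).
Qed.

Lemma nc_3_6__2_12 : ~ comm (3, 6)%N (2, 12)%N.
Proof.
move=> /(rep_matching (s := (3, 6)%N) (s' := (2, 12)%N) isT isT) M.
have [_ _ _ t0 _] := @rep_bounds R (3, 6)%N isT; have s3 := sqE R 3.
have [|q [n [q0 E]]] := equality_2_12 t0 conj_field_3_6 _ M.
  by rewrite t_3_6; lra.
have [] := @sqrt3_lin (q - n%:~R) (- n%:~R).
  rewrite !(rmorphB, rmorphN) /= !rmorph_int.
  by move: E; rewrite /= cf3 cf6; lra.
move=> E1 /eqP; rewrite oppr_eq0 => /eqP E2; move: E1; rewrite E2 subr0 => /eqP.
by rewrite (negPf q0).
Qed.

Lemma nc_3_6__4_12 : ~ comm (3, 6)%N (4, 12)%N.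
Proof.
move=> /(rep_matching (s := (3, 6)%N) (s' := (4, 12)%N) isT isT) M.
have [_ _ _ t0 _] := @rep_bounds R (3, 6)%N isT; have s3 := sqE R 3; have s2 := sqE R 2.
have [_ Sb] := seq12 R; have [aa Da] := pair_rt2 R.
have a0 : 0 < c 4 by rewrite cf4 rt_gt0.
have E' := rt2_b12' R.
have t'2 : (- rt 2 + b12') ^+ 2 = 6 - 3 * rt 3.
  by rewrite sD mulNr E' b12'_sq sqrrN s2; ring.
have s30 := @rt_gt0 R 3 isT.
have [|||q [n [i [q0 i2 H]]]] := equality_matching (conjugate_data_4_12 R) isT Sb _ t0 _ conj_field_3_6 _ M.
- by right.
- by apply/eqP => z; move: t'2; rewrite z expr0n /=; nra.
- by rewrite t_3_6 t_4_12 t'2; lra.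
have {H} : ratr q * (3 + rt 3) = (1 + rt 3) * (n%:~R * (3 + rt 3) - i%:~R) :> R.
  have := congr1 (fun x => rt 2 * x) H; rewrite /= cf3 cf6 mulr1.
  have -> : rt 2 * (ratr q * (c 4 + c 12)) = ratr q * (rt 2 * c 4 + c 4 * c 12) by rewrite cf4; ring.
  have -> : rt 2 * ((1 + rt 3) * (n%:~R * (c 4 + c 12) - i%:~R * (c 4 / 2))) =
     (1 + rt 3) * (n%:~R * (rt 2 * c 4 + c 4 * c 12) - i%:~R * (rt 2 * c 4 / 2)).
    by rewrite cf4; ring.
  rewrite cf4_12 cf4 -expr2 s2 => E0; have -> : 3 + rt 3 = 2 + (1 + rt 3) by ring.
  by rewrite E0; congr (_ * (_ - _)); field.
move=> H; have [] := @sqrt3_lin (3 * q - (6 * n%:~R - i%:~R)) (q - (4 * n%:~R - i%:~R)).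
  rewrite !(rmorphB, rmorphM) /= !rmorph_nat !rmorph_int.
  have : (1 + rt 3) * (n%:~R * (3 + rt 3) - i%:~R) =
      3 * n%:~R + 4 * n%:~R * rt 3 + n%:~R * rt 3 ^+ 2 - i%:~R - i%:~R * rt 3 by ring.
  by rewrite -H s3; lra.
(* The two components give 3 q = 6 n - i and q = 4 n - i, hence i = 3 n; the bound |i| <= 2 leaves n
   = i = 0, and then q = 0. *)
move=> H1 H2; have /eqP : (3 * n - i)%:~R = 0 :> rat.
  by rewrite rmorphB rmorphM /=; lra.
rewrite intr_eq0 => /eqP H3; have n0 : n = 0 by lia.
move: q0; rewrite (_ : q = 0) ?eqxx //.
have i0 : i = 0 by lia.
by move: H2; rewrite n0 i0; lra.
Qed.

Lemma reps_not_commensurable p p' : p \in reps -> p' \in reps -> p != p' -> ~ comm p p'.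
Proof.
move=> Hp Hp' ne; have [E|] := eqVneq (rep_field p) (rep_field p'); last first.
  exact: fields_not_commensurable.
(* In each pair the first group has the larger |t' / t|. Over sqrt 3 the ratios agree, and the
   targets are the groups whose equality cusps are known. *)
pose L := [:: ((2, 8), (3, 4)); ((2, 10), (2, 5)); ((2, 10), (3, 5)); ((2, 5), (3, 5));
  ((4, 12), (2, 12)); ((3, 6), (2, 12)); ((3, 6), (4, 12))]%N.
have nc q q' : (q, q') \in L -> ~ comm q q'.
  rewrite !inE; do ?[case/orP]; move=> /eqP [-> ->].
  - exact: nc_2_8__3_4.
  - exact: nc_2_10__2_5.
  - exact: nc_2_10__3_5.
  - exact: nc_2_5__3_5.
  - exact: nc_4_12__2_12.
  - exact: nc_3_6__2_12.
  - exact: nc_3_6__4_12.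
have /allP /(_ _ Hp) /allP /(_ _ Hp') : all (fun q => all (fun q' =>
    [|| q == q', rep_field q != rep_field q', (q, q') \in L | (q', q) \in L]) reps) reps by [].
rewrite (negPf ne) E eqxx /= => /orP[/nc //|/nc H C].
by apply: H; apply: commensurable_sym => //; exact: gam_psl.
Qed.

(** Besides its head a class contains at most (m, m, oo) and, for m = 2 k, (k, oo, oo), both up to
    conjugation of index 2 in the head (2, m, oo). *)
Lemma class_rep d cl s : (d, cl) \in nine_classes -> s \in cl ->
  exists p l m, [/\ p \in reps, s = (l, m, None),
    forall s0, head s0 cl = (Some p.1, Some p.2, None) &
    commensurable (gam (cf R l) (cf R m) : set 'M[R]_2) (gam (c p.1) (c p.2))].
Proof.
have refl a b : commensurable (gam a b : set 'M[R]_2) (gam a b).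
  by apply: commensurable_sub; [exact: gam_psl | exact: gam_psl | exact/fin_index_refl/gam_psl].
have mm m : (2 <= m)%N -> commensurable (gam (c m) (c m) : set 'M[R]_2) (gam (c 2) (c m)).
  by move=> m2; rewrite cf2; exact: index2_mm.
have koo k : (2 <= k)%N -> commensurable (gam (c k) (cf R None) : set 'M[R]_2) (gam (c 2) (c (2 * k))).
  move=> k2; rewrite cf2 cf_oo; have -> : c k = c (2 * k) ^+ 2 - 2 by rewrite cf_double //; ring.
  apply: index2_koo; rewrite lt_neqAle eq_sym cf_neq0 ?cf_ge0 //= ?(leq_trans k2) ?leq_pmull //.
  by apply/eqP => -[]; lia.
move=> H1 H2; rewrite !inE in H1.
repeat match goal with H : is_true (_ || _) |- _ => move/orP: H => [H|H] end;
move/eqP: H1 => [? ?]; subst d cl; rewrite !inE in H2;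
repeat match goal with H : is_true (_ || _) |- _ => move/orP: H => [H|H] end;
move/eqP: H2 => ?; subst s.
- by exists (2, 8)%N, (Some 2%N), (Some 8%N).
- by exists (2, 8)%N, (Some 8%N), (Some 8%N); split=> //; exact: mm.
- by exists (2, 8)%N, (Some 4%N), None; split=> //; exact: (koo 4%N).
- by exists (3, 4)%N, (Some 3%N), (Some 4%N).
- by exists (2, 12)%N, (Some 2%N), (Some 12%N).
- by exists (2, 12)%N, (Some 12%N), (Some 12%N); split=> //; exact: mm.
- by exists (2, 12)%N, (Some 6%N), None; split=> //; exact: (koo 6%N).
- by exists (4, 12)%N, (Some 4%N), (Some 12%N).
- by exists (3, 6)%N, (Some 3%N), (Some 6%N).
- by exists (2, 10)%N, (Some 2%N), (Some 10%N).
- by exists (2, 10)%N, (Some 10%N), (Some 10%N); split=> //; exact: mm.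
- by exists (2, 10)%N, (Some 5%N), None; split=> //; exact: (koo 5%N).
- by exists (2, 5)%N, (Some 2%N), (Some 5%N).
- by exists (2, 5)%N, (Some 5%N), (Some 5%N); split=> //; exact: mm.
- by exists (3, 5)%N, (Some 3%N), (Some 5%N).
- by exists (4, 6)%N, (Some 4%N), (Some 6%N).
Qed.

Lemma triangle_group_commensurable l m (G : set 'M[R]_2) : triangle_group (l, m, None) G ->
  psl_subgroup G /\ commensurable G (gam (cf R l) (cf R m)).
Proof.
move=> /triangle_group_gam [C [dC CG]]; have UC := detpm1_unit dC.
have PG : psl_subgroup G.
  by rewrite -(conjV_K G UC) CG; apply: psl_conj; [rewrite unitrV | exact: gam_psl].
by split=> //; exact: commensurable_conj dC CG.
Qed.

Lemma sixteen_class s : s \in sixteen_signatures ->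
  exists d cl, (d, cl) \in nine_classes /\ s \in cl.
Proof.
move=> Hs; have /allP /(_ s Hs) /hasP [[d cl] H1 H2] :
    all (fun s => has (fun p => s \in p.2) nine_classes) sixteen_signatures by [].
by exists d, cl.
Qed.

End SameField.

Theorem mainTheorem7 (R : realType) :
  (* the sixteen groups are the noncocompact triangle groups of arithmetic
     dimension 2, equivalently with quadratic invariant trace field *)
  (forall (s : signature) (G : set 'M[R]_2),
     hyperbolic_signature s -> triangle_group s G ->
     (s \in sixteen_signatures <->
        ~ cocompact G /\ arithmetic_dimension G 2) /\
     (s \in sixteen_signatures <->
        ~ cocompact G /\ degree_over_Q (invariant_trace_field G) 2)) /\
  (* the nine classes partition them *)
  perm_eq (flatten [seq c.2 | c <- nine_classes]) sixteen_signatures /\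
  (forall (s s' : signature) (G G' : set 'M[R]_2),
     s \in sixteen_signatures -> s' \in sixteen_signatures ->
     triangle_group s G -> triangle_group s' G' ->
     (commensurable G G' <->
        exists2 c, c \in nine_classes & (s \in c.2) && (s' \in c.2))) /\
  (* their invariant trace fields *)
  (forall (d : nat) (c : seq signature) (s : signature) (G : set 'M[R]_2),
     (d, c) \in nine_classes -> s \in c -> triangle_group s G ->
     invariant_trace_field G = Q_sqrt d).
Proof.
split; [|split; [by [] | split]].
(* For finite n the group is cocompact and the signature is not in the list. *)
- case=> [[l m] [n|]] G hyp tri.
    have co := compact_triangle_group hyp tri.
    have ns : (l, m, Some n) \notin sixteen_signatures.
      by rewrite !inE !xpair_eqE !andbF.
    by split; split=> [s16|[]//]; rewrite (negPf ns) in s16.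
  have [l2 lm _ _] := hyp.
  have m2 : le_oo (Some 2%N) m.
    by move: l2 lm; case: (l) => [l'|]; case: (m) => [m'|] //=; exact: leq_trans.
  have [C [dC CG]] := triangle_group_gam tri.
  have nco := gam_not_cocompact l2 m2 dC CG.
  by have [-> ->] := noncompact_classification hyp tri; split; split=> [|[]].
- move=> s s' G G' s16 s16' tri tri'.
  have GP := @gam_psl R; split=> [C|[[d cl] /= Hcl /andP[Hs Hs']]].
    have [d [cl [Hcl Hs]]] := sixteen_class s16.
    have [d' [cl' [Hcl' Hs']]] := sixteen_class s16'.
    have [p [l [m [Hp sE hp Cp]]]] := class_rep R Hcl Hs.
    have [p' [l' [m' [Hp' sE' hp' Cp']]]] := class_rep R Hcl' Hs'.
    rewrite sE in tri; rewrite sE' in tri'.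
    have [PG CG] := triangle_group_commensurable tri.
    have [PG' CG'] := triangle_group_commensurable tri'.
    have C1 := commensurable_trans PG (GP _ _) (GP _ _) CG Cp.
    have C2 := commensurable_trans PG' (GP _ _) (GP _ _) CG' Cp'.
    have C3 := commensurable_trans (GP _ _) PG (GP _ _)
      (commensurable_sym PG (GP _ _) C1) (commensurable_trans PG PG' (GP _ _) C C2).
    have pp' : p = p'.
      by apply/eqP/negP => /negP ne; exact: reps_not_commensurable Hp Hp' ne C3.
    (* The heads of the classes are distinct, so equal representatives come from the same class. *)
    have /allP /(_ _ Hcl) /allP /(_ _ Hcl') : all (fun x => all (fun y =>
        (head s x.2 == head s y.2) ==> (x == y)) nine_classes) nine_classes by [].
    rewrite /= hp hp' pp' eqxx /= => /eqP E; exists (d, cl) => //=.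
    by rewrite Hs (congr1 snd E : cl = cl').
  have [p [l [m [Hp sE hp Cp]]]] := class_rep R Hcl Hs.
  have [p' [l' [m' [Hp' sE' hp' Cp']]]] := class_rep R Hcl Hs'.
  rewrite sE in tri; rewrite sE' in tri'.
  have [PG CG] := triangle_group_commensurable tri.
  have [PG' CG'] := triangle_group_commensurable tri'.
  have C1 := commensurable_trans PG (GP _ _) (GP _ _) CG Cp.
  have C2 := commensurable_trans PG' (GP _ _) (GP _ _) CG' Cp'.
  have := hp s; rewrite hp' => -[E1 E2]; rewrite E1 E2 in C2.
  exact: commensurable_trans PG (GP _ _) PG' C1 (commensurable_sym PG' (GP _ _) C2).
- move=> d cl s G Hcl Hs tri; have [l [m [sE d4 s16 <-]]] := nine_classes_field R Hcl Hs.
  rewrite sE in tri s16; have [C [dC CG]] := triangle_group_gam tri.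
  have [PG _] := triangle_group_commensurable tri.
  have dG g : G g -> detpm1 g by case: PG => _ Gd _ _ /Gd.
  rewrite -(invariant_trace_field_conj (detpm1_unit dC) dG) CG gam_trace_field //.
  have {s16} : (l, m, None) \in sixteen_signatures := s16.
  rewrite !inE !xpair_eqE eqxx !andbT.
  by do ?[case/orP]; move=> /andP[_ /eqP ->]; exact: cf_neq0.
Qed.
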